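(* Let $\mathcal{L}$ be the operator $$\mathcal{L}=\frac{1}{V(x)}\sum_{i,j=1}^N\frac{\partial}{\partial x_i}\Big(V(x)\,a_{i,j}(x)\,\frac{\partial}{\partial x_j}\Big),\qquad x\in\mathbb{R}^N,$$ where $V\in C^\infty(\mathbb{R}^N,\mathbb{R})$ is positive, $a_{i,j}\in C^\infty(\mathbb{R}^N,\mathbb{R})$, and the matrix $A(x)=(a_{i,j}(x))_{i,j}$ is symmetric and positive semi-definite for every $x\in\mathbb{R}^N$. Assume that $A(x)\neq 0$ for every $x\in\mathbb{R}^N$. Let $c\in C^\infty(\mathbb{R}^N,\mathbb{R})$ be nonnegative and suppose that the operator $\mathcal{L}_c:=\mathcal{L}-c$ is $C^\infty$-hypoelliptic on every open subset of $\mathbb{R}^N$. If $\Omega\subseteq\mathbb{R}^N$ is a connected open set, then any function $u\in C^2(\Omega,\mathbb{R})$ satisfying $\mathcal{L}_c u\geq 0$ on $\Omega$ and attaining a nonnegative maximum in $\Omega$ is constant throughout $\Omega$.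
   Context: A linear differential operator $L$ with smooth coefficients is $C^\infty$-hypoelliptic in an open set $\Omega\subseteq\mathbb{R}^N$ if, for every distribution $u\in\mathcal{D}'(\Omega)$, every open set $U\subseteq\Omega$ and every $f\in C^\infty(U,\mathbb{R})$, the equation $Lu=f$ in $U$ (in the sense of distributions) implies that $u$ is (a function-type distribution associated with) a $C^\infty$ function on $U$. The operator $\mathcal{L}-c$ acts as $u\mapsto\mathcal{L}u-c\,u$. *)

(* Defs.v *)
From mathcomp Require Import all_boot all_order all_algebra.
From mathcomp Require Import all_classical all_reals all_analysis.

Set Implicit Arguments.
Unset Strict Implicit.
Unset Printing Implicit Defensive.

Import Order.TTheory GRing.Theory Num.Theory.
Import numFieldNormedType.Exports.

Local Open Scope classical_set_scope.
Local Open Scope ring_scope.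

(* Points of R^N are row vectors, with the library's topology on matrices.
   A function on an open subset U of R^N is represented by a total function on
   R^N whose values outside U are irrelevant. *)

Section Smoothness.
Variables (R : realType) (N : nat).
Implicit Types (U K : set 'rV[R]_N) (f : 'rV[R]_N -> R).

Definition partial (i : 'I_N) f : 'rV[R]_N -> R :=
  fun x => 'D_(delta_mx ord0 i) f x.

Definition iter_partial (s : seq 'I_N) f : 'rV[R]_N -> R := foldr partial f s.

Fixpoint Ck (k : nat) U f : Prop :=
  (forall x, U x -> {for x, continuous f}) /\
  match k with
  | 0 => True
  | k'.+1 => forall i : 'I_N,
      (forall x, U x -> derivable f x (delta_mx ord0 i)) /\
      Ck k' U (partial i f)
  end.

Definition smooth U f : Prop := forall k, Ck k U f.

Definition smooth_supported_in K f : Prop :=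
  smooth setT f /\ forall x, ~ K x -> f x = 0.

Definition test_function U f : Prop :=
  exists K, [/\ compact K, K `<=` U & smooth_supported_in K f].

Definition Ck_norm (m : nat) f : R :=
  sup [set r | exists s : seq 'I_N, exists x,
                 (size s <= m)%N /\ r = `|iter_partial s f x|].

End Smoothness.

(* Integral over R^N, computed one coordinate at a time with the
   one-dimensional Lebesgue measure. It is only ever applied to continuous
   compactly supported functions, for which, by Fubini's theorem, it is the
   integral with respect to the N-dimensional Lebesgue measure. *)
Fixpoint integral_rV (R : realType) (N : nat) : ('rV[R]_N -> R) -> R :=
  match N return ('rV[R]_N -> R) -> R with
  | 0 => fun f => f 0
  | n.+1 => fun f =>
      (\int[@lebesgue_measure R]_t
         integral_rV (fun y : 'rV[R]_n => f (row_mx (t%:M : 'rV[R]_1) y)))%R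
  end.

Section Distributions.
Variables (R : realType) (N : nat).
Implicit Types (U Omega : set 'rV[R]_N) (f g phi psi : 'rV[R]_N -> R).

(* A functional is a total map on functions, but only its values on test
   functions of the open set at hand are ever constrained or used. *)
Definition functional : Type := ('rV[R]_N -> R) -> R.

Implicit Types (T : functional).

Definition distribution Omega T : Prop :=
  (forall (a : R) phi psi,
     test_function Omega phi -> test_function Omega psi ->
     T (fun x => a * phi x + psi x) = a * T phi + T psi) /\
  (forall K : set 'rV[R]_N, compact K -> K `<=` Omega ->
     exists (C : R) (m : nat), forall phi, smooth_supported_in K phi ->
       `|T phi| <= C * Ck_norm m phi).

Definition function_distr f : functional :=
  fun phi => integral_rV (fun x => f x * phi x).

Definition mul_distr g T : functional := fun phi => T (fun x => g x * phi x).

Definition partial_distr (i : 'I_N) T : functional :=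
  fun phi => - T (partial i phi).

Definition eq_distr U T1 T2 : Prop :=
  forall phi, test_function U phi -> T1 phi = T2 phi.

(* L is the action of the differential operator on distributions. *)
Definition hypoelliptic (L : functional -> functional) Omega : Prop :=
  forall T, distribution Omega T ->
  forall U f, open U -> U `<=` Omega -> smooth U f ->
    eq_distr U (L T) (function_distr f) ->
    exists2 g, smooth U g & eq_distr U T (function_distr g).

End Distributions.

Section Operator.
Variables (R : realType) (N : nat).
Variables (V : 'rV[R]_N -> R) (A : 'rV[R]_N -> 'M[R]_N) (c : 'rV[R]_N -> R).

(* L u - c u for u of class C^2 *)
Definition Lc (u : 'rV[R]_N -> R) : 'rV[R]_N -> R :=
  fun x =>
    (V x)^-1 * (\sum_(i < N) \sum_(j < N)
       partial i (fun y => V y * A y i j * partial j u y) x)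
    - c x * u x.

(* the same operator, with products and derivatives of distributions *)
Definition Lc_distr (T : functional R N) : functional R N :=
  fun phi =>
    mul_distr (fun x => (V x)^-1)
      (fun psi => \sum_(i < N) \sum_(j < N)
         partial_distr i
           (mul_distr (fun y => V y * A y i j) (partial_distr j T)) psi) phi
    - mul_distr c T phi.

End Operator.

(* Main.v *)
Require Import Defs.
From mathcomp Require Import all_boot all_order all_algebra.
From mathcomp Require Import all_classical all_reals all_analysis.
From mathcomp Require Import ring lra.

Set Implicit Arguments.
Unset Strict Implicit.
Unset Printing Implicit Defensive.

Import Order.TTheory GRing.Theory Num.Theory.
Import numFieldNormedType.Exports.

Local Open Scope classical_set_scope.
Local Open Scope ring_scope.

(** Write v = u x0 - u, where x0 is the maximum point, and M = V (L - c), which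
    is formally symmetric.  Then v >= 0 and M v <= 0, because c and u x0 are
    nonnegative, and the theorem says that v = 0.  As the zero set of v is
    closed in Omega, connectedness reduces this to the local statement that v
    vanishes near each of its zeros (local_vanishing).  As A may
    degenerate, no elliptic estimate holds; the only regularity available is
    that weak solutions given by functionals of order zero are smooth
    (weak_solution_smooth).  Such functionals are produced by
    duality: a Hahn-Banach theorem (cone_dominated) yields a linear functional
    subject to prescribed upper bounds, and what has to be proved in each case
    is that the bounds are consistent.

    Two facts about the operator carry the argument in dimension at least two.

    First, a nonnegative supersolution w on a connected open set is either
    identically zero or positive on a dense subset (positivity_dichotomy).
    Near each point there is a positive solution h (local_harmonic), obtained
    by duality from Kato's inequality.  The functions h logcut(w / h), with
    logarithmic cutoffs concave enough to absorb their own energy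
    (concave_energy), converge weakly to a solution (log_limit) that equals h
    where w > 0 and 0 inside the set where w = 0.  This limit is continuous by
    hypoellipticity, so it cannot jump, and the closure of the set where w > 0
    is open.

    Second, for a small ball B around a zero x0 of v there is a positive
    functional T with T (- M phi) = phi x0 for test functions phi, bounded
    above by phi x0 on - M phi for all supersolutions phi that are nonnegative
    on the boundary of B (pole_functional).  The consistency of these bounds is
    the weak minimum principle.  Away from x0 this T has a nonnegative smooth
    density g that solves M g = 0 and is not identically zero (green_density).

    The punctured ball is connected, so the dichotomy makes g positive on a
    dense set.  Since v / (1 + v) is a supersolution vanishing at x0, the bound
    on T forces M (v / (1 + v)) = 0 near x0, and by strict concavity M v, the
    energy density of v and c v all vanish.  Then flat (v - a) is a solution
    for every a > 0; it is zero near x0, so by the dichotomy it is zero on the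
    punctured ball, and v <= a (local_vanishing_ge2).  In one variable the
    equation can be integrated directly (local_vanishing_1). *)

(** * Dominated linear functionals *)

Section ConeDomination.
Variables (R : realType) (E : lmodType R).

(** An element (f, r) stands for the requirement T f <= r on an unknown linear
    functional T; consistent requirements are closed under positive
    combinations and do not force T 0 to be negative. *)
Definition bound_cone (S : set (E * R)) : Prop :=
  [/\ forall x y, S x -> S y -> S (x.1 + y.1, x.2 + y.2),
      forall a x, 0 < a -> S x -> S (a *: x.1, a * x.2) &
      forall r, S (0, r) -> 0 <= r].

(** Zorn's lemma, applied to the sets that form a cone together with S, so that
    the empty chain is harmless. *)
Lemma bound_cone_maximal (S : set (E * R)) : bound_cone S ->
  exists M, [/\ S `<=` M, bound_cone M &
    forall M', bound_cone M' -> M `<=` M' -> M' `<=` M].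
Proof.
move=> goodS; pose P C := bound_cone (S `|` C).
have [F FP Ftot|C [PC maxC]] := @Zorn_bigcup _ P.
  have [[X0 FX0]|F0] := pselect (exists X, F X); last first.
    suff F0' : \bigcup_(X in F) X = set0 by rewrite /P F0' setU0.
    by rewrite -subset0 => x [X FX _]; case: F0; exists X.
  have lift X : F X -> S `|` X `<=` S `|` \bigcup_(X in F) X.
    by move=> FX x [Sx|Xx]; [left|right; exists X].
  have pick x : (S `|` \bigcup_(X in F) X) x -> exists2 X, F X & (S `|` X) x.
    by move=> [Sx|[X FX Xx]]; [exists X0 => //; left|exists X => //; right].
  split.
  - move=> x y /pick[X FX Xx] /pick[Y FY Yy].
    have [XY|YX] := Ftot _ _ FX FY.
      apply: (lift _ FY); have [+ _ _] := FP _ FY; apply => //.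
      by case: Xx => [?|/XY ?]; [left|right].
    apply: (lift _ FX); have [+ _ _] := FP _ FX; apply => //.
    by case: Yy => [?|/YX ?]; [left|right].
  - move=> a x a0 /pick[X FX Xx]; apply: (lift _ FX).
    by have [_ + _] := FP _ FX; apply.
  - by move=> r /pick[X FX Xx]; have [_ _] := FP _ FX; apply.
exists (S `|` C); split => // M' goodM' subM'.
have eM' : S `|` M' = M' by apply/setUidPr => x Sx; apply: subM'; left.
have [e|ne] := pselect (M' `<=` C); first by move=> x /e; right.
case: (maxC M').
  by split=> // x Cx; apply: subM'; right.
by rewrite /P eM'.
Qed.

(** A Hahn-Banach theorem in the form used to solve equations by duality: a
    pair (f, r) in the cone S prescribes that the functional be at most r at
    f.  The consistency requirement is that no nonnegative combination of the
    prescriptions bounds the value at 0 by a negative number. *)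
Lemma cone_dominated (D : set E) (S : set (E * R)) :
  (forall a f g, D f -> D g -> D (a *: f + g)) ->
  S (0, 0) -> bound_cone S -> (forall f, D f -> exists r, S (f, r)) ->
  exists T : E -> R,
    (forall a f g, D f -> D g -> T (a *: f + g) = a * T f + T g) /\
    (forall f r, D f -> S (f, r) -> T f <= r).
Proof.
move=> Dlin S0 goodS SD.
have [M [SM goodM maxM]] := bound_cone_maximal goodS.
have [Madd Mscale Mpos] := goodM.
have M0 : M (0, 0) by apply: SM.
pose B f := [set r | M (f, r)].
pose T f := inf (B f).
have MN f r s : M (f, r) -> M (- f, s) -> - s <= r.
  move=> Mr Ms; have := Madd _ _ Mr Ms; rewrite /= subrr => /Mpos h.
  by rewrite -subr_ge0 opprK.
have DN f : D f -> D (- f).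
  move=> Df; have D0 : D 0 by have := Dlin (-1) f f Df Df; rewrite scaleN1r addNr.
  by have := Dlin (-1) f 0 Df D0; rewrite scaleN1r addr0.
have BD f : D f -> has_inf (B f).
  move=> Df; split; first by have [r Sr] := SD _ Df; exists r; apply: SM.
  have [s Ss] := SD _ (DN _ Df); exists (- s) => r Br.
  by apply: MN Br _; apply: SM.
have Tle f r : D f -> M (f, r) -> T f <= r.
  by move=> Df Mr; apply: ge_inf => //; case: (BD _ Df).
have Tge f s : D f -> (forall r, M (f, r) -> s <= r) -> s <= T f.
  by move=> Df Hs; apply: lb_le_inf => //; case: (BD _ Df).
(* adding the opposite prescription (- f, - T f) keeps the cone consistent,
   hence it already belongs to the maximal cone *)
have MT f : D f -> M (- f, - T f).
  move=> Df.
  pose M' : set (E * R) := [set x | exists t y,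
    [/\ 0 <= t, M y & x = (y.1 - t *: f, y.2 - t * T f)]].
  have : M' `<=` M.
    apply: maxM; last first.
      move=> [g r] Mx; exists 0, (g, r).
      by rewrite lexx scale0r mul0r /= !subr0.
    split.
    - move=> _ _ [t [y [t0 My ->]]] [u [z [u0 Mz ->]]] /=.
      exists (t + u), (y.1 + z.1, y.2 + z.2); split.
      + exact: addr_ge0.
      + exact: Madd.
      + by rewrite /= !scalerDl mulrDl !opprD; congr pair; rewrite addrACA.
    - move=> a _ a0 [t [y [t0 My ->]]] /=.
      exists (a * t), (a *: y.1, a * y.2); split.
      + by rewrite mulr_ge0 // ltW.
      + exact: Mscale.
      + by rewrite /= scalerBr scalerA mulrBr mulrA.
    - move=> r [t [[g s] [t0 My [eg ->]]]].
      have {eg} eg : g = t *: f by apply/esym/eqP; rewrite -subr_eq0 -oppr_eq0 opprB -eg.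
      move: t0; rewrite le_eqVlt => /predU1P[t0|t0].
        by rewrite -t0 mul0r subr0; apply: Mpos; move: My; rewrite eg -t0 scale0r.
      rewrite subr_ge0 mulrC -ler_pdivlMr //; apply: Tle => //.
      have := Mscale t^-1 _ _ My; rewrite invr_gt0 => /(_ t0) /=.
      by rewrite eg scalerA mulVf ?gt_eqF // scale1r mulrC.
  by apply; exists 1, (0, 0); rewrite /= scale1r mul1r !sub0r ler01.
have TN f : D f -> T (- f) = - T f.
  move=> Df; apply/eqP; rewrite eq_le; apply/andP; split.
    by apply: Tle; [exact: DN|exact: MT].
  apply: (Tge); first exact: DN.
  by move=> r Mr; rewrite lerNl; apply: Tge => // s Ms; apply: MN Ms _.
have TM f : D f -> M (f, T f).
  by move=> Df; have := MT _ (DN _ Df); rewrite opprK TN // opprK.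
have D0 f : D f -> D 0.
  by move=> Df; have := Dlin (-1) f f Df Df; rewrite scaleN1r addNr.
have DA f g : D f -> D g -> D (f + g).
  by move=> Df Dg; rewrite -[f]scale1r; exact: Dlin.
have DZ a f : D f -> D (a *: f).
  by move=> Df; rewrite -[_ *: _]addr0; apply: Dlin => //; exact: D0 Df.
have TAle f g : D f -> D g -> T (f + g) <= T f + T g.
  move=> Df Dg; apply: Tle; first exact: DA.
  exact: (Madd (f, T f) (g, T g)) (TM _ Df) (TM _ Dg).
have TA f g : D f -> D g -> T (f + g) = T f + T g.
  move=> Df Dg; apply/eqP; rewrite eq_le TAle //=.
  have := TAle _ _ (DN _ Df) (DN _ Dg).
  rewrite (TN _ Df) (TN _ Dg) -(opprD f g) (TN _ (DA _ _ Df Dg)).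
  by rewrite -opprD lerN2.
have TZle a f : 0 < a -> D f -> T (a *: f) <= a * T f.
  move=> a0 Df; apply: Tle; first exact: DZ.
  exact: (Mscale a (f, T f)) a0 (TM _ Df).
have T0 f : D f -> T 0 = 0.
  by move=> /D0 d0; have /eqP := TA _ _ d0 d0; rewrite addr0 addrC -subr_eq subrr => /eqP<-.
have TZp a f : 0 < a -> D f -> T (a *: f) = a * T f.
  move=> a0 Df; apply/eqP; rewrite eq_le TZle //=.
  have := TZle a^-1 (a *: f); rewrite invr_gt0 => /(_ a0 (DZ _ _ Df)).
  by rewrite scalerA mulVf ?gt_eqF // scale1r mulrC ler_pdivlMr // mulrC.
have TZ a f : D f -> T (a *: f) = a * T f.
  move=> Df; have [a0|a0|->] := ltgtP a 0; last by rewrite scale0r mul0r (T0 f).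
    rewrite -[a]opprK scaleNr (TN _ (DZ _ _ Df)).
    by rewrite TZp ?oppr_gt0 // !mulNr.
  by rewrite TZp.
exists T; split.
  by move=> a f g Df Dg; rewrite TA ?TZ //; exact: DZ.
by move=> f r Df Sr; apply: Tle => //; exact: SM.
Qed.

End ConeDomination.

(** The case of a space of functions, with the operations of the module written
    pointwise.  It produces the three functionals used below: a weak solution
    with zero boundary values, a generalized limit, and the solution with a
    pole. *)
Lemma dominated_functional (R : realType) (X : Type) (D : set (X -> R))
    (S : (X -> R) -> R -> Prop) :
  (forall (a : R) f g, D f -> D g -> D (fun x => a * f x + g x)) ->
  S (fun=> 0) 0 ->
  (forall f g r s, S f r -> S g s -> S (fun x => f x + g x) (r + s)) ->
  (forall a f r, 0 < a -> S f r -> S (fun x => a * f x) (a * r)) ->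
  (forall r, S (fun=> 0) r -> 0 <= r) ->
  (forall f, D f -> exists r, S f r) ->
  exists T : (X -> R) -> R,
    (forall a f g, D f -> D g -> T (fun x => a * f x + g x) = a * T f + T g) /\
    (forall f r, D f -> S f r -> T f <= r).
Proof.
move=> Dlin S0 Sadd Sscale Spos SD.
have [] := @cone_dominated R (X -> R^o) D [set x | S x.1 x.2] Dlin S0 _ SD.
  by split=> [x y|a x|r]; [exact: Sadd|exact: Sscale|exact: Spos].
by move=> T [Tlin Tdom]; exists T.
Qed.

(** * Functions of class C^k *)

Section Calculus.
Variables (R : realType) (N : nat).
Local Notation rV := 'rV[R]_N.
Implicit Types (U W : set rV) (f g u : rV -> R) (F : R -> R) (i j : 'I_N).

Lemma derive_line f (x v : rV) : 'D_v f x = 'D_1 (fun h : R => f (h *: v + x)) 0.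
Proof.
rewrite /derive; set g1 := fun h => h^-1 *: _; set g2 := fun h => h^-1 *: _.
suff -> : g1 = g2 by [].
by rewrite funeqE /g1 /g2 => h /=; rewrite addr0 scale0r add0r [_%:A]mulr1.
Qed.

Lemma is_derive_line f (x v : rV) (t : R) : derivable f (t *: v + x) v ->
  is_derive t 1 (fun h : R => f (h *: v + x)) ('D_v f (t *: v + x)).
Proof.
have e : (fun h : R => f (h *: v + (t *: v + x))) =
         (fun h : R => f (h *: v + x)) \o shift t.
  by apply/funext => h /=; rewrite scalerDl addrA.
have e2 : (fun h => h^-1 *: (((fun h : R => f (h *: v + (t *: v + x))) \o shift 0)
     (h *: 1) - (fun h : R => f (h *: v + (t *: v + x))) 0)) =
     (fun h => h^-1 *: (((fun h : R => f (h *: v + x)) \o shift t) (h *: 1)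
       - (fun h : R => f (h *: v + x)) t)).
  by apply/funext => h /=; rewrite addr0 scale0r add0r addrA -scalerDl.
move=> df; apply: DeriveDef.
  by move: df => /derivable1P; rewrite /derivable e2.
by rewrite derive_line /derive e2.
Qed.

Lemma is_derive_chain F u (x v : rV) : derivable u x v -> derivable F (u x) 1 ->
  is_derive x v (fun y => F (u y)) (F^`()%classic (u x) * 'D_v u x).
Proof.
move=> du dF.
have d1 : is_derive (0 : R) 1 (fun h : R => u (h *: v + x)) ('D_v u x).
  by have := @is_derive_line u x v 0; rewrite scale0r add0r; apply.
have d2 : is_derive ((fun h : R => u (h *: v + x)) 0) 1 F (F^`()%classic (u x)).
  by rewrite /= scale0r add0r derive1E; exact/derivableP.
have [d3 e3] := is_derive1_comp d2 d1.
by apply: DeriveDef; [apply/derivable1P|rewrite derive_line].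
Qed.

Lemma Ck_continuous k U f x : Ck k U f -> U x -> {for x, continuous f}.
Proof. by case: k => [|k] [+ _]; apply. Qed.

Lemma Ck_derivable k U f i x : Ck k.+1 U f -> U x -> derivable f x (delta_mx ord0 i).
Proof. by move=> [_ /(_ i)[+ _]]; apply. Qed.

Lemma Ck_partial k U f i : Ck k.+1 U f -> Ck k U (partial i f).
Proof. by move=> [_ /(_ i)[_]]. Qed.

Lemma Ck_subset k U W f : W `<=` U -> Ck k U f -> Ck k W f.
Proof.
move=> WU; elim: k f => [|k IH] f [cf df]; (split; first by move=> x /WU/cf) => // i.
by have [dfi Cfi] := df i; split => [x /WU/dfi//|]; exact: IH.
Qed.

Lemma Ck_pred k U f : Ck k.+1 U f -> Ck k U f.
Proof.
elim: k f => [|k IH] f [cf df]; split=> // i.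
by have [dfi Cfi] := df i; split => //; exact: IH.
Qed.

Lemma Ck_le k l U f : (k <= l)%N -> Ck l U f -> Ck k U f.
Proof.
move=> /subnK <-; elim: (l - k)%N => // m IH Cf; apply: IH; exact: Ck_pred.
Qed.

Lemma Ck_local k U f :
  (forall x, U x -> exists2 W, W x & Ck k W f) -> Ck k U f.
Proof.
elim: k f => [|k IH] f H; (split; [by move=> x /H[W Wx /Ck_continuous]; apply|]) => //.
move=> i; split; first by move=> x /H[W Wx /Ck_derivable]; apply.
by apply: IH => x /H[W Wx CW]; exists W => //; exact: Ck_partial.
Qed.

Lemma near_open U (P : rV -> Prop) x :
  open U -> U x -> (forall y, U y -> P y) -> \forall y \near x, P y.
Proof.
move=> oU Ux UP; near=> y; apply: UP; near: y; exact: open_nbhs_nbhs.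
Unshelve. all: by end_near. Qed.

Lemma partial_eq U f g i x : open U -> (forall x, U x -> f x = g x) -> U x ->
  partial i f x = partial i g x.
Proof. by move=> oU fg Ux; apply: near_eq_derive; exact: near_open fg. Qed.

Lemma continuous_eq U f g x : open U -> (forall x, U x -> f x = g x) -> U x ->
  {for x, continuous f} -> {for x, continuous g}.
Proof.
move=> oU fg Ux cf; have cg : f @ x --> g x by rewrite -(fg _ Ux); exact: cf.
have fgx : \near x, f x = g x := near_open oU Ux fg.
exact: cvg_trans (near_eq_cvg fgx) cg.
Qed.

Lemma Ck_eq k U f g : open U -> (forall x, U x -> f x = g x) -> Ck k U f -> Ck k U g.
Proof.
move=> oU; elim: k f g => [|k IH] f g fg [cf df].
  by split=> // x Ux; apply: continuous_eq fg _ (cf _ Ux).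
split=> [x Ux|i]; first exact: continuous_eq fg _ (cf _ Ux).
have [dfi Cfi] := df i; split => [x Ux|].
  by apply: near_eq_derivable (dfi _ Ux); exact: near_open fg.
by apply: IH Cfi => x Ux; exact: partial_eq fg Ux.
Qed.

Lemma partial_cst i (a : R) : partial i (fun=> a) = fun=> 0.
Proof. by apply/funext => x; exact: derive_cst. Qed.

Lemma Ck_cst k U (a : R) : Ck k U (fun=> a).
Proof.
elim: k a => [|k IH] a; (split; first by move=> x _; exact: cst_continuous) => // i.
by split=> [x _|]; [exact: derivable_cst|rewrite partial_cst].
Qed.

Lemma partialD f g i x : derivable f x (delta_mx ord0 i) ->
  derivable g x (delta_mx ord0 i) ->
  partial i (fun y => f y + g y) x = partial i f x + partial i g x.
Proof. by move=> df dg; exact: deriveD. Qed.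

Lemma partialM f g i x : derivable f x (delta_mx ord0 i) ->
  derivable g x (delta_mx ord0 i) ->
  partial i (fun y => f y * g y) x = partial i f x * g x + f x * partial i g x.
Proof.
move=> df dg; have := deriveM df dg; rewrite /partial => ->.
by rewrite addrC mulrC.
Qed.

Lemma partial_chain F u i x : derivable u x (delta_mx ord0 i) ->
  derivable F (u x) 1 ->
  partial i (fun y => F (u y)) x = F^`()%classic (u x) * partial i u x.
Proof. by move=> du dF; case: (is_derive_chain du dF). Qed.

Lemma CkD k U f g : open U -> Ck k U f -> Ck k U g -> Ck k U (fun x => f x + g x).
Proof.
move=> oU; elim: k f g => [|k IH] f g Cf Cg.
  by split=> // x Ux; exact: continuousD (Ck_continuous Cf Ux) (Ck_continuous Cg Ux).
split=> [x Ux|i].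
  by exact: continuousD (Ck_continuous Cf Ux) (Ck_continuous Cg Ux).
have dfg x : U x -> derivable f x (delta_mx ord0 i) /\ derivable g x (delta_mx ord0 i).
  by move=> Ux; split; [exact: Ck_derivable Cf Ux|exact: Ck_derivable Cg Ux].
split=> [x /dfg[df dg]|]; first exact: derivableD.
apply: Ck_eq (IH _ _ (Ck_partial i Cf) (Ck_partial i Cg)) => // x Ux.
by have [df dg] := dfg _ Ux; rewrite partialD.
Qed.

Lemma CkM k U f g : open U -> Ck k U f -> Ck k U g -> Ck k U (fun x => f x * g x).
Proof.
move=> oU; elim: k f g => [|k IH] f g Cf Cg.
  by split=> // x Ux; exact: continuousM (Ck_continuous Cf Ux) (Ck_continuous Cg Ux).
split=> [x Ux|i].
  by exact: continuousM (Ck_continuous Cf Ux) (Ck_continuous Cg Ux).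
have dfg x : U x -> derivable f x (delta_mx ord0 i) /\ derivable g x (delta_mx ord0 i).
  by move=> Ux; split; [exact: Ck_derivable Cf Ux|exact: Ck_derivable Cg Ux].
split=> [x /dfg[df dg]|]; first exact: derivableM.
apply: (@Ck_eq _ _ (fun x => partial i f x * g x + f x * partial i g x)) => // [x Ux|].
  by have [df dg] := dfg _ Ux; rewrite partialM.
apply: CkD => //; apply: IH; try exact: Ck_partial; exact: Ck_pred.
Qed.

Lemma CkZ k U (a : R) f : open U -> Ck k U f -> Ck k U (fun x => a * f x).
Proof. by move=> oU Cf; apply: CkM => //; exact: Ck_cst. Qed.

Lemma CkN k U f : open U -> Ck k U f -> Ck k U (fun x => - f x).
Proof.
move=> oU /(CkZ (-1) oU); apply: Ck_eq => // x _; exact: mulN1r.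
Qed.

Lemma CkB k U f g : open U -> Ck k U f -> Ck k U g -> Ck k U (fun x => f x - g x).
Proof. by move=> oU Cf Cg; apply: CkD => //; exact: CkN. Qed.

Lemma Ck_sum (I : Type) (s : seq I) k U (f : I -> rV -> R) : open U ->
  (forall l, Ck k U (f l)) -> Ck k U (fun x => \sum_(l <- s) f l x).
Proof.
move=> oU Cf; elim: s => [|a s IH].
  by apply: Ck_eq (@Ck_cst k U 0) => // x _; rewrite big_nil.
by apply: Ck_eq (CkD oU (Cf a) IH) => // x _; rewrite big_cons.
Qed.

Lemma partial_sum (I : Type) (s : seq I) (f : I -> rV -> R) i x :
  (forall l, derivable (f l) x (delta_mx ord0 i)) ->
  partial i (fun y => \sum_(l <- s) f l y) x = \sum_(l <- s) partial i (f l) x.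
Proof.
move=> df.
suff : is_derive x (delta_mx ord0 i : rV) (fun y => \sum_(l <- s) f l y)
    (\sum_(l <- s) partial i (f l) x) by case.
elim: s => [|a s IH].
  rewrite big_nil (_ : (fun _ => _) = cst 0); first exact: is_derive_cst.
  by apply/funext => y; rewrite big_nil.
rewrite big_cons (_ : (fun _ => _) = (f a) + (fun y => \sum_(l <- s) f l y)).
  by apply: is_deriveD; exact/derivableP.
by apply/funext => y; rewrite big_cons.
Qed.

Lemma is_derive_coord i j x :
  is_derive x (delta_mx ord0 i : rV) (fun y : rV => y ord0 j) (i == j)%:R.
Proof.
have cv : (fun h : R => h^-1 *: (((fun y : rV => y ord0 j) \o shift x)
    (h *: (delta_mx ord0 i : rV)) - x ord0 j)) @ 0^' --> ((i == j)%:R : R).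
  apply: (@cvg_trans _ ((fun=> (i == j)%:R : R) @ 0^')); last exact: cvg_cst.
  apply: near_eq_cvg; near=> h.
  have h0 : h != 0 by near: h; exact: nbhs_dnbhs_neq.
  rewrite /= !mxE eqxx /= addrK eq_sym scalerA mulVf // scale1r.
  by rewrite eq_sym.
apply: DeriveDef; first by apply/cvg_ex; eexists; exact: cv.
exact: cvg_lim cv.
Unshelve. all: by end_near. Qed.

Lemma coord_cont j (x : rV) : {for x, continuous (fun y : rV => y ord0 j)}.
Proof. exact: coord_continuous. Qed.

Lemma Ck_coord k U j : Ck k U (fun y : rV => y ord0 j).
Proof.
case: k => [|k]; (split; first by move=> x _; exact: coord_cont) => // i.
split=> [x _|]; first by have [] := is_derive_coord i j x.
suff -> : partial i (fun y : rV => y ord0 j) = fun=> (i == j)%:R by exact: Ck_cst.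
by apply/funext => x; have [_] := is_derive_coord i j x.
Qed.

(** One-variable functions of class C^k, for use as outer functions. *)
Fixpoint C1k (k : nat) (I : set R) F : Prop :=
  (forall t, I t -> {for t, continuous F}) /\
  match k with
  | 0 => True
  | k'.+1 => (forall t, I t -> derivable F t 1) /\ C1k k' I F^`()%classic
  end.

Lemma Ck_comp k U (I : set R) F u : open U -> (forall x, U x -> I (u x)) ->
  C1k k I F -> Ck k U u -> Ck k U (fun x => F (u x)).
Proof.
move=> oU UI; elim: k F u UI => [|k IH] F u UI CF Cu.
  split=> // x Ux; apply: continuous_comp; first exact: (Ck_continuous Cu).
  by have [cF _] := CF; apply: cF; exact: UI.
have [cF [dF CF']] := CF.
split=> [x Ux|i].
  by apply: continuous_comp; [exact: (Ck_continuous Cu)|apply: cF; exact: UI].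
have du x : U x -> derivable u x (delta_mx ord0 i) by exact: (Ck_derivable Cu).
have dFx x : U x -> derivable F (u x) 1 by move=> /UI/dF.
split=> [x Ux|]; first by have [] := is_derive_chain (du _ Ux) (dFx _ Ux).
apply: (@Ck_eq _ _ (fun x => F^`()%classic (u x) * partial i u x)) => // [x Ux|].
  by rewrite partial_chain //; [exact: du|exact: dFx].
by apply: CkM => //; [apply: IH => //; exact: Ck_pred|exact: Ck_partial].
Qed.

End Calculus.

(** * Integrals of continuous compactly supported functions *)

Section EpsilonDelta.
Variables (R : realType) (V : normedModType R).
Implicit Types (f : V -> R) (x : V).

Lemma continuous_epsP f x : {for x, continuous f} <->
  forall e : R, 0 < e ->
    exists2 d : R, 0 < d & forall y, `|x - y| < d -> `|f x - f y| < e.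
Proof.
split=> [/cvgrPdist_lt cf e e0|H].
  by have /nbhs_normP[d /= d0 Hd] := cf _ e0; exists d => // y xy; exact: Hd.
apply/cvgrPdist_lt => e e0; have [d d0 Hd] := H _ e0.
by apply/nbhs_normP; exists d => //= y; exact: Hd.
Qed.

Lemma nbhs_norm_lt (x : V) (d : R) : 0 < d -> nbhs x [set y | `|x - y| < d].
Proof. by move=> d0; apply/nbhs_normP; exists d. Qed.

Lemma continuousDZ (a : R) f (g : V -> R) : continuous f -> continuous g ->
  continuous (fun x => a * f x + g x).
Proof.
move=> cf cg x; apply: cvgD; last exact: cg.
by apply: cvgM; [exact: cvg_cst|exact: cf].
Qed.

Definition supp_in (r : R) f : Prop := forall x, r < `|x| -> f x = 0.

Lemma supp_in_le r s f : r <= s -> supp_in r f -> supp_in s f.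
Proof. by move=> rs fr x sx; apply: fr; exact: le_lt_trans sx. Qed.

End EpsilonDelta.

Section OneVariableIntegrals.
Variable R : realType.
Local Notation mu := (@lebesgue_measure R).
Implicit Types (h k : R -> R) (r : R).

Lemma Rintegral_supp r h : supp_in r h ->
  (\int[mu]_t h t)%R = (\int[mu]_(t in `[- r, r]) h t)%R.
Proof.
move=> hr; rewrite [RHS]Rintegral_mkcond; congr Rintegral.
apply/funext => t; rewrite patchE; case: ifPn => // /negP tr.
apply: hr; rewrite ltNge; apply/negP => tr'; apply: tr.
by rewrite inE /= in_itv /= -ler_norml.
Qed.

Lemma integrable_segment r h : continuous h ->
  mu.-integrable (`[- r, r] : set R) (EFin \o h).
Proof.
move=> ch; apply: continuous_compact_integrable; first exact: segment_compact.
exact: continuous_subspaceT.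
Qed.

Lemma RintegralDZ r a h k : continuous h -> continuous k -> supp_in r h ->
  supp_in r k ->
  (\int[mu]_t (a * h t + k t))%R = a * (\int[mu]_t h t)%R + (\int[mu]_t k t)%R.
Proof.
move=> ch ck hr kr.
rewrite (@Rintegral_supp r) ?(@Rintegral_supp r h) ?(@Rintegral_supp r k) //; last first.
  by move=> t rt; rewrite hr // kr // mulr0 addr0.
have ih := integrable_segment r ch; have ik := integrable_segment r ck.
have ia : mu.-integrable (`[- r, r] : set R) (EFin \o (fun t => a * h t)).
  by apply: integrable_segment => x; apply: cvgM; [exact: cvg_cst|exact: ch].
by rewrite RintegralD // RintegralZl.
Qed.

Lemma Rintegral_norm_le r M h : 0 <= r -> continuous h -> supp_in r h ->
  (forall t, `|h t| <= M) -> `|(\int[mu]_t h t)%R| <= M * (2 * r).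
Proof.
move=> r0 ch hr hM; rewrite (Rintegral_supp hr).
apply: le_trans (le_normr_Rintegral _ (integrable_segment _ ch)) _ => //.
apply: (@le_trans _ _ (\int[mu]_(t in `[- r, r]) M)%R).
  apply: le_Rintegral => //.
  - apply: (@integrable_segment r (fun t => `|h t|)) => x.
    exact: (cvg_norm (ch x)).
  - by apply: (@integrable_segment r (fun=> M)) => x; exact: cvg_cst.
rewrite Rintegral_cst //= lebesgue_measure_itv /= lte_fin.
have M0 : 0 <= M := le_trans (normr_ge0 _) (hM 0).
case: ifP => [_|_] /=; first by rewrite opprK mulr_natl mulr2n.
by rewrite mulr0 mulr_ge0 // mulr_ge0.
Qed.

Lemma Rintegral_gt0 r h t : continuous h -> supp_in r h ->
  (forall s, 0 <= h s) -> 0 < h t -> 0 < (\int[mu]_s h s)%R.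
Proof.
move=> ch hr h0 ht.
have /continuous_epsP/(_ (h t / 2))[|d d0 Hd] := ch t; first by rewrite divr_gt0.
have hs (s : R) : s \in `](t - d), (t + d)[ -> h t / 2 <= h s.
  rewrite in_itv /= -ltr_distlC => /Hd; rewrite ltr_norml => /andP[_]; lra.
pose I : set R := `[t - d / 2, t + d / 2]%classic.
have iI (s : R) : I s -> s \in `](t - d), (t + d)[.
  by rewrite /I /= !in_itv /= => /andP[s1 s2]; apply/andP; split; lra.
have hr' : supp_in (Num.max r (`|t| + d)) h.
  by apply: supp_in_le hr; rewrite le_max lexx.
rewrite (Rintegral_supp hr'); set J := (X in (\int[mu]_(s in X) _)%R).
have IJ : I `<=` J.
  move=> s; rewrite /I /J /= !in_itv /= => /andP[s1 s2].
  have : `|s| <= Num.max r (`|t| + d).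
    rewrite le_max; apply/orP; right.
    have -> : s = t + (s - t) by rewrite addrC subrK.
    by apply: le_trans (ler_normD _ _) _; rewrite lerD2l ler_norml; lra.
  by rewrite ler_norml.
apply: (@lt_le_trans _ _ (\int[mu]_(s in I) (h t / 2))%R).
  rewrite /I Rintegral_cst //= lebesgue_measure_itv /= lte_fin.
  by case: ifP => /= H; [apply: mulr_gt0; lra|move: H; lra].
have mJ : measurable J by exact: measurable_itv.
have -> : (\int[mu]_(s in I) (h t / 2))%R =
          (\int[mu]_(s in J) ((fun=> h t / 2) \_ I) s)%R.
  by rewrite -Rintegral_mkcondr; congr Rintegral; rewrite setIC setIidl.
have iI' : mu.-integrable J (EFin \o ((fun=> h t / 2) \_ I)).
  have -> : EFin \o ((fun=> h t / 2) \_ I) = (EFin \o (fun=> h t / 2)) \_ I.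
    by rewrite restrict_EFin.
  have mI : measurable (I : set R) by rewrite /I; exact: measurable_itv.
  apply/(integrable_restrict mu mI mJ); rewrite setIidr //.
  apply: continuous_compact_integrable; first exact: segment_compact.
  by apply: continuous_subspaceT => x; exact: cvg_cst.
have iJ : mu.-integrable J (EFin \o h) by exact: integrable_segment.
apply: (le_Rintegral _ iI' iJ) => [|s Js]; first by rewrite /J; exact: measurable_itv.
by rewrite patchE; case: ifPn => // /set_mem Is; apply: hs; exact: iI.
Qed.

Lemma Rintegral_derive0 r h k : 0 < r -> continuous k -> supp_in r h ->
  supp_in r k -> (forall t : R, is_derive t 1 h (k t)) -> (\int[mu]_t k t)%R = 0.
Proof.
move=> r0 ck hr kr hk; have r1 : r <= r + 1 by rewrite lerDl.
have ch t : {for t, continuous h}.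
  by apply/differentiable_continuous/derivable1_diffP; have [] := hk t.
rewrite (Rintegral_supp (supp_in_le r1 kr)) /Rintegral.
rewrite (@continuous_FTC2 _ _ h).
- by rewrite /= !hr ?subrr ?normrN // ger0_norm; lra.
- lra.
- exact: continuous_subspaceT.
- split.
  + by move=> t _; have [] := hk t.
  + exact: cvg_at_right_filter (ch _).
  + exact: cvg_at_left_filter (ch _).
- by move=> t _; rewrite derive1E; have [_ ->] := hk t.
Qed.

End OneVariableIntegrals.

Section RowVectors.
Variables (R : realType).
Implicit Types (n : nat) (t s : R).

Lemma rV_norm_le n (x : 'rV[R]_n) (a : R) : 0 <= a ->
  (forall i, `|x ord0 i| <= a) -> `|x| <= a.
Proof.
move=> a0 xa; rewrite [leLHS]/Num.norm /= mx_normrE; apply/bigmax_leP; split=> //.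
by move=> [i j] _ /=; rewrite (ord1 i).
Qed.

Lemma coord_norm_le n (x : 'rV[R]_n) i : `|x ord0 i| <= `|x|.
Proof.
by rewrite [leRHS]/Num.norm /= mx_normrE; apply/bigmax_geP; right; exists (ord0, i).
Qed.

(** The row on which integral_rV evaluates its integrand. *)
Definition consv n (t : R) (y : 'rV[R]_n) : 'rV[R]_n.+1 := row_mx (t%:M : 'rV[R]_1) y.

Lemma consv0 n t (y : 'rV[R]_n) : consv t y ord0 ord0 = t.
Proof.
have -> : ord0 = lshift n (ord0 : 'I_1) :> 'I_(1 + n) by apply/val_inj.
transitivity ((t%:M : 'rV[R]_1) ord0 ord0); first exact: row_mxEl.
by rewrite mxE eqxx.
Qed.

Lemma consvS n t (y : 'rV[R]_n) i : consv t y ord0 (lift ord0 i) = y ord0 i.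
Proof.
have -> : lift ord0 i = rshift 1 i :> 'I_(1 + n) by apply/val_inj.
exact: row_mxEr.
Qed.

Lemma consv_ex n (x : 'rV[R]_n.+1) : exists t y, x = consv t y.
Proof.
exists (x ord0 ord0), (\row_i x ord0 (lift ord0 i)); apply/rowP => i.
by case: (unliftP ord0 i) => [j ->|->]; rewrite ?consvS ?consv0 ?mxE.
Qed.

Lemma eq_consv n (x y : 'rV[R]_n.+1) : x ord0 ord0 = y ord0 ord0 ->
  (forall i, x ord0 (lift ord0 i) = y ord0 (lift ord0 i)) -> x = y.
Proof. by move=> e0 eS; apply/rowP => i; case: (unliftP ord0 i) => [j ->|->]. Qed.

Lemma consvB n t s (y z : 'rV[R]_n) : consv t y - consv s z = consv (t - s) (y - z).
Proof.
apply: eq_consv => [|i]; rewrite [LHS]mxE [X in _ + X]mxE ?consv0 ?consvS //.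
by rewrite [RHS]mxE [X in _ = _ + X]mxE.
Qed.

Lemma consvD n t s (y z : 'rV[R]_n) : consv t y + consv s z = consv (t + s) (y + z).
Proof.
by apply: eq_consv => [|i]; rewrite [LHS]mxE ?consv0 ?consvS // [RHS]mxE.
Qed.

Lemma consvZ n t s (y : 'rV[R]_n) : t *: consv s y = consv (t * s) (t *: y).
Proof.
by apply: eq_consv => [|i]; rewrite [LHS]mxE ?consv0 ?consvS // [RHS]mxE.
Qed.

Lemma delta_consv0 n : delta_mx ord0 ord0 = consv 1 (0 : 'rV[R]_n).
Proof.
by apply: eq_consv => [|i]; rewrite [LHS]mxE ?consv0 ?consvS // [RHS]mxE.
Qed.

Lemma delta_consvS n (i : 'I_n) :
  delta_mx ord0 (lift ord0 i) = consv (0 : R) (delta_mx ord0 i).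
Proof.
apply: eq_consv => [|j]; rewrite [LHS]mxE ?consv0 ?consvS // [RHS]mxE.
by rewrite (inj_eq (@lift_inj _ ord0)).
Qed.

Lemma consv_norm_le n t (y : 'rV[R]_n) a : 0 <= a -> `|t| <= a -> `|y| <= a ->
  `|consv t y| <= a.
Proof.
move=> a0 ta ya; apply: rV_norm_le => // i.
case: (unliftP ord0 i) => [j ->|->]; rewrite ?consvS ?consv0 //.
exact: le_trans (coord_norm_le _ _) ya.
Qed.

Lemma consv_norm0 n t : `|consv t (0 : 'rV[R]_n)| = `|t|.
Proof.
apply/eqP; rewrite eq_le consv_norm_le ?normr0 //=.
by have := coord_norm_le (consv t (0 : 'rV[R]_n)) ord0; rewrite consv0.
Qed.

Lemma norm_consvl n t (y : 'rV[R]_n) : `|t| <= `|consv t y|.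
Proof. by have := coord_norm_le (consv t y) ord0; rewrite consv0. Qed.

Lemma norm_consvr n t (y : 'rV[R]_n) : `|y| <= `|consv t y|.
Proof.
by apply: rV_norm_le => // i; have := coord_norm_le (consv t y) (lift ord0 i); rewrite consvS.
Qed.

Lemma slice_continuous n (f : 'rV[R]_n.+1 -> R) t : continuous f ->
  continuous (fun y : 'rV[R]_n => f (consv t y)).
Proof.
move=> cf y; apply/continuous_epsP => e e0.
have /continuous_epsP/(_ e e0)[d d0 Hd] := cf (consv t y).
exists d => // z yz; apply: Hd; rewrite consvB subrr.
by apply: le_lt_trans yz; apply: consv_norm_le; rewrite ?normr0.
Qed.

Lemma slice_supp n (f : 'rV[R]_n.+1 -> R) r t : supp_in r f ->
  supp_in r (fun y : 'rV[R]_n => f (consv t y)).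
Proof. by move=> fr y ry; apply: fr; exact: lt_le_trans (norm_consvr _ _). Qed.

Lemma compact_norm_ball n (r : R) : compact [set x : 'rV[R]_n | `|x| <= r].
Proof.
apply: bounded_closed_compact.
  exists r; split; first exact: num_real.
  by move=> M rM x /= xr; apply: le_trans xr _; exact: ltW.
apply: (@closed_comp _ _ (fun x : 'rV[R]_n => `|x|) [set t : R | t <= r]).
  by move=> x _; exact: norm_continuous.
exact: closed_le.
Qed.

(** Compactness of the ball that carries f gives a uniform modulus there; a pair
    of points outside the ball needs none. *)
Lemma supp_unif_continuous n (f : 'rV[R]_n -> R) r : continuous f -> supp_in r f ->
  forall e : R, 0 < e ->
  exists2 d : R, 0 < d & forall x y, `|x - y| < d -> `|f x - f y| < e.
Proof.
move=> cf fr e e0; have e20 : 0 < e / 2 by rewrite divr_gt0.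
pose P (d : R) x := forall y, `|x - y| < d -> `|f x - f y| < e.
have := (compact_near_coveringP _).1 (@compact_norm_ball n r) R (0^'+) P _.
case=> [x _|d /= d0 Hd].
  have /continuous_epsP/(_ _ e20)[d d0 Hd] := cf x.
  have d20 : 0 < d / 2 by rewrite divr_gt0.
  exists ([set x' | `|x - x'| < d / 2], [set d' : R | d' < d / 2]).
    split; first by exact: nbhs_norm_lt.
    by exists (d / 2) => // z /=; rewrite sub0r normrN => + z0; rewrite gtr0_norm.
  move=> [x' d'] /= [xx' d'd] y x'y.
  have xy : `|x - y| < d.
    rewrite -(subrKA x') (le_lt_trans (ler_normD _ _)) //.
    by rewrite [d]splitr ltrD // (lt_trans x'y).
  have fxx : `|f x - f x'| < e / 2 by apply: Hd; lra.
  have fxy : `|f x - f y| < e / 2 by apply: Hd.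
  by rewrite -(subrKA (f x)) (le_lt_trans (ler_normD _ _)) // [e]splitr ltrD // distrC.
have d20 : 0 < d / 2 by rewrite divr_gt0.
have Pd : [set x : 'rV[R]_n | `|x| <= r] `<=` P (d / 2).
  by apply: Hd => //=; rewrite sub0r normrN gtr0_norm //; lra.
exists (d / 2) => // x y xy.
have [xr|xr] := leP `|x| r; first exact: (Pd x).
have [yr|yr] := leP `|y| r; first by rewrite distrC; apply: (Pd y) => //; rewrite distrC.
by rewrite (fr x) // (fr y) // subrr normr0.
Qed.

End RowVectors.

Section IteratedIntegral.
Variables (R : realType).
Local Notation mu := (@lebesgue_measure R).
Implicit Types (n : nat) (t s r : R).

Lemma integral_rVS n (f : 'rV[R]_n.+1 -> R) :
  integral_rV f = (\int[mu]_t integral_rV (fun y : 'rV[R]_n => f (consv t y)))%R.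
Proof. by []. Qed.

Let linear_at n := forall (a : R) (f g : 'rV[R]_n -> R) r,
  continuous f -> continuous g -> supp_in r f -> supp_in r g ->
  integral_rV (fun x => a * f x + g x) = a * integral_rV f + integral_rV g.

Let bounded_at n := forall (f : 'rV[R]_n -> R) (r M : R), 0 <= r ->
  continuous f -> supp_in r f -> (forall x, `|f x| <= M) ->
  `|integral_rV f| <= M * (2 * r) ^+ n.

Let integral_rV_zero n : linear_at n -> integral_rV (fun _ : 'rV[R]_n => 0) = 0 :> R.
Proof.
move=> lin; have := @lin (-1) (fun=> 0) (fun=> 0) 0.
rewrite mulr0 addr0 => ->; first by rewrite mulN1r addNr.
all: by [exact: cst_continuous|].
Qed.

Let slice_integral_continuous n (f : 'rV[R]_n.+1 -> R) r : 0 <= r ->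
  linear_at n -> bounded_at n -> continuous f -> supp_in r f ->
  continuous (fun t => integral_rV (fun y : 'rV[R]_n => f (consv t y))).
Proof.
move=> r0 lin bnd cf fr t; apply/continuous_epsP => e e0.
pose C := (2 * r) ^+ n + 1.
have C0 : 0 < C by rewrite ltr_wpDl // exprn_ge0 // mulr_ge0.
have [d d0 Hd] := supp_unif_continuous cf fr (divr_gt0 e0 C0).
exists d => // s ts.
have := @lin (-1) (fun y => f (consv s y)) (fun y => f (consv t y)) r.
rewrite mulN1r addrC => <-; [|exact: slice_continuous|exact: slice_continuous
  |exact: slice_supp|exact: slice_supp].
apply: (@le_lt_trans _ _ (e / C * (2 * r) ^+ n)).
  apply: bnd => // [|x rx|y].
  - by apply: continuousDZ; exact: slice_continuous.
  - by rewrite !(slice_supp _ fr) // mulr0 addr0.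
  - rewrite mulN1r addrC; apply/ltW; apply: Hd.
    by rewrite consvB subrr consv_norm0.
rewrite -mulrA gtr_pMr // mulrC ltr_pdivrMr // mul1r.
by rewrite ltrDl.
Qed.

(** Linearity and boundedness go through the induction on the dimension
    together: both are needed to see that the slice integrals depend
    continuously on the first coordinate, and can be integrated in turn. *)
Let integral_lin_bounded n : linear_at n /\ bounded_at n.
Proof.
elim: n => [|n [lin bnd]].
  by split=> // f r M r0 cf fr /=; rewrite expr0 mulr1.
have F_supp (f : 'rV[R]_n.+1 -> R) r : supp_in r f ->
    supp_in r (fun t : R => integral_rV (fun y : 'rV[R]_n => f (consv t y))).
  move=> fr t rt; rewrite (_ : (fun y => _) = fun=> 0) ?integral_rV_zero //.
  by apply/funext => y; apply: fr; exact: lt_le_trans (norm_consvl _ _).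
split=> [a f g r cf cg fr gr|f r M r0 cf fr fM].
  have fr' : supp_in (Num.max r 0) f by apply: supp_in_le fr; rewrite le_max lexx.
  have gr' : supp_in (Num.max r 0) g by apply: supp_in_le gr; rewrite le_max lexx.
  have r0' : 0 <= Num.max r 0 by rewrite le_max lexx orbT.
  rewrite !integral_rVS -(RintegralDZ a _ _ (F_supp _ _ fr') (F_supp _ _ gr')).
  - congr Rintegral; apply/funext => t; apply: (lin _ _ _ r); try exact: slice_continuous.
    + exact: slice_supp.
    + exact: slice_supp.
  - exact: slice_integral_continuous fr'.
  - exact: slice_integral_continuous gr'.
rewrite integral_rVS exprSr mulrA; apply: Rintegral_norm_le => //.
- exact: slice_integral_continuous fr.
- exact: F_supp.
- by move=> t; apply: bnd => //; [exact: slice_continuous|exact: slice_supp].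
Qed.

Definition compactly_continuous n (f : 'rV[R]_n -> R) : Prop :=
  continuous f /\ exists r, supp_in r f.
Local Notation Cc := compactly_continuous.

Lemma Cc_supp2 n (f g : 'rV[R]_n -> R) : Cc f -> Cc g ->
  exists r, [/\ 0 <= r, supp_in r f & supp_in r g].
Proof.
move=> [_ [r fr]] [_ [s gs]]; exists (Num.max 0 (Num.max r s)).
split; first by rewrite le_max lexx.
  by apply: supp_in_le fr; rewrite !le_max lexx !orbT.
by apply: supp_in_le gs; rewrite !le_max lexx !orbT.
Qed.

Lemma integral_rVDZ n a (f g : 'rV[R]_n -> R) : Cc f -> Cc g ->
  integral_rV (fun x => a * f x + g x) = a * integral_rV f + integral_rV g.
Proof.
move=> Cf Cg; have [r [_ fr gr]] := Cc_supp2 Cf Cg.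
by have [lin _] := integral_lin_bounded n; apply: (lin _ _ _ r); case: Cf Cg => ? _ [].
Qed.

Lemma integral_rV0 n : integral_rV (fun _ : 'rV[R]_n => 0) = 0 :> R.
Proof. by have [lin _] := integral_lin_bounded n; exact: integral_rV_zero. Qed.

Lemma integral_rV_bound n (r : R) : exists2 C : R, 0 < C &
  forall (f : 'rV[R]_n -> R) M, continuous f -> supp_in r f ->
    (forall x, `|f x| <= M) -> `|integral_rV f| <= M * C.
Proof.
pose s := Num.max r 0; have s0 : 0 <= s by rewrite le_max lexx orbT.
have s20 : 0 <= (2 * s) ^+ n by rewrite exprn_ge0 // mulr_ge0.
exists ((2 * s) ^+ n + 1); first by rewrite ltr_wpDl.
move=> f M cf fr fM; have [_ bnd] := integral_lin_bounded n.
apply: (@le_trans _ _ (M * (2 * s) ^+ n)).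
  by apply: bnd => //; apply: supp_in_le fr; rewrite le_max lexx.
by rewrite ler_wpM2l ?lerDl // (le_trans _ (fM 0)).
Qed.

Lemma integral_rV_ge0 n (f : 'rV[R]_n -> R) : (forall x, 0 <= f x) -> 0 <= integral_rV f.
Proof.
elim: n f => [|n IH] f f0 //=.
by apply: Rintegral_ge0 => t _; apply: IH => y; exact: f0.
Qed.

Lemma slice_integral_Cc n (f : 'rV[R]_n.+1 -> R) : Cc f ->
  continuous (fun t => integral_rV (fun y : 'rV[R]_n => f (consv t y))) /\
  exists r, supp_in r (fun t : R => integral_rV (fun y : 'rV[R]_n => f (consv t y))).
Proof.
move=> Cf; have [cf _] := Cf; have [r [r0 fr _]] := Cc_supp2 Cf Cf.
have [lin bnd] := integral_lin_bounded n.
split; first exact: slice_integral_continuous fr.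
exists r => t rt; rewrite (_ : (fun y => _) = fun=> 0) ?integral_rV0 //.
by apply/funext => y; apply: fr; exact: lt_le_trans (norm_consvl _ _).
Qed.

Lemma slice_Cc n (f : 'rV[R]_n.+1 -> R) t : Cc f ->
  Cc (fun y : 'rV[R]_n => f (consv t y)).
Proof.
by move=> [cf [r fr]]; split; [exact: slice_continuous|exists r; exact: slice_supp].
Qed.

Lemma integral_rV_gt0 n (f : 'rV[R]_n -> R) x : Cc f -> (forall y, 0 <= f y) ->
  0 < f x -> 0 < integral_rV f.
Proof.
elim: n f x => [|n IH] f x Cf f0.
  by rewrite /= (_ : x = 0) //; apply/rowP => -[].
have [t [y ->]] := consv_ex x => fx; rewrite integral_rVS.
have [cF [r Fr]] := slice_integral_Cc Cf.
apply: (Rintegral_gt0 (t := t) cF Fr) => [s|].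
  by apply: integral_rV_ge0 => z; exact: f0.
by apply: IH fx => //; exact: slice_Cc.
Qed.

End IteratedIntegral.

Section IntegralOfDerivative.
Variables (R : realType).
Local Notation mu := (@lebesgue_measure R).
Local Notation Cc := (@compactly_continuous R _).
Implicit Types (n : nat) (t s r : R).

(** The mean value theorem for increments of either sign. *)
Lemma MVT_dist (g dg : R -> R) (a b : R) :
  (forall x : R, `|a - x| <= `|a - b| -> is_derive x 1 g (dg x)) ->
  exists2 c, `|a - c| <= `|a - b| & g b - g a = dg c * (b - a).
Proof.
move=> dgx; have cg (l r : R) : (forall x, x \in `[l, r] -> `|a - x| <= `|a - b|) ->
    {within `[l, r], continuous g}.
  move=> H; apply: derivable_within_continuous => x /H /dgx; by case.
have [ab|ba] := leP a b.
  have din x : x \in `[a, b] -> `|a - x| <= `|a - b|.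
    by rewrite in_itv /= => /andP[c1 c2]; rewrite !ler0_norm ?subr_le0 // lerN2 lerD2l lerN2.
  have dgo x : x \in `]a, b[ -> is_derive x 1 g (dg x).
    by move=> /subset_itv_oo_cc/din; exact: dgx.
  have [c cab e] := MVT_segment ab dgo (cg _ _ din).
  by exists c => //; exact: din.
have din x : x \in `[b, a] -> `|a - x| <= `|a - b|.
  rewrite in_itv /= => /andP[c1 c2].
  by rewrite !ger0_norm ?subr_ge0 ?(ltW ba) // lerD2l lerN2.
have dgo x : x \in `]b, a[ -> is_derive x 1 g (dg x).
  by move=> /subset_itv_oo_cc/din; exact: dgx.
have [c cab e] := MVT_segment (ltW ba) dgo (cg _ _ din).
exists c; first exact: din.
by rewrite -opprB e -mulrN opprB.
Qed.

Lemma open_norm_gt n (r : R) : open [set x : 'rV[R]_n | r < `|x|].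
Proof.
apply: (@open_comp _ _ (fun x : 'rV[R]_n => `|x|) [set t : R | r < t]).
  by move=> x _; exact: norm_continuous.
exact: open_gt.
Qed.

Lemma partial_supp n (f : 'rV[R]_n -> R) r i : supp_in r f -> supp_in r (partial i f).
Proof.
move=> fr x rx; rewrite (@partial_eq _ _ _ _ (fun=> 0) _ _ (@open_norm_gt n r)) //.
by rewrite partial_cst.
Qed.

Lemma Ck_continuousT n k (f : 'rV[R]_n -> R) : Ck k setT f -> continuous f.
Proof. by move=> Cf x; exact: (Ck_continuous Cf). Qed.

Lemma is_derive_slice n (f : 'rV[R]_n.+1 -> R) t y :
  derivable f (consv t y) (delta_mx ord0 ord0) ->
  is_derive t 1 (fun s => f (consv s y)) (partial ord0 f (consv t y)).
Proof.
have e (h : R) : h *: (delta_mx ord0 ord0 : 'rV[R]_n.+1) + consv 0 y = consv h y.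
  by rewrite delta_consv0 consvZ mulr1 scaler0 consvD addr0 add0r.
rewrite -{1}e => /is_derive_line; rewrite e.
by rewrite (_ : (fun h : R => f _) = (fun s => f (consv s y))) //; apply/funext => h; rewrite e.
Qed.

Lemma quotient_slice n (f : 'rV[R]_n.+1 -> R) t y (i : 'I_n) :
  (fun h : R => h^-1 *: (((fun z => f (consv t z)) \o shift y)
     (h *: (delta_mx ord0 i : 'rV[R]_n)) - f (consv t y))) =
  (fun h => h^-1 *: ((f \o shift (consv t y))
     (h *: (delta_mx ord0 (lift ord0 i) : 'rV[R]_n.+1)) - f (consv t y))).
Proof.
by apply/funext => h /=; rewrite delta_consvS consvZ mulr0 consvD add0r.
Qed.

Lemma partial_slice n (f : 'rV[R]_n.+1 -> R) t i :
  partial i (fun z => f (consv t z)) = (fun y => partial (lift ord0 i) f (consv t y)).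
Proof. by apply/funext => y; rewrite /partial /derive quotient_slice. Qed.

Lemma Ck1_slice n (f : 'rV[R]_n.+1 -> R) t : Ck 1 setT f ->
  Ck 1 setT (fun y : 'rV[R]_n => f (consv t y)).
Proof.
move=> Cf; split=> [y _|i].
  by apply: slice_continuous; exact: Ck_continuousT Cf.
split=> [y _|].
  by have := @Ck_derivable _ _ _ _ _ (lift ord0 i) (consv t y) Cf Logic.I; rewrite /derivable quotient_slice.
split=> // y _; rewrite partial_slice; apply: slice_continuous.
exact: Ck_continuousT (Ck_partial _ Cf).
Qed.

(** Differentiation under the integral sign, by the mean value theorem and the
    uniform continuity of the derivative. *)
Lemma is_derive_integral n (f : 'rV[R]_n.+1 -> R) r t : Ck 1 setT f -> supp_in r f ->
  is_derive t 1 (fun s => integral_rV (fun y : 'rV[R]_n => f (consv s y)))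
    (integral_rV (fun y : 'rV[R]_n => partial ord0 f (consv t y))).
Proof.
move=> Cf fr; pose g := partial ord0 f.
have cf : continuous f := Ck_continuousT Cf.
have cg : continuous g := Ck_continuousT (Ck_partial ord0 Cf).
have gr : supp_in r g by exact: partial_supp.
have Cfs s : Cc (fun y : 'rV[R]_n => f (consv s y)) by apply: slice_Cc; split=> //; exists r.
have Cgs s : Cc (fun y : 'rV[R]_n => g (consv s y)) by apply: slice_Cc; split=> //; exists r.
have [C C0 bnd] := integral_rV_bound n r.
pose F s := integral_rV (fun y : 'rV[R]_n => f (consv s y)).
have cvF : (fun h : R => h^-1 *: ((F \o shift t) (h *: 1) - F t)) @ 0^' -->
    integral_rV (fun y : 'rV[R]_n => g (consv t y)).
  apply/cvgrPdist_lt => e e0.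
  have eC : 0 < e / (2 * C) by rewrite divr_gt0 // mulr_gt0.
  have [d d0 Hd] := supp_unif_continuous cg gr eC.
  exists d => // h /=; rewrite sub0r normrN => hd h0.
  rewrite [_%:A]mulr1 /F /=.
  pose D y := -1 * f (consv t y) + f (consv (h + t) y).
  have CD : Cc D.
    split; first by apply: continuousDZ; exact: slice_continuous.
    by exists r => y ry; rewrite /D !(slice_supp _ fr) // mulr0 addr0.
  have ID : integral_rV D = -1 * F t + F (h + t) by rewrite integral_rVDZ.
  pose E y := - h^-1 * D y + g (consv t y).
  have -> : integral_rV (fun y => g (consv t y)) - h^-1 *: (F (h + t) - F t) =
      integral_rV E.
    by rewrite integral_rVDZ // ID /GRing.scale /=; ring.
  apply: (@le_lt_trans _ _ (e / (2 * C) * C)); last first.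
    by rewrite invfM mulrA -mulrA mulVf ?gt_eqF // mulr1; lra.
  apply: bnd => [|y ry|y].
  - apply: continuousDZ; last exact: slice_continuous.
    by case: CD.
  - have gt := slice_supp t gr ry; have ft := slice_supp t fr ry.
    by rewrite /E /D gt ft (slice_supp _ fr ry) !mulr0 !addr0 mulr0.
  - have dy s : `|t - s| <= `|t - (h + t)| ->
        is_derive s 1 (fun s => f (consv s y)) (g (consv s y)).
      by move=> _; apply: is_derive_slice; exact: (@Ck_derivable _ _ _ _ _ _ _ Cf).
    have [c ct e1] := MVT_dist dy.
    have -> : E y = g (consv t y) - g (consv c y).
      have -> : E y = g (consv t y) - h^-1 * (f (consv (h + t) y) - f (consv t y)).
        by rewrite /E /D; ring.
      by rewrite e1 addrK [_ * h]mulrC mulKf.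
    apply/ltW; apply: Hd; rewrite consvB subrr consv_norm0.
    by apply: le_lt_trans ct _; rewrite opprD addrCA subrr addr0 normrN.
apply: DeriveDef; first by apply/cvg_ex; eexists; exact: cvF.
exact: cvg_lim cvF.
Qed.

(** For the first coordinate this is the fundamental theorem of calculus for the
    slice integrals; the other coordinates are differentiated inside the
    slices. *)
Lemma integral_partial0 n (f : 'rV[R]_n -> R) i : Ck 1 setT f ->
  (exists r, supp_in r f) -> integral_rV (partial i f) = 0.
Proof.
elim: n f i => [|n IH] f i; first by case: i.
move=> Cf [r0 fr0]; pose r := Num.max r0 1.
have fr : supp_in r f by apply: supp_in_le fr0; rewrite le_max lexx.
have r_gt0 : 0 < r by rewrite lt_max ltr01 orbT.
case: (unliftP ord0 i) => [j ->|->]; rewrite integral_rVS.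
  rewrite (_ : (fun t => _) = fun=> 0); first by rewrite /Rintegral integral0.
  apply/funext => t; rewrite -partial_slice; apply: IH; first exact: Ck1_slice.
  by exists r; exact: slice_supp.
have cont_supp g : continuous g -> supp_in r g ->
    continuous (fun t => integral_rV (fun y : 'rV[R]_n => g (consv t y))) /\
    supp_in r (fun t : R => integral_rV (fun y : 'rV[R]_n => g (consv t y))).
  move=> cg gr; split; first by apply: (@slice_integral_Cc _ _ g _).1; split=> //; exists r.
  move=> t rt; rewrite (_ : (fun y => _) = fun=> 0) ?integral_rV0 //.
  by apply/funext => y; apply: gr; exact: lt_le_trans (norm_consvl _ _).
have [_ Fr] := cont_supp _ (Ck_continuousT Cf) fr.
have [cG Gr] := cont_supp _ (Ck_continuousT (Ck_partial ord0 Cf)) (partial_supp _ fr).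
by apply: (Rintegral_derive0 r_gt0 cG Fr Gr) => t; exact: is_derive_integral fr.
Qed.

End IntegralOfDerivative.

(** * Outer functions of one variable *)

Section OneVariableSmoothness.
Variable R : realType.
Implicit Types (I : set R) (F G : R -> R) (t : R).

Lemma C1k_eq k I F G : open I -> (forall t, I t -> F t = G t) -> C1k k I F -> C1k k I G.
Proof.
move=> oI; have near_eq (H K : R -> R) t : (forall t, I t -> H t = K t) -> I t ->
    \near t, H t = K t.
  move=> HK It; near=> s; apply: HK; near: s; exact: open_nbhs_nbhs.
have cont_eq (H K : R -> R) t : (forall t, I t -> H t = K t) -> I t ->
    {for t, continuous H} -> {for t, continuous K}.
  move=> HK It cH; have cK : H @ t --> K t by rewrite -(HK _ It); exact: cH.
  exact: cvg_trans (near_eq_cvg (near_eq _ _ _ HK It)) cK.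
elim: k F G => [|k IH] F G FG [cF dF].
  by split=> // t It; apply: cont_eq FG It (cF _ It).
split=> [t It|]; first exact: cont_eq FG It (cF _ It).
have [dF1 CF1] := dF; split=> [t It|].
  exact: near_eq_derivable (near_eq _ _ _ FG It) (dF1 _ It).
apply: IH CF1 => t It; rewrite !derive1E; exact: near_eq_derive (near_eq _ _ _ FG It).
Unshelve. all: by end_near. Qed.

Lemma is_derive_continuous F (t d : R) : is_derive t 1 F d -> {for t, continuous F}.
Proof. by move=> [dF _]; exact/differentiable_continuous/derivable1_diffP. Qed.

(** This gives smoothness without a formula for iterated derivatives. *)
Lemma C1k_stable (C : set (R -> R)) I : open I ->
  (forall F, C F -> exists2 G, C G & forall t : R, I t -> is_derive t 1 F (G t)) ->
  forall k F, C F -> C1k k I F.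
Proof.
move=> oI CI; elim=> [|k IH] F CF; have [G CG FG] := CI _ CF.
  by split=> // t It; exact: is_derive_continuous (FG t It).
split=> [t It|]; first exact: is_derive_continuous (FG t It).
split=> [t It|]; first by have [] := FG t It.
by apply: C1k_eq (IH _ CG) => // t It; rewrite derive1E; have [_ ->] := FG t It.
Qed.

Lemma C1k_one F F1 I : open I -> (forall t : R, I t -> is_derive t 1 F (F1 t)) ->
  (forall t, I t -> {for t, continuous F1}) -> C1k 1 I F.
Proof.
move=> oI d1 c1; split=> [t It|]; first exact: is_derive_continuous (d1 t It).
split=> [t It|]; first by have [] := d1 t It.
by apply: (@C1k_eq _ _ F1) => // t It; rewrite derive1E; have [_ ->] := d1 t It.
Qed.

Lemma C1k_two F F1 F2 I : open I -> (forall t : R, I t -> is_derive t 1 F (F1 t)) ->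
  (forall t : R, I t -> is_derive t 1 F1 (F2 t)) ->
  (forall t, I t -> {for t, continuous F2}) ->
  C1k 2 I F.
Proof.
move=> oI d1 d2 c2.
split=> [t It|]; first exact: is_derive_continuous (d1 t It).
split=> [t It|]; first by have [] := d1 t It.
apply: (@C1k_eq _ _ F1) => // [t It|]; first by rewrite derive1E; have [_ ->] := d1 t It.
exact: C1k_one d2 c2.
Qed.

Lemma is_derive_expV m (t : R) : t != 0 ->
  is_derive t 1 (fun t => t^-1 ^+ m) (- m%:R * t^-1 ^+ m.+1).
Proof.
move=> t0; elim: m => [|m IH].
  have -> : (fun t : R => t^-1 ^+ 0) = cst 1 by apply/funext => s; rewrite expr0.
  by rewrite mulr0n oppr0 mul0r; exact: is_derive_cst.
have d1 : is_derive t 1 (fun t : R => t^-1) (- t^-1 ^+ 2).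
  have [dV eV] : is_derive t 1 (fun t : R => (id t)^-1) (- (id t) ^- 2 *: 1).
    exact: is_deriveV.
  by apply: DeriveDef => //; rewrite eV /GRing.scale /= mulr1 exprVn.
have -> : (fun t : R => t^-1 ^+ m.+1) = (fun t => t^-1 * t^-1 ^+ m).
  by apply/funext => s; rewrite exprS.
apply: is_derive_eq (is_deriveM d1 IH) _.
by rewrite /GRing.scale /= !exprS -natr1; ring.
Qed.

Lemma C1k_inv k : C1k k [set t : R | t != 0] (fun t => t^-1).
Proof.
have oI : open [set t : R | t != 0] by exact: open_neq.
apply: (@C1k_stable [set F | exists a m, F = fun t => a * (t^-1) ^+ m]) => //.
- move=> _ [a [m ->]].
  exists (fun t => - (m%:R * a) * t^-1 ^+ m.+1); first by exists (- (m%:R * a)), m.+1.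
  move=> t t0.
  apply: is_derive_eq (is_deriveZ a (is_derive_expV m t0)) _.
  by rewrite /GRing.scale /=; ring.
- exists 1; exists 1%N; apply/funext => t; by rewrite expr1 mul1r.
Qed.

(** The terms t^-m exp(-1/t), extended by 0: they are flat at 0 and their
    derivatives are combinations of terms of the same kind. *)
Definition flat_term (m : nat) (t : R) : R :=
  if 0 < t then t^-1 ^+ m * expR (- t^-1) else 0.

Definition flat : R -> R := flat_term 0.

Lemma flat_gt0 t : 0 < t -> 0 < flat t.
Proof. by move=> t0; rewrite /flat /flat_term t0 expr0 mul1r expR_gt0. Qed.

Lemma flat_eq0 t : t <= 0 -> flat t = 0.
Proof. by move=> t0; rewrite /flat /flat_term ltNge t0. Qed.

Lemma flat_ge0 t : 0 <= flat t.
Proof.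
by have [t0|t0] := leP t 0; [rewrite flat_eq0|exact/ltW/flat_gt0].
Qed.

(** Comparison of exp(1/t) with a power of 1/t, which makes the difference
    quotients at 0 tend to 0. *)
Lemma flat_term_bound m t : `|flat_term m t| <= (m.+2)%:R ^+ m.+2 * t ^+ 2.
Proof.
rewrite /flat_term; case: ifPn => [t0|_]; last first.
  by rewrite normr0 mulr_ge0 ?sqr_ge0 // exprn_ge0 // ler0n.
have s0 : 0 < t^-1 by rewrite invr_gt0.
rewrite ger0_norm; last by rewrite mulr_ge0 ?expR_ge0 // exprn_ge0 // ltW.
rewrite -ler_pdivrMr ?exprn_gt0 // expRN -exprVn mulrAC -exprD addn2.
rewrite ler_pdivrMr ?expR_gt0 //.
have k0 : 0 < (m.+2)%:R :> R by rewrite ltr0n.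
have -> : expR t^-1 = expR (t^-1 / (m.+2)%:R) ^+ m.+2.
  by rewrite -expRM_natl mulrC divfK ?gt_eqF.
rewrite -exprMn lerXn2r ?nnegrE ?mulr_ge0 ?expR_ge0 ?(ltW s0) ?(ltW k0) //.
rewrite -ler_pdivrMl // mulrC; apply: le_trans (expR_ge1Dx _).
by rewrite lerDr.
Qed.

Lemma is_derive_flat_term m t :
  is_derive t 1 (flat_term m) (- m%:R * flat_term m.+1 t + flat_term m.+2 t).
Proof.
have [t0|t0|->] := ltgtP t 0.
- have e : \near t, (fun=> 0) t = flat_term m t.
    near=> s; rewrite /flat_term ltNge ltW //; near: s; exact: lt_nbhsl.
  apply: (near_eq_is_derive e).
  rewrite /flat_term !(ltNge 0 t) (ltW t0) /= mulr0 addr0; exact: is_derive_cst.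
- have e : \near t, (fun t => t^-1 ^+ m * expR (- t^-1)) t = flat_term m t.
    near=> s; rewrite /flat_term ifT //; near: s; exact: lt_nbhsr.
  apply: (near_eq_is_derive e).
  have t00 : t != 0 by rewrite gt_eqF.
  have d1 : is_derive t 1 (fun t : R => t^-1) (- t^-1 ^+ 2).
    have e1 : (fun t : R => t^-1 ^+ 1) = (fun t => t^-1).
      by apply/funext => s; rewrite expr1.
    by have := is_derive_expV 1 t00; rewrite e1 mulN1r.
  have d3 : is_derive t 1 (fun t : R => expR (- t^-1)) (expR (- t^-1) * (- - t^-1 ^+ 2)).
    exact: is_derive1_comp.
  apply: is_derive_eq (is_deriveM (is_derive_expV m t00) d3) _.
  by rewrite /flat_term t0 /GRing.scale /= !exprS; ring.
- have cv : (fun h : R => h^-1 *: ((flat_term m \o shift 0) (h *: 1) - flat_term m 0))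
      @ 0^' --> (0 : R).
    pose B : R := (m.+2)%:R ^+ m.+2.
    have B0 : 0 < B by rewrite exprn_gt0 // ltr0n.
    apply/cvgrPdist_lt => e e0; exists (e / B); first by rewrite /= divr_gt0.
    move=> h /=; rewrite !sub0r !normrN => hd h0.
    rewrite {2}/flat_term ltxx subr0 addr0 [_%:A]mulr1.
    rewrite normrM normfV mulrC ltr_pdivrMr ?normr_gt0 //.
    apply: le_lt_trans (flat_term_bound _ _) _; rewrite -/B -real_normK ?num_real //.
    rewrite expr2 mulrA ltr_pM2r ?normr_gt0 //.
    by move: hd; rewrite ltr_pdivlMr // mulrC.
  rewrite /flat_term ltxx mulr0 addr0.
  apply: DeriveDef; first by apply/cvg_ex; eexists; exact: cv.
  exact: cvg_lim cv.
Unshelve. all: by end_near. Qed.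

Inductive flat_span : (R -> R) -> Prop :=
| flat_span_term m : flat_span (flat_term m)
| flat_span_lin a F G : flat_span F -> flat_span G -> flat_span (fun t => a * F t + G t).

Lemma C1k_flat k : C1k k setT flat.
Proof.
apply: (@C1k_stable flat_span) => //; first exact: openT; last exact: flat_span_term.
move=> F; elim=> [m|a {}F G _ [F' CF' dF] _ [G' CG' dG]].
  exists (fun t => - m%:R * flat_term m.+1 t + flat_term m.+2 t).
    by apply: flat_span_lin; exact: flat_span_term.
  by move=> t _; exact: is_derive_flat_term.
exists (fun t => a * F' t + G' t); first exact: flat_span_lin.
move=> t It; apply: is_deriveD; [apply: is_deriveZ; exact: dF|exact: dG].
Qed.

End OneVariableSmoothness.

(** * Test functions *)

Section TestFunctions.
Variables (R : realType) (N : nat).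
Local Notation rV := 'rV[R]_N.
Local Notation Cc := (@compactly_continuous R N).
Implicit Types (U W K : set rV) (f g phi psi zeta : rV -> R) (i j : 'I_N) (x y : rV).

Lemma smooth_subset U W f : W `<=` U -> smooth U f -> smooth W f.
Proof. by move=> WU sf k; exact: Ck_subset (sf k). Qed.

Lemma smooth_eq U f g : open U -> (forall x, U x -> f x = g x) -> smooth U f -> smooth U g.
Proof. by move=> oU fg sf k; exact: Ck_eq fg (sf k). Qed.

Lemma smooth_cst U (a : R) : smooth U (fun=> a).
Proof. by move=> k; exact: Ck_cst. Qed.

Lemma smoothD U f g : open U -> smooth U f -> smooth U g -> smooth U (fun x => f x + g x).
Proof. by move=> oU sf sg k; exact: CkD. Qed.

Lemma smoothB U f g : open U -> smooth U f -> smooth U g -> smooth U (fun x => f x - g x).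
Proof. by move=> oU sf sg k; exact: CkB. Qed.

Lemma smoothM U f g : open U -> smooth U f -> smooth U g -> smooth U (fun x => f x * g x).
Proof. by move=> oU sf sg k; exact: CkM. Qed.

Lemma smooth_sum (T : Type) (s : seq T) U (f : T -> rV -> R) : open U ->
  (forall l, smooth U (f l)) -> smooth U (fun x => \sum_(l <- s) f l x).
Proof. by move=> oU sf k; apply: Ck_sum => // l; exact: sf. Qed.

Lemma smooth_partial U f i : smooth U f -> smooth U (partial i f).
Proof. by move=> sf k; exact: Ck_partial. Qed.

Lemma smooth_comp U (I : set R) (F : R -> R) u : open U -> (forall x, U x -> I (u x)) ->
  (forall k, C1k k I F) -> smooth U u -> smooth U (fun x => F (u x)).
Proof. by move=> oU UI CF su k; exact: Ck_comp UI (CF k) (su k). Qed.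

Lemma smooth_inv U f : open U -> (forall x, U x -> f x != 0) -> smooth U f ->
  smooth U (fun x => (f x)^-1).
Proof. by move=> oU f0 sf; apply: smooth_comp f0 (@C1k_inv R) sf. Qed.

Lemma smooth_derivable U f i x : smooth U f -> U x -> derivable f x (delta_mx ord0 i).
Proof. by move=> sf Ux; case: (sf 1%N) => _ /(_ i)[+ _]; apply. Qed.

Lemma smooth_continuous U f x : smooth U f -> U x -> {for x, continuous f}.
Proof. by move=> sf; exact: Ck_continuous (sf 0%N). Qed.

Lemma compact_bounded_norm K : compact K -> exists r : R, forall x, K x -> `|x| <= r.
Proof.
move=> /compact_bounded[M [_ HM]]; exists (M + 1) => x Kx.
by apply: HM => //; rewrite ltrDl.
Qed.

Lemma compact_closed_rV K : compact K -> closed K.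
Proof. by apply: compact_closed; exact: norm_hausdorff. Qed.

(** A product is as regular as its factors when one factor has compact support
    in the open set where the other one is regular, since the product vanishes
    outside. *)
Lemma Ck_extend k U K g zeta : open U -> compact K -> K `<=` U -> Ck k U g ->
  Ck k U zeta -> (forall x, ~ K x -> zeta x = 0) -> Ck k setT (fun x => g x * zeta x).
Proof.
move=> oU cK KU Cg Cz z0; apply: Ck_local => x _.
have [Ux|nUx] := pselect (U x); first by exists U => //; exact: CkM.
have oK : open (~` K) by apply: closed_openC; exact: compact_closed_rV.
exists (~` K); first by move=> /KU.
apply: Ck_eq (@Ck_cst R N k (~` K) 0) => // y Ky.
by rewrite z0 // mulr0.
Qed.

Lemma test_smooth U phi : test_function U phi -> smooth setT phi.
Proof. by move=> [K [_ _ []]]. Qed.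

Lemma test_subset U W phi : W `<=` U -> test_function W phi -> test_function U phi.
Proof. by move=> WU [K [cK KW sK]]; exists K; split => //; exact: subset_trans WU. Qed.

Lemma test_supp U phi : test_function U phi -> exists r, supp_in r phi.
Proof.
move=> [K [cK KU [_ phi0]]]; have [r Kr] := compact_bounded_norm cK.
by exists r => x rx; apply: phi0 => /Kr; rewrite leNgt rx.
Qed.

Lemma test_Cc U phi : test_function U phi -> Cc phi.
Proof.
move=> tp; split; last exact: test_supp tp.
by move=> x; exact: smooth_continuous (test_smooth tp) _.
Qed.

Lemma test_out U phi x : test_function U phi -> ~ U x -> phi x = 0.
Proof. by move=> [K [_ KU [_ phi0]]] nUx; apply: phi0 => /KU. Qed.

Lemma testDZ U (a : R) phi psi : test_function U phi -> test_function U psi ->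
  test_function U (fun x => a * phi x + psi x).
Proof.
move=> [K [cK KU [sp p0]]] [L [cL LU [sq q0]]]; exists (K `|` L); split.
- exact: compactU.
- by move=> x [/KU|/LU].
- split; first by apply: smoothD; [exact: openT| |exact: sq];
    apply: smoothM => //; [exact: openT|exact: smooth_cst].
  by move=> x /not_orP[Kx Lx]; rewrite p0 // q0 // mulr0 addr0.
Qed.

Lemma test_mul U g phi : open U -> smooth U g -> test_function U phi ->
  test_function U (fun x => g x * phi x).
Proof.
move=> oU sg [K [cK KU [sp p0]]]; exists K; split=> //; split.
  by move=> k; apply: Ck_extend oU cK KU (sg k) (Ck_subset _ (sp k)) p0.
by move=> x Kx; rewrite p0 // mulr0.
Qed.

Lemma test_partial U phi i : test_function U phi -> test_function U (partial i phi).
Proof.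
move=> [K [cK KU [sp p0]]]; exists K; split=> //; split; first exact: smooth_partial.
move=> x Kx; have oK : open (~` K) by apply: closed_openC; exact: compact_closed_rV.
by rewrite (@partial_eq _ _ (~` K) _ (fun=> 0)) // ?partial_cst // => y; exact: p0.
Qed.

Lemma test0 U : test_function U (fun=> 0).
Proof.
by exists set0; split => //; [exact: compact0|split=> //; exact: smooth_cst].
Qed.

Lemma testZ U (a : R) phi : test_function U phi -> test_function U (fun x => a * phi x).
Proof.
move=> tp; have := testDZ a tp (test0 U).
by congr test_function; apply/funext => x; rewrite addr0.
Qed.

Lemma testD U phi psi : test_function U phi -> test_function U psi ->
  test_function U (fun x => phi x + psi x).
Proof.
move=> tp tq; have := testDZ 1 tp tq.
by congr test_function; apply/funext => x; rewrite mul1r.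
Qed.

Lemma test_sum (T : Type) (s : seq T) U (f : T -> rV -> R) :
  (forall l, test_function U (f l)) -> test_function U (fun x => \sum_(l <- s) f l x).
Proof.
move=> tf; elim: s => [|a s IH].
  by have := test0 U; congr test_function; apply/funext => x; rewrite big_nil.
have := testD (tf a) IH; congr test_function; apply/funext => x.
by rewrite big_cons.
Qed.

Definition supported k U f : Prop :=
  exists K, [/\ compact K, K `<=` U, Ck k setT f & forall x, ~ K x -> f x = 0].

Lemma test_supported k U phi : test_function U phi -> supported k U phi.
Proof. by move=> [K [cK KU [sp p0]]]; exists K; split. Qed.

Lemma supported_le k l U f : (k <= l)%N -> supported l U f -> supported k U f.
Proof. by move=> kl [K [cK KU Cf f0]]; exists K; split=> //; exact: Ck_le kl Cf. Qed.

Lemma supported_supp k U f : supported k U f -> exists r, supp_in r f.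
Proof.
move=> [K [cK KU _ f0]]; have [r Kr] := compact_bounded_norm cK.
by exists r => x rx; apply: f0 => /Kr; rewrite leNgt rx.
Qed.

Lemma supported_partial k U f i : supported k.+1 U f -> supported k U (partial i f).
Proof.
move=> [K [cK KU Cf f0]]; exists K; split=> //; first exact: Ck_partial.
move=> x Kx; have oK : open (~` K) by apply: closed_openC; exact: compact_closed_rV.
by rewrite (@partial_eq _ _ (~` K) _ (fun=> 0)) // ?partial_cst // => y; exact: f0.
Qed.

Lemma supported_mul k U g f : open U -> Ck k U g -> supported k U f ->
  supported k U (fun x => g x * f x).
Proof.
move=> oU Cg [K [cK KU Cf f0]]; exists K; split=> //.
  by apply: Ck_extend oU cK KU Cg (Ck_subset _ Cf) f0.
by move=> x Kx; rewrite f0 // mulr0.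
Qed.

Lemma supported_Cc k U f : supported k U f -> Cc f.
Proof.
move=> sf; split; last exact: supported_supp sf.
by have [K [_ _ Cf _]] := sf; exact: Ck_continuousT Cf.
Qed.

Lemma Cc_mul_supported k U g f : open U -> (forall x, U x -> {for x, continuous g}) ->
  supported k U f -> Cc (fun x => g x * f x).
Proof.
move=> oU cg sf; apply: (@supported_Cc 0 U).
by apply: supported_mul => //; exact: supported_le sf.
Qed.

Lemma Cc_mul U g phi : open U -> (forall x, U x -> {for x, continuous g}) ->
  test_function U phi -> Cc (fun x => g x * phi x).
Proof. by move=> oU cg tp; apply: Cc_mul_supported oU cg (test_supported 0 tp). Qed.

Lemma CcDZ (a : R) f g : Cc f -> Cc g -> Cc (fun x => a * f x + g x).
Proof.
move=> Cf Cg; split; first by apply: continuousDZ; [case: Cf|case: Cg].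
have [r [_ h1 h2]] := Cc_supp2 Cf Cg.
by exists r => x rx; rewrite h1 // h2 // mulr0 addr0.
Qed.

Lemma Cc0 : Cc (fun=> 0).
Proof. by split; [exact: cst_continuous|exists 0]. Qed.

Lemma integral_Cc_sum (T : Type) (l : seq T) (H : T -> rV -> R) :
  (forall t, Cc (H t)) -> Cc (fun x => \sum_(t <- l) H t x) /\
  integral_rV (fun x => \sum_(t <- l) H t x) = \sum_(t <- l) integral_rV (H t).
Proof.
move=> CH; elim: l => [|t l [CS IS]].
  rewrite big_nil (_ : (fun x => _) = fun=> 0); last by apply/funext => x; rewrite big_nil.
  by split; [exact: Cc0|exact: integral_rV0].
have e : (fun x => \sum_(t <- t :: l) H t x) =
         (fun x => 1 * H t x + \sum_(t <- l) H t x).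
  by apply/funext => x; rewrite big_cons mul1r.
rewrite e; split; first exact: CcDZ.
by rewrite integral_rVDZ // mul1r IS big_cons.
Qed.

Lemma le_integral_rV f g : Cc f -> Cc g -> (forall x, f x <= g x) ->
  integral_rV f <= integral_rV g.
Proof.
move=> Cf Cg fg; have : 0 <= integral_rV (fun x => -1 * f x + g x).
  by apply: integral_rV_ge0 => x; rewrite mulN1r addrC subr_ge0.
by rewrite integral_rVDZ // mulN1r addrC subr_ge0.
Qed.

Lemma Cc_comp (F : R -> R) f : continuous F -> F 0 = 0 -> Cc f -> Cc (fun x => F (f x)).
Proof.
move=> cF F0 [cf [r fr]]; split; last by exists r => x /fr ->.
by move=> x; apply: continuous_comp; [exact: cf|exact: cF].
Qed.

Lemma integral_rVZ (a : R) f : Cc f -> integral_rV (fun x => a * f x) = a * integral_rV f.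
Proof.
move=> Cf; have := integral_rVDZ a Cf Cc0; rewrite integral_rV0 addr0 => <-.
by congr integral_rV; apply/funext => x; rewrite addr0.
Qed.

Definition bump x0 (r : R) x : R := flat (r ^+ 2 - \sum_i (x ord0 i - x0 ord0 i) ^+ 2).

Lemma bump_ge0 x0 r x : 0 <= bump x0 r x.
Proof. exact: flat_ge0. Qed.

Lemma bump_center x0 r : 0 < r -> 0 < bump x0 r x0.
Proof.
move=> r0; apply: flat_gt0; rewrite big1 ?subr0 ?exprn_gt0 // => i _.
by rewrite subrr expr0n.
Qed.

Lemma bump_out x0 r x : 0 < r -> r < `|x0 - x| -> bump x0 r x = 0.
Proof.
move=> r0 rx; apply: flat_eq0; rewrite subr_le0 leNgt; apply/negP => Hs.
move: rx; rewrite ltNge => /negP; apply; apply: rV_norm_le => [|i]; first exact: ltW.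
rewrite leNgt; apply/negP => ri; move: Hs; rewrite ltNge => /negP; apply.
rewrite (bigD1 i) //= ler_wpDr //; first by apply: sumr_ge0 => j _; exact: sqr_ge0.
rewrite -[leRHS]real_normK ?num_real // lerXn2r ?nnegrE ?(ltW r0) //.
by move: ri; rewrite !mxE distrC => /ltW.
Qed.

Lemma smooth_bump x0 r : smooth setT (bump x0 r).
Proof.
have oT : open (setT : set rV) by exact: openT.
apply: (smooth_comp (I := setT)) => // [k|]; first exact: C1k_flat.
apply: smoothB => //; first exact: smooth_cst.
apply: smooth_sum => // i.
have sB : smooth setT (fun y : rV => y ord0 i - x0 ord0 i).
  by apply: smoothB => //; [move=> k; exact: Ck_coord|exact: smooth_cst].
apply: (smooth_eq oT _ (smoothM oT sB sB)) => y _.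
by rewrite expr2.
Qed.

Lemma compact_center_ball x0 (r : R) : compact [set x | `|x0 - x| <= r].
Proof.
apply: bounded_closed_compact.
  exists (`|x0| + r); split; first exact: num_real.
  move=> M HM x xr; apply: (@le_trans _ _ (`|x0| + r)); last exact: ltW.
  by rewrite -[x](subKr x0) (le_trans (ler_normB _ _)) // lerD2l.
apply: (@closed_comp _ _ (fun x : rV => `|x0 - x|) [set t : R | t <= r]).
  move=> x _; apply/continuous_epsP => e e0; exists e => // y xy.
  apply: le_lt_trans (ler_dist_dist _ _) _.
  by rewrite opprB addrC addrA subrK distrC.
exact: closed_le.
Qed.

Lemma bump_in U x0 : open U -> U x0 -> exists2 r : R, 0 < r &
  test_function U (bump x0 r).
Proof.
move=> oU Ux; have /nbhs_normP[d /= d0 Ud] := open_nbhs_nbhs (conj oU Ux).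
exists (d / 2); first by rewrite divr_gt0.
have d20 : 0 < d / 2 by rewrite divr_gt0.
exists [set x | `|x0 - x| <= d / 2]; split.
- exact: compact_center_ball.
- move=> x xd; apply: Ud; apply: le_lt_trans (xd : `|x0 - x| <= d / 2) _; lra.
- split; first exact: smooth_bump.
  by move=> x nx; apply: bump_out => //; rewrite ltNge; apply/negP.
Qed.

Lemma test_bump U x0 : open U -> U x0 ->
  exists phi, [/\ test_function U phi, (forall x, 0 <= phi x) & 0 < phi x0].
Proof.
move=> oU Ux; have [r r0 tb] := bump_in oU Ux; exists (bump x0 r).
by split=> //; [exact: bump_ge0|exact: bump_center].
Qed.

(** The fundamental lemma of the calculus of variations. *)
Lemma le_of_integral U f g : open U ->
  (forall x, U x -> {for x, continuous f}) -> (forall x, U x -> {for x, continuous g}) ->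
  (forall phi, test_function U phi -> (forall x, 0 <= phi x) ->
     integral_rV (fun x => f x * phi x) <= integral_rV (fun x => g x * phi x)) ->
  forall x, U x -> f x <= g x.
Proof.
move=> oU cf cg H x Ux; rewrite leNgt; apply/negP => gf.
pose W := U `&` [set y | g y < f y].
have nW : nbhs x [set y | U y /\ g y < f y].
  apply: filterI; first exact: open_nbhs_nbhs.
  have c : {for x, continuous (fun y => f y - g y)} by exact: continuousB (cf _ Ux) (cg _ Ux).
  have /continuous_epsP/(_ (f x - g x))[|d d0 Hd] := c; first by rewrite subr_gt0.
  apply: filterS (nbhs_norm_lt x d0) => y /= /Hd.
  by rewrite ltr_norml => /andP[_]; lra.
have [phi [tphi phi0 phix]] := test_bump (@open_interior _ [set y | U y /\ g y < f y]) nW.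
have sub : (interior [set y | U y /\ g y < f y]) `<=` U by move=> y /interior_subset[].
have tU := test_subset sub tphi.
have cfp := Cc_mul oU cf tU; have cgp := Cc_mul oU cg tU.
have := H _ tU phi0; apply/negP; rewrite -ltNge -subr_gt0.
have e : integral_rV (fun x => f x * phi x) - integral_rV (fun x => g x * phi x) =
    integral_rV (fun x => -1 * (g x * phi x) + f x * phi x).
  by rewrite integral_rVDZ // mulN1r addrC.
rewrite e; apply: (@integral_rV_gt0 _ _ _ x).
- split; first by apply: continuousDZ; [case: cgp|case: cfp].
  have [r [_ gr fr]] := Cc_supp2 cgp cfp.
  by exists r => y ry; rewrite gr // fr // mulr0 addr0.
- move=> y; have [/interior_subset[_ gfy]|nI] := pselect (interior [set y | U y /\ g y < f y] y).
    by rewrite mulN1r addrC -mulrBl mulr_ge0 // subr_ge0 ltW.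
  by rewrite (test_out tphi nI) !mulr0 addr0.
- by rewrite mulN1r addrC -mulrBl mulr_gt0 // subr_gt0.
Qed.

Lemma eq_of_integral U f g : open U ->
  (forall x, U x -> {for x, continuous f}) -> (forall x, U x -> {for x, continuous g}) ->
  (forall phi, test_function U phi ->
     integral_rV (fun x => f x * phi x) = integral_rV (fun x => g x * phi x)) ->
  forall x, U x -> f x = g x.
Proof.
move=> oU cf cg H x Ux; apply/eqP; rewrite eq_le; apply/andP; split.
  by apply: (le_of_integral oU cf cg) => // phi /H ->.
by apply: (le_of_integral oU cg cf) => // phi /H ->.
Qed.

End TestFunctions.

(** * Functionals of order zero *)

Section FunctionalsOfOrderZero.
Variables (R : realType) (N : nat).
Local Notation rV := 'rV[R]_N.
Local Notation Cc := (@compactly_continuous R N).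
Implicit Types (U K : set rV) (f phi psi : rV -> R) (T : functional R N).

Lemma Cc_bounded f : compactly_continuous f -> exists2 B : R, 0 <= B & forall x, `|f x| <= B.
Proof.
move=> [cf [r fr]]; pose s := Num.max r 0.
have s0 : 0 <= s by rewrite le_max lexx orbT.
have b0 : [set x : rV | `|x| <= s] !=set0 by exists 0; rewrite /= normr0.
have cn : {within [set x : rV | `|x| <= s], continuous (fun x => `|f x|)}.
  by apply: continuous_subspaceT => x; exact: (cvg_norm (cf x)).
have [z _ zmax] := EVT_max_rV b0 (@compact_norm_ball R N s) cn.
exists `|f z| => // x; have [xs|sx] := leP `|x| s; first by apply: zmax; exact: mem_set.
by rewrite fr ?normr0 //; apply: le_lt_trans sx; rewrite le_max lexx.
Qed.

Lemma sup_le_Ck_norm phi x : compactly_continuous phi -> `|phi x| <= Ck_norm 0 phi.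
Proof.
move=> /Cc_bounded[B B0 phiB]; apply: sup_upper_bound; last by exists [::], x.
split; first by exists `|phi 0|, [::], 0.
by exists B => _ [[|? ?] [y [// _ ->]]]; exact: phiB.
Qed.

Definition linear_on U T : Prop := forall (a : R) phi psi,
  test_function U phi -> test_function U psi ->
  T (fun x => a * phi x + psi x) = a * T phi + T psi.

Lemma linear_on0 U T : linear_on U T -> T (fun=> 0) = 0.
Proof.
move=> lin; have := lin (-1) _ _ (test0 U) (test0 U).
have -> : (fun _ : rV => -1 * 0 + 0 : R) = fun=> 0 by apply/funext => x; ring.
by rewrite mulN1r addNr.
Qed.

Lemma linear_onZ U T (a : R) phi : linear_on U T -> test_function U phi ->
  T (fun x => a * phi x) = a * T phi.
Proof.
move=> lin tp; have := lin a _ _ tp (test0 U).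
rewrite (linear_on0 lin) addr0 => <-; congr T; apply/funext => x; ring.
Qed.

Lemma linear_onD U T phi psi : linear_on U T -> test_function U phi ->
  test_function U psi -> T (fun x => phi x + psi x) = T phi + T psi.
Proof.
move=> lin tp tq; have := lin 1 _ _ tp tq.
rewrite mul1r => <-; congr T; apply/funext => x; ring.
Qed.

Lemma linear_onB U T phi psi : linear_on U T -> test_function U phi ->
  test_function U psi -> T (fun x => phi x - psi x) = T phi - T psi.
Proof.
move=> lin tp tq; have := lin (-1) _ _ tq tp.
rewrite mulN1r addrC => <-; congr T; apply/funext => x; ring.
Qed.

Lemma linear_on_sum (I : Type) (s : seq I) U T (f : I -> rV -> R) : linear_on U T ->
  (forall l, test_function U (f l)) ->
  T (fun x => \sum_(l <- s) f l x) = \sum_(l <- s) T (f l).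
Proof.
move=> lin tf; elim: s => [|a s IH].
  by rewrite big_nil -[RHS](linear_on0 lin); congr T; apply/funext => x; rewrite big_nil.
rewrite big_cons -IH -(linear_onD lin (tf a) (test_sum s tf)); congr T.
by apply/funext => x; rewrite big_cons.
Qed.

Lemma Cc_norm f : Cc f -> Cc (fun x => `|f x|).
Proof.
by move=> Cf; apply: (@Cc_comp R N (fun t : R => `|t|)) => //;
  [exact: norm_continuous|rewrite normr0].
Qed.

(** Linearity turns the one-sided bound into a two-sided one, and on a fixed
    compact set the L^1 norm is dominated by the supremum norm. *)
Lemma order0_of_L1 U (T : functional R N) (k : R) : linear_on U T ->
  (forall f, test_function U f -> T f <= k * integral_rV (fun x => `|f x|)) ->
  forall K, compact K -> K `<=` U -> exists2 C : R, 0 <= C & forall phi (B : R),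
    smooth_supported_in K phi -> (forall x, `|phi x| <= B) -> `|T phi| <= C * B.
Proof.
move=> Tlin Tk K cK KU; have [r Kr] := compact_bounded_norm cK.
have [C C0 IC] := integral_rV_bound N r; exists (`|k| * C); first by rewrite mulr_ge0 // ltW.
move=> phi B [sp p0] pB.
have tp : test_function U phi by exists K.
have Cp := Cc_norm (test_Cc tp).
have hI : k * integral_rV (fun x => `|phi x|) <= `|k| * C * B.
  have h0 : 0 <= integral_rV (fun x => `|phi x|) by apply: integral_rV_ge0.
  have h1 : integral_rV (fun x => `|phi x|) <= B * C.
    apply: le_trans (ler_norm _) _.
    apply: IC; [by case: Cp| |by move=> x; rewrite normr_id].
    by move=> x rx; rewrite p0 ?normr0 // => /Kr; rewrite leNgt rx.
  rewrite -mulrA [C * B]mulrC; apply: (@le_trans _ _ (`|k| * integral_rV (fun x => `|phi x|))).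
    by rewrite ler_wpM2r // ler_norm.
  by rewrite ler_wpM2l.
have h1 : T phi <= `|k| * C * B by apply: le_trans hI; exact: Tk.
have h2 : - T phi <= `|k| * C * B.
  rewrite -mulN1r -(linear_onZ (-1) Tlin tp); apply: le_trans (Tk _ (testZ (-1) tp)) _.
  by under eq_fun do rewrite mulN1r normrN.
by rewrite ler_norml; apply/andP; split; lra.
Qed.

End FunctionalsOfOrderZero.

(** * Open sets and truncation *)

Section SetsOfRn.
Variables (R : realType) (N : nat).
Local Notation rV := 'rV[R]_N.
Implicit Types (U K W : set rV) (f g : rV -> R).

Lemma open_ballP U x : open U -> U x -> exists2 r : R, 0 < r & forall y, `|x - y| < r -> U y.
Proof.
move=> oU Ux; have /nbhs_ballP[r r0 rU] : nbhs x U by exact: open_nbhs_nbhs.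
by exists r => // y xy; apply: rU; rewrite -ball_normE.
Qed.

Lemma open_superlevel U f (m : R) : open U -> (forall x, U x -> {for x, continuous f}) ->
  open (U `&` [set x | m < f x]).
Proof.
move=> oU cf; rewrite openE => x [Ux mx]; apply/nbhs_ballP.
have [r r0 rU] := open_ballP oU Ux.
have mf : 0 < f x - m by rewrite subr_gt0.
have /continuous_epsP/(_ _ mf)[d d0 Hd] := cf x Ux.
exists (Num.min r d); first by rewrite /= lt_min r0.
move=> y; rewrite -ball_normE /= lt_min => /andP[yr yd]; split; first exact: rU.
by have := Hd _ yd; rewrite ltr_norml => /andP[_]; rewrite /=; lra.
Qed.

Lemma compact_upper_bound K f : compact K -> (forall x, K x -> {for x, continuous f}) ->
  exists b, forall x, K x -> f x <= b.
Proof.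
move=> cK cf.
have : compact (f @` K).
  by apply: continuous_compact => //; apply: continuous_in_subspaceT => x /set_mem; exact: cf.
move=> /compact_bounded[B [_ HB]]; exists (B + 1) => x Kx.
by apply: le_trans (ler_norm _) _; apply: HB; [rewrite ltrDl|exists x].
Qed.

Lemma closure_meets U (A : set rV) x : open U -> U x -> closure A x -> exists2 y, A y & U y.
Proof.
by move=> oU Ux /(_ _ (open_nbhs_nbhs (conj oU Ux)))[y [Ay Uy]]; exists y.
Qed.

Lemma not_closureP (A : set rV) (x : rV) : ~ closure A x -> exists2 r : R, 0 < r & forall y, `|x - y| < r -> ~ A y.
Proof.
move=> nA; have oA : open (~` closure A) by exact: closed_openC (@closed_closure _ A).
have [r r0 rA] := open_ballP oA nA; exists r => // y yr Ay.
by apply: (rA y yr); exact: subset_closure.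
Qed.

Lemma open_center_ball (x0 : rV) (r : R) : open [set x | `|x0 - x| < r].
Proof.
apply: (@open_comp _ _ (fun x : rV => `|x0 - x|) [set t : R | t < r]); last exact: open_lt.
move=> x _; apply/continuous_epsP => e e0; exists e => // y xy.
apply: le_lt_trans (ler_dist_dist _ _) _.
by rewrite opprB addrC addrA subrK distrC.
Qed.

End SetsOfRn.

Section Truncation.
Variables (R : realType) (N : nat).
Local Notation rV := 'rV[R]_N.
Implicit Types (U K W : set rV) (f g : rV -> R) (x : rV).

Lemma flat_compl (s : R) : 0 < s -> [/\ 0 <= 1 - flat s, 1 - flat s <= 1 & (1 - flat s) * s <= 1].
Proof.
move=> s0; rewrite /flat /flat_term s0 expr0 mul1r; have si : 0 < s^-1 by rewrite invr_gt0.
split; first by rewrite subr_ge0 -expR0 ler_expR oppr_le0 ltW.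
  by rewrite gerBl expR_ge0.
have h : 1 - expR (- s^-1) <= s^-1 by have := expR_ge1Dx (- s^-1); lra.
by have := ler_wpM2r (ltW s0) h; rewrite mulVf ?gt_eqF.
Qed.

(** The multiplier of t vanishes for |t| <= e and tends to 1 so fast that the
    error stays of the order of e for all t. *)
Lemma flat_truncation (e t : R) : 0 < e -> `|t - t * flat (t ^+ 2 / e ^+ 2 - 1)| <= 2 * e.
Proof.
move=> e0; pose a := `|t| / e; have a0 : 0 <= a by rewrite divr_ge0 // ltW.
have ta : `|t| = a * e by rewrite /a divfK // gt_eqF.
have -> : t ^+ 2 / e ^+ 2 - 1 = a ^+ 2 - 1.
  by rewrite /a expr_div_n real_normK ?num_real.
have -> : t - t * flat (a ^+ 2 - 1) = t * (1 - flat (a ^+ 2 - 1)) by ring.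
rewrite normrM ta mulrAC ler_pM2r //; clear ta; clearbody a.
have [s0|s0] := leP (a ^+ 2 - 1) 0.
  by rewrite flat_eq0 // subr0 normr1 mulr1; nra.
have [p0 p1 ps] := flat_compl s0; rewrite (ger0_norm p0).
move: (1 - flat _) p0 p1 ps => p p0 p1 ps.
have [a2|a2] := leP 2 a.
  have : p * a <= p * (a ^+ 2 - 1) by rewrite ler_wpM2l //; nra.
  by lra.
by apply: le_trans (ltW a2); rewrite ler_piMr.
Qed.

Definition truncate (e : R) f x : R := f x * flat (f x ^+ 2 / e ^+ 2 - 1).

Lemma truncate_near e f x : 0 < e -> `|f x - truncate e f x| <= 2 * e.
Proof. exact: flat_truncation. Qed.

(** The support lies in the closed set where |f| >= e, which misses x0. *)
Lemma test_truncate U (e : R) f x0 : 0 < e -> test_function U f -> f x0 = 0 ->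
  test_function (U `&` [set x | x != x0]) (truncate e f).
Proof.
move=> e0 tf fx0; have oT : open (setT : set rV) by exact: openT.
have [K [cK KU [sf fK]]] := tf.
have sf2 : smooth setT (fun x => f x ^+ 2).
  by apply: (smooth_eq oT _ (smoothM oT sf sf)) => y _; rewrite expr2.
have e20 : 0 < e ^+ 2 by rewrite exprn_gt0.
exists (K `&` [set x | e ^+ 2 <= f x ^+ 2]); split.
- apply: compact_closedI => //.
  apply: (@closed_comp _ _ (fun x => f x ^+ 2) [set t | e ^+ 2 <= t]); last exact: closed_ge.
  by move=> x _; exact: (smooth_continuous sf2).
- move=> x [Kx fx]; split; first exact: KU.
  by apply/eqP => xx; move: fx; rewrite /= xx fx0 expr0n /= leNgt e20.
- split.
    apply: (smoothM oT sf).
    apply: (@smooth_comp R N setT setT (@flat R) (fun x => f x ^+ 2 / e ^+ 2 - 1) oT) => // [k|].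
      exact: C1k_flat.
    apply: (smoothB oT _ (smooth_cst _ _)).
    exact: (smoothM oT sf2 (smooth_cst _ _)).
  move=> x nx; rewrite /truncate.
  have [Kx|/fK->] := pselect (K x); last by rewrite mul0r.
  rewrite flat_eq0 ?mulr0 // subr_le0 ler_pdivrMr // mul1r leNgt; apply/negP => h.
  by apply: nx; split=> //=; exact: ltW.
Qed.

(** A test function that vanishes at x0 is, by truncation, a uniform limit of
    test functions supported away from x0; a functional of order zero that
    vanishes on the latter is thus a multiple of the evaluation at x0. *)
Lemma functional_at_point U (T : functional R N) (C : R) x0 : linear_on U T -> 0 <= C ->
  (forall f (m : R), test_function U f -> (forall x, `|f x| <= m) -> `|T f| <= C * m) ->
  (forall f, test_function (U `&` [set x | x != x0]) f -> T f = 0) ->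
  forall f, test_function U f -> f x0 = 0 -> T f = 0.
Proof.
move=> Tlin C0 Tb T0 f tf fx0; apply/eqP; rewrite -normr_le0.
apply/ler_addgt0Pl => d d0; rewrite addr0.
pose e := d / (2 * (C + 1)).
have C1 : 0 < C + 1 by rewrite ltr_wpDl.
have e0 : 0 < e by rewrite divr_gt0 // mulr_gt0.
have tt := test_truncate e0 tf fx0.
have ttU : test_function U (truncate e f) by apply: test_subset tt; exact: subIsetl.
have -> : T f = T (fun x => f x - truncate e f x).
  by rewrite (linear_onB Tlin tf ttU) (T0 _ tt) subr0.
have td : test_function U (fun x => f x - truncate e f x).
  have := testDZ (-1) ttU tf; congr test_function; apply/funext => x; ring.
apply: le_trans (Tb _ _ td (fun x => truncate_near f x e0)) _.
have -> : d = (C + 1) * (2 * e) by rewrite /e; field; rewrite gt_eqF.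
by apply: ler_wpM2r; [rewrite mulr_ge0 // ltW|rewrite lerDl].
Qed.

End Truncation.

(** * Smoothed positive parts and logarithmic cutoffs *)

Section SmoothPositivePart.
Variables (R : realType) (e : R).
Hypothesis e_gt0 : 0 < e.
Implicit Type t : R.

Definition hypot t : R := Num.sqrt (t ^+ 2 + e ^+ 2).

(** Smooth convex approximation of the positive part, with error at most e. *)
Definition softpos t : R := (t + hypot t - e) / 2.
Definition softpos1 t : R := (1 + t / hypot t) / 2.
Definition softpos2 t : R := e ^+ 2 / (2 * hypot t ^+ 3).

Lemma hypot_arg_gt0 t : 0 < t ^+ 2 + e ^+ 2.
Proof. by rewrite ltr_wpDl ?sqr_ge0 // exprn_gt0. Qed.

Lemma hypot_gt0 t : 0 < hypot t.
Proof. by rewrite sqrtr_gt0 hypot_arg_gt0. Qed.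

Lemma hypot_sqr t : hypot t ^+ 2 = t ^+ 2 + e ^+ 2.
Proof. by rewrite sqr_sqrtr // ltW // hypot_arg_gt0. Qed.

Lemma hypot_ge t : e <= hypot t /\ `|t| <= hypot t.
Proof.
have h0 := ltW (hypot_gt0 t); have h2 := hypot_sqr t.
split.
  by rewrite -(ler_pXn2r (n := 2)) ?nnegrE ?(ltW e_gt0) // h2 lerDr sqr_ge0.
by rewrite -(ler_pXn2r (n := 2)) ?nnegrE // h2 real_normK ?num_real // lerDl sqr_ge0.
Qed.

Lemma softpos0 : softpos 0 = 0.
Proof. by rewrite /softpos /hypot expr0n /= !add0r sqrtr_sqr gtr0_norm // subrr mul0r. Qed.

Lemma softpos_ge t : t - e <= softpos t /\ - e <= softpos t.
Proof.
have [h1 h2] := hypot_ge t; rewrite /softpos; move: h2; rewrite ler_norml => /andP[h2 h3].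
by have e0 := e_gt0; split; lra.
Qed.

Lemma softpos1_bounds t : 0 <= softpos1 t <= 1.
Proof.
have h0 := hypot_gt0 t; have [_ h2] := hypot_ge t.
have : `|t / hypot t| <= 1 by rewrite normrM normfV (gtr0_norm h0) ler_pdivrMr // mul1r.
by rewrite ler_norml /softpos1 => /andP[h3 h4]; apply/andP; split; lra.
Qed.

Lemma softpos2_ge0 t : 0 <= softpos2 t.
Proof. by rewrite divr_ge0 ?sqr_ge0 // mulr_ge0 // exprn_ge0 // ltW // hypot_gt0. Qed.

Lemma softpos_convex t : softpos t <= t * softpos1 t.
Proof.
have h0 := hypot_gt0 t; have [h1 _] := hypot_ge t; have h2 := hypot_sqr t.
have -> : t * softpos1 t = softpos t + e * (1 - e / hypot t) / 2.
  have -> : t * softpos1 t = (t + t ^+ 2 / hypot t) / 2 by rewrite /softpos1; field; lra.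
  have -> : t ^+ 2 = hypot t ^+ 2 - e ^+ 2 by rewrite h2 addrK.
  by rewrite /softpos; field; lra.
by rewrite lerDl divr_ge0 // mulr_ge0 ?(ltW e_gt0) // subr_ge0 ler_pdivrMr // mul1r.
Qed.

Lemma is_derive_hypot t : is_derive t 1 hypot (t / hypot t).
Proof.
have d0 : is_derive t 1 (fun s : R => s ^+ 2 + e ^+ 2) (2 * t).
  have d1 := is_deriveD (is_deriveM (is_derive_id t (1 : R)) (is_derive_id t 1))
     (is_derive_cst (e ^+ 2) t (1 : R)).
  have -> : (fun s : R => s ^+ 2 + e ^+ 2) = (id * id + cst (e ^+ 2))%R.
    by apply/funext => s; rewrite expr2.
  by apply: is_derive_eq d1 _; rewrite /GRing.scale /=; ring.
have d2 := is_derive1_sqrt (hypot_arg_gt0 t).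
have d3 : is_derive t 1 hypot ((2 * hypot t)^-1 * (2 * t))
  := is_derive1_comp (g := fun s : R => s ^+ 2 + e ^+ 2) d2 d0.
apply: is_derive_eq d3 _.
by have h0 := hypot_gt0 t; field; lra.
Qed.

Lemma is_derive_softpos t : is_derive t 1 softpos (softpos1 t).
Proof.
have d := is_deriveZ (2^-1 : R) (is_deriveB (is_deriveD (is_derive_id t (1 : R))
   (is_derive_hypot t)) (is_derive_cst e t (1 : R))).
have -> : softpos = 2^-1 *: ((id + hypot) - cst e)%R.
  by apply/funext => s; rewrite /softpos mulrC.
by apply: is_derive_eq d _; rewrite /GRing.scale /= /softpos1 subr0 mulrC.
Qed.

Lemma is_derive_softpos1 t : is_derive t 1 softpos1 (softpos2 t).
Proof.
have h0 := hypot_gt0 t; have h00 : hypot t != 0 by rewrite gt_eqF.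
have d1 := is_deriveM (is_derive_id t (1 : R)) (is_deriveV (f := hypot) h00 (is_derive_hypot t)).
have d := is_deriveZ (2^-1 : R) (is_deriveD (is_derive_cst (1 : R) t (1 : R)) d1).
have -> : softpos1 = 2^-1 *: (cst 1 + id * (fun s => (hypot s)^-1))%R.
  by apply/funext => s; rewrite /softpos1 mulrC.
apply: is_derive_eq d _; rewrite /GRing.scale /= /softpos2.
have -> : e ^+ 2 = hypot t ^+ 2 - t ^+ 2 by rewrite hypot_sqr addrC addKr.
by field; lra.
Qed.

Lemma continuous_softpos2 t : {for t, continuous softpos2}.
Proof.
have h0 := hypot_gt0 t; have ch := is_derive_continuous (is_derive_hypot t).
apply: cvgM; first exact: cvg_cst.
apply: cvgV; first by rewrite gt_eqF // mulr_gt0 // exprn_gt0.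
apply: cvgM; first exact: cvg_cst.
have -> : (fun s => hypot s ^+ 3) = (fun s => hypot s * (hypot s * hypot s)).
  by apply/funext => s; rewrite !exprS expr0 mulr1.
rewrite (_ : hypot t ^+ 3 = hypot t * (hypot t * hypot t)) ?exprS ?expr0 ?mulr1 //.
by apply: cvgM => //; apply: cvgM.
Qed.

End SmoothPositivePart.

Section LogCutoff.
Variables (R : realType) (d : R).
Hypothesis d_gt0 : 0 < d.
Implicit Type t : R.

(** As d tends to 0 this tends to the indicator of (0, +oo), and its concavity
    is so strong that logcut2 = - logcut1 ^ 2 / d. *)
Definition logcut t : R := d * ln (1 + t * expR d^-1).
Definition logcut1 t : R := d * (expR d^-1 / (1 + t * expR d^-1)).
Definition logcut2 t : R := - (d^-1 * logcut1 t ^+ 2).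
Definition logdom : set R := [set t | 0 < 1 + t * expR d^-1].

Lemma logdom_ge0 t : 0 <= t -> logdom t.
Proof. by move=> t0; rewrite /logdom /= ltr_wpDr // mulr_ge0 // expR_ge0. Qed.

Lemma is_derive_affine t : is_derive t 1 (fun s : R => 1 + s * expR d^-1) (expR d^-1).
Proof.
have := is_deriveD (is_derive_cst (1 : R) t (1 : R)) (is_deriveZ (expR d^-1) (is_derive_id t (1 : R))).
have -> : cst 1 + expR d^-1 *: id = (fun s : R => 1 + s * expR d^-1).
  by apply/funext => s; rewrite mulrC.
by move=> h; apply: is_derive_eq h _; rewrite /GRing.scale /= add0r mulr1.
Qed.

Lemma open_logdom : open logdom.
Proof.
apply: (@open_comp _ _ (fun s : R => 1 + s * expR d^-1) [set t : R | 0 < t]); last exact: open_gt.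
by move=> t _; exact: is_derive_continuous (is_derive_affine t).
Qed.

Lemma is_derive_logcut t : logdom t -> is_derive t 1 logcut (logcut1 t).
Proof.
move=> t0; have h1 := is_derive1_comp (g := fun s : R => 1 + s * expR d^-1)
  (is_derive1_ln t0) (is_derive_affine t).
apply: is_derive_eq (is_deriveZ d h1) _.
by rewrite /logcut1 /GRing.scale /= [_^-1 * _]mulrC.
Qed.

Lemma is_derive_logcut1 t : logdom t -> is_derive t 1 logcut1 (logcut2 t).
Proof.
move=> t0; have t00 : 1 + t * expR d^-1 != 0 by rewrite gt_eqF.
have h1 := is_deriveV (f := fun s : R => 1 + s * expR d^-1) t00 (is_derive_affine t).
have := is_deriveZ d (is_deriveZ (expR d^-1) h1).
move=> h; apply: is_derive_eq h _; rewrite /logcut2 /logcut1 /GRing.scale /=.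
by field; rewrite t00 gt_eqF.
Qed.

Lemma continuous_logcut2 t : logdom t -> {for t, continuous logcut2}.
Proof.
move=> t0; have c1 := is_derive_continuous (is_derive_logcut1 t0).
have -> : logcut2 = fun s => - d^-1 * (logcut1 s * logcut1 s).
  by apply/funext => s; rewrite /logcut2 expr2 mulNr.
by apply: cvgM; [exact: cvg_cst|exact: cvgM].
Qed.

Lemma logcut0 : logcut 0 = 0.
Proof. by rewrite /logcut mul0r addr0 ln1 mulr0. Qed.

Lemma logcut_ge0 t : 0 <= t -> 0 <= logcut t.
Proof.
by move=> t0; rewrite mulr_ge0 ?(ltW d_gt0) // ln_ge0 // lerDl mulr_ge0 // expR_ge0.
Qed.

Lemma logcut_le t B : 0 <= t <= B -> logcut t <= 1 + d * ln (1 + B).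
Proof.
move=> /andP[t0 tB]; have E0 := expR_gt0 d^-1; have E1 : 1 <= expR d^-1.
  by apply: le_trans (expR_ge1Dx _); rewrite lerDl invr_ge0 ltW.
have B0 : 0 <= B by exact: le_trans tB.
have -> : 1 + d * ln (1 + B) = d * ln ((1 + B) * expR d^-1).
  rewrite lnM ?posrE //; last by rewrite ltr_wpDr.
  by rewrite expRK mulrDr mulfV ?gt_eqF // addrC.
rewrite ler_pM2l // ler_ln ?posrE; last 2 first.
- by rewrite ltr_wpDr // mulr_ge0 // ltW.
- by rewrite mulr_gt0 // ltr_wpDr.
by rewrite mulrDl mul1r lerD // ler_pM2r.
Qed.

Lemma logcut_ge t m : 0 < m <= t -> 1 + d * ln m <= logcut t.
Proof.
move=> /andP[m0 mt]; have E0 := expR_gt0 d^-1.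
have -> : 1 + d * ln m = d * ln (m * expR d^-1).
  by rewrite lnM ?posrE // expRK mulrDr mulfV ?gt_eqF // addrC.
have t0 : 0 < t by exact: lt_le_trans mt.
rewrite ler_pM2l // ler_ln ?posrE; last 2 first.
- by rewrite mulr_gt0.
- by rewrite ltr_wpDr // mulr_ge0 // ltW.
by rewrite -[leLHS]add0r lerD // ler_pM2r.
Qed.

End LogCutoff.

(** * Second-order conditions at a minimum *)

Section SecondOrderTest.
Variables (R : realType) (N : nat).
Local Notation rV := 'rV[R]_N.
Implicit Types (U : set rV) (f : rV -> R) (i j : 'I_N) (x y z w : rV).

Lemma derivable_scale (a : R) f i x : derivable f x (delta_mx ord0 i) ->
  derivable (fun y => a * f y) x (delta_mx ord0 i).
Proof. exact: derivableZ. Qed.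

Lemma partialZ (a : R) f i x : derivable f x (delta_mx ord0 i) ->
  partial i (fun y => a * f y) x = a * partial i f x.
Proof.
move=> df; have da : derivable (fun _ : rV => a) x (delta_mx ord0 i) by exact: derivable_cst.
by rewrite partialM // partial_cst mul0r add0r.
Qed.

Let wsum w (s : seq 'I_N) : rV := \sum_(i <- s) w ord0 i *: delta_mx ord0 i.

Lemma norm_delta_le i : `|delta_mx ord0 i : rV| <= 1.
Proof.
apply: rV_norm_le => // j; rewrite mxE eqxx /=.
by case: eqP => _; rewrite ?normr1 ?normr0.
Qed.

(** Telescoping over the coordinates, uniformly in the base point y so that the
    increments of the earlier coordinates can be absorbed in it. *)
Lemma C1_expansion U f z w (s : seq 'I_N) : open U -> Ck 1 U f -> U z ->
  forall e : R, 0 < e -> exists2 d : R, 0 < d & forall (t : R) y, `|t| < d -> `|z - y| < d ->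
    `|f (t *: wsum w s + y) - f y - t * \sum_(i <- s) w ord0 i * partial i f z| <= e * `|t|.
Proof.
move=> oU Cf Uz; elim: s => [|i s IH] e e0.
  exists 1 => // t y _ _.
  by rewrite /wsum !big_nil scaler0 add0r subrr mulr0 subr0 normr0 mulr_ge0 // ltW.
have e20 : 0 < e / 2 by rewrite divr_gt0.
have [d1 d10 IH1] := IH _ e20.
have /nbhs_normP[d2 /= d20 Ud] := open_nbhs_nbhs (conj oU Uz).
pose c := `|w ord0 i| + 1; have c0 : 0 < c by rewrite ltr_wpDl.
have cf : {for z, continuous (partial i f)} := Ck_continuous (Ck_partial i Cf) Uz.
have /continuous_epsP/(_ (e / 2 / c))[|d3 d30 Hd3] := cf; first by rewrite divr_gt0.
pose d := Num.min d1 (Num.min d2 d3) / (c + 1).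
have m0 : 0 < Num.min d1 (Num.min d2 d3) by rewrite !lt_min d10 d20.
have c10 : 0 < c + 1 by rewrite addr_gt0.
have d0 : 0 < d by rewrite divr_gt0.
have dc : d * (c + 1) = Num.min d1 (Num.min d2 d3) by rewrite /d divfK ?gt_eqF.
exists d => // t y td zy.
pose a := t * w ord0 i.
have ac : `|a| <= d * c.
  by rewrite /a normrM ler_pM // ?ltW // /c; lra.
have near (h : R) : `|h| <= `|a| -> `|z - (h *: delta_mx ord0 i + y)| < Num.min d1 (Num.min d2 d3).
  move=> ha; rewrite opprD addrCA (le_lt_trans (ler_normD _ _)) // normrN normrZ.
  rewrite -dc mulrDr mulr1 ler_ltD //; apply: le_trans ac.
  apply: le_trans ha; rewrite -[leRHS]mulr1 ler_wpM2l //; exact: norm_delta_le.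
have Uy (h : R) : `|h| <= `|a| -> U (h *: delta_mx ord0 i + y).
  by move=> /near; rewrite !lt_min => /and3P[_ zd _]; exact: Ud.
have dline (h : R) : `|0 - h| <= `|0 - a| ->
    is_derive h 1 (fun h : R => f (h *: delta_mx ord0 i + y)) (partial i f (h *: delta_mx ord0 i + y)).
  rewrite !sub0r !normrN => /Uy Uh; apply: is_derive_line.
  exact: (Ck_derivable (i := i) Cf Uh).
have [b ba e1] := MVT_dist dline; move: ba; rewrite !sub0r !normrN => ba.
have step1 : `|f (a *: delta_mx ord0 i + y) - f y - a * partial i f z| <= e / 2 * `|t|.
  have -> : f (a *: delta_mx ord0 i + y) - f y = partial i f (b *: delta_mx ord0 i + y) * a.
    by move: e1; rewrite subr0 scale0r add0r.
  rewrite mulrC -mulrBr normrM distrC.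
  apply: (@le_trans _ _ (`|a| * (e / 2 / c))).
    rewrite ler_wpM2l // ltW //; apply: Hd3.
    by have := near _ ba; rewrite !lt_min => /and3P[].
  have -> : `|a| * (e / 2 / c) = e / 2 * `|t| * (`|w ord0 i| / c) by rewrite /a normrM; ring.
  apply: ler_piMr; first by rewrite mulr_ge0 // ltW.
  by rewrite ler_pdivrMr // mul1r /c; lra.
have step2 := IH1 t (a *: delta_mx ord0 i + y).
have td1 : `|t| < d1.
  apply: lt_le_trans td _; apply: (@le_trans _ _ (d * (c + 1))); last by rewrite dc ge_min lexx.
  by rewrite ler_pMr // lerDr ltW.
have zy1 : `|z - (a *: delta_mx ord0 i + y)| < d1.
  by have := near a (lexx _); rewrite lt_min => /andP[].
have {}step2 := step2 td1 zy1.
rewrite /wsum !big_cons -!/(wsum w s).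
have -> : t *: (w ord0 i *: delta_mx ord0 i + wsum w s) + y =
    t *: wsum w s + (a *: delta_mx ord0 i + y).
  by rewrite scalerDr scalerA -/a [_ + t *: _]addrC -addrA.
set F1 := f (_ + (_ + y)); pose F2 := f (a *: delta_mx ord0 i + y).
have -> : F1 - f y - t * (w ord0 i * partial i f z + \sum_(j <- s) w ord0 j * partial j f z) =
  (F1 - F2 - t * \sum_(j <- s) w ord0 j * partial j f z) + (F2 - f y - a * partial i f z).
  by rewrite /a; ring.
apply: le_trans (ler_normD _ _) _; apply: le_trans (lerD step2 step1) _.
by rewrite -mulrDl -splitr.
Qed.

Lemma is_derive_direction U f z w : open U -> Ck 1 U f -> U z ->
  is_derive z w f (\sum_i w ord0 i * partial i f z).
Proof.
move=> oU Cf Uz; have ew : w = wsum w (index_enum 'I_N).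
  by rewrite /wsum [LHS]row_sum_delta.
have cv : (fun h : R => h^-1 *: ((f \o shift z) (h *: w) - f z)) @ 0^' -->
    (\sum_i w ord0 i * partial i f z).
  apply/cvgrPdist_le => e e0.
  have [d d0 Hd] := C1_expansion w (index_enum 'I_N) oU Cf Uz e0.
  exists d => // h /=; rewrite sub0r normrN => hd h0.
  have := Hd h z hd; rewrite subrr normr0 => /(_ d0); rewrite -ew => H.
  rewrite distrC -(ler_pM2r (x := `|h|)) ?normr_gt0 // -normrM.
  by apply: le_trans H; rewrite /GRing.scale /= mulrBl mulrC mulVKf // mulrC.
apply: DeriveDef; first by apply/cvg_ex; eexists; exact: cv.
exact: cvg_lim cv.
Qed.

Lemma min_second_derivative (g g1 : R -> R) (g2 d : R) : 0 < d ->
  (forall t : R, `|t| < d -> is_derive t 1 g (g1 t)) -> is_derive (0 : R) 1 g1 g2 ->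
  (forall t : R, `|t| < d -> g 0 <= g t) -> g1 0 = 0 /\ 0 <= g2.
Proof.
move=> d0 dg dg1 gmin; have z0 : `|0 : R| < d by rewrite normr0.
have g10 : g1 0 = 0.
  have H : is_derive (0 : R) 1 g 0.
    apply: (@derive1_at_min _ g (- d) d) => //.
    - by lra.
    - by move=> t; rewrite in_itv /= -ltr_norml => /dg[].
    - by rewrite in_itv /=; lra.
    - by move=> t; rewrite in_itv /= -ltr_norml; exact: gmin.
  by have [_ e0] := dg _ z0; rewrite -e0; have [_ ->] := H.
split=> //; rewrite leNgt; apply/negP => g20.
have [cv1 cv2] := dg1.
have : (fun h : R => h^-1 *: ((g1 \o shift 0) (h *: 1) - g1 0)) @ 0^' --> g2.
  by rewrite -cv2; exact: cv1.
move=> /cvgrPdist_lt/(_ (- g2)); rewrite oppr_gt0 => /(_ g20)[e /= e0 He].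
pose t := Num.min (d / 2) (e / 2).
have t0 : 0 < t by rewrite lt_min !divr_gt0.
have td : t < d by rewrite gt_min; apply/orP; left; lra.
have te : t < e by rewrite gt_min; apply/orP; right; lra.
have dgt (s : R) : s \in `]0, t[ -> is_derive s 1 g (g1 s).
  by rewrite in_itv /= => /andP[s0 st]; apply: dg; rewrite gtr0_norm; lra.
have cg : {within `[0, t], continuous g}.
  apply: derivable_within_continuous => s; rewrite in_itv /= => /andP[s0 st].
  by have [] : is_derive s 1 g (g1 s) by apply: dg; rewrite ger0_norm; lra.
have [c] := MVT t0 dgt cg; rewrite in_itv /= => /andP[c0 ct] ec.
have : 0 <= g t - g 0 by rewrite subr_ge0; apply: gmin; rewrite gtr0_norm.
rewrite ec subr0 pmulr_lge0 //; apply/negP; rewrite -ltNge.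
have := He c; rewrite /ball_ /= sub0r normrN gtr0_norm // => /(_ (lt_trans ct te)).
rewrite gt_eqF // => /(_ isT); rewrite g10 subr0 addr0 [_%:A]mulr1.
rewrite ltr_norml => /andP[H _].
have : c^-1 * g1 c < 0 by move: H; rewrite /GRing.scale /=; lra.
by rewrite pmulr_rlt0 // invr_gt0.
Qed.

Lemma local_min_test U f z : open U -> Ck 2 U f -> U z ->
  (forall x, U x -> f z <= f x) ->
  (forall i, partial i f z = 0) /\
  (forall w, 0 <= \sum_i \sum_j w ord0 i * w ord0 j * partial i (partial j f) z).
Proof.
move=> oU Cf Uz fmin.
have H w : \sum_i w ord0 i * partial i f z = 0 /\
    0 <= \sum_i \sum_j w ord0 i * w ord0 j * partial i (partial j f) z.
  have /nbhs_normP[d /= d0 Ud] := open_nbhs_nbhs (conj oU Uz).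
  pose e := d / (`|w| + 1).
  have w0 : 0 < `|w| + 1 by rewrite ltr_wpDl.
  have e0 : 0 < e by rewrite divr_gt0.
  have Ut (t : R) : `|t| < e -> U (t *: w + z).
    move=> te; apply: Ud; rewrite /= opprD addrCA subrr addr0 normrN normrZ.
    apply: (@le_lt_trans _ _ (`|t| * (`|w| + 1))); first by rewrite ler_wpM2l // lerDl.
    by rewrite -ltr_pdivlMr.
  pose D x := \sum_i w ord0 i * partial i f x.
  have CD : Ck 1 U D.
    by apply: Ck_sum => // i; apply: CkZ => //; exact: Ck_partial.
  have dg (t : R) : `|t| < e -> is_derive t 1 (fun h : R => f (h *: w + z)) (D (t *: w + z)).
    move=> /Ut Uw; have [df e1] := is_derive_direction w oU (Ck_pred Cf) Uw.
    by rewrite /D -e1; exact: is_derive_line.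
  have dg1 : is_derive (0 : R) 1 (fun t : R => D (t *: w + z)) (\sum_i w ord0 i * partial i D z).
    have [dD e1] := is_derive_direction w oU CD Uz; rewrite -e1.
    by have := @is_derive_line _ _ D z w 0; rewrite scale0r add0r; apply.
  have [|h1 h2] := min_second_derivative e0 dg dg1.
    by move=> t /Ut Uw; rewrite scale0r add0r; exact: fmin.
  split; first by move: h1; rewrite scale0r add0r.
  apply: le_trans h2 _; rewrite le_eqVlt; apply/orP; left; apply/eqP.
  apply: eq_bigr => i _; rewrite /D partial_sum => [|j].
    rewrite mulr_sumr; apply: eq_bigr => j _.
    by rewrite partialZ ?mulrA //; exact: (Ck_derivable (i := i) (Ck_partial j Cf) Uz).
  by apply: Ck_derivable Uz; apply: CkZ => //; exact: Ck_partial Cf.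
split=> [i|w]; last by have [] := H w.
have [+ _] := H (delta_mx ord0 i); rewrite (bigD1 i) //= mxE !eqxx mul1r.
rewrite big1 ?addr0 // => j ji.
by rewrite mxE (negbTE ji) andbF mul0r.
Qed.

End SecondOrderTest.

(** * Connectedness of punctured balls *)

Section Connectedness.
Variables (R : realType) (N : nat).
Local Notation rV := 'rV[R]_N.
Implicit Types (A : set rV) (x y z : rV).

Definition segment x y : set rV := [set x + t *: (y - x) | t in `[0, 1 : R]].

Lemma segment_left x y : segment x y x.
Proof. by exists 0; rewrite ?scale0r ?addr0 //= in_itv /= lexx ler01. Qed.

Lemma segment_right x y : segment x y y.
Proof. by exists 1; rewrite ?scale1r ?subrKC //= in_itv /= lexx ler01. Qed.

Lemma connected_segment x y : connected (segment x y).
Proof.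
apply: connected_continuous_connected; first exact: segment_connected.
apply: continuous_subspaceT => t.
apply: cvgD; first exact: cvg_cst.
by apply: cvgZr_tmp; exact: cvg_id.
Qed.

Lemma segment_ball x0 x y (r : R) : `|x0 - x| < r -> `|x0 - y| < r ->
  segment x y `<=` [set z | `|x0 - z| < r].
Proof.
move=> xr yr z [t]; rewrite /= in_itv /= => /andP[t0 t1] <-.
have -> : x0 - (x + t *: (y - x)) = (1 - t) *: (x0 - x) + t *: (x0 - y).
  by apply/rowP => k; rewrite !mxE; ring.
apply: le_lt_trans (ler_normD _ _) _; rewrite !normrZ (ger0_norm t0).
rewrite ger0_norm ?subr_ge0 //.
have [->|tn] := eqVneq t 0; first by rewrite subr0 mul1r mul0r addr0.
have tp : 0 < t by rewrite lt_neqAle eq_sym tn.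
have : t * `|x0 - y| < t * r by rewrite ltr_pM2l.
have : (1 - t) * `|x0 - x| <= (1 - t) * r by rewrite ler_wpM2l ?subr_ge0 // ltW.
lra.
Qed.

(** The coordinate k takes the value of x0 only at the end point x. *)
Lemma segment_avoid x0 x y k : x != x0 -> x ord0 k = x0 ord0 k -> y ord0 k != x0 ord0 k ->
  segment x y `<=` [set z | z != x0].
Proof.
move=> xx0 xk yk _ [t _ <-]; apply/eqP => e; have /rowP/(_ k) := e.
rewrite !mxE xk => /eqP; rewrite -subr_eq0 addrAC subrr add0r mulf_eq0 subr_eq0 (negbTE yk) orbF.
by move=> /eqP t0; move: e; rewrite t0 scale0r addr0; apply/eqP.
Qed.

Lemma connected_from A x : A x ->
  (forall y, A y -> exists C, [/\ connected C, C x, C y & C `<=` A]) -> connected A.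
Proof.
move=> Ax H.
have -> : A = \bigcup_(C in [set C | [/\ connected C, C x & C `<=` A]]) C.
  apply/seteqP; split=> y; last by move=> [C [_ _ CA] /CA].
  by move=> /H[C [cC Cx Cy CA]]; exists C.
by apply: bigcup_connected; [exists x => C []|move=> C []].
Qed.

(** A point off the i-th axis through the centre is joined to that axis by a
    segment; a point on it is reached by a detour through the j-th axis. *)
Lemma connected_punctured_ball x0 (r : R) (i j : 'I_N) : i != j -> 0 < r ->
  connected ([set x | `|x0 - x| < r] `&` [set x | x != x0]).
Proof.
move=> ij r0; pose pt k : rV := x0 + (r / 2) *: delta_mx ord0 k.
have r20 : 0 < r / 2 by rewrite divr_gt0.
have ptE k l : pt k ord0 l = x0 ord0 l + r / 2 * (l == k)%:R by rewrite !mxE eqxx /=.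
have ptk k : pt k ord0 k != x0 ord0 k.
  by rewrite ptE eqxx mulr1 -subr_eq0 addrAC subrr add0r gt_eqF.
have ptl k l : l != k -> pt k ord0 l = x0 ord0 l.
  by move=> lk; rewrite ptE (negbTE lk) mulr0 addr0.
have ptn k : pt k != x0 by apply: contra (ptk k) => /eqP <-.
have ptB k : `|x0 - pt k| < r.
  have -> : x0 - pt k = - ((r / 2) *: delta_mx ord0 k) by rewrite /pt opprD addNKr.
  rewrite normrN normrZ (gtr0_norm r20).
  apply: (@le_lt_trans _ _ (r / 2 * 1)); last by rewrite mulr1 ltr_pdivrMr // ltr_pMr // ltr1n.
  by rewrite ler_pM2l // norm_delta_le.
apply: (@connected_from _ (pt i)); first by split; [exact: ptB|exact: ptn].
move=> x [xB xn].
have [[k ki xk]|nk] := pselect (exists2 k, k != i & x ord0 k != x0 ord0 k).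
  exists (segment (pt i) x); split; [exact: connected_segment|exact: segment_left
    |exact: segment_right|].
  move=> z xz; split; first exact: segment_ball (ptB i) xB _ xz.
  exact: segment_avoid (ptn i) (ptl _ _ ki) xk _ xz.
have xi : x ord0 i != x0 ord0 i.
  apply: contra xn => /eqP xi; apply/eqP/rowP => k.
  have [->//|ki] := eqVneq k i; apply/eqP; apply: contrapT => /negP xk.
  by apply: nk; exists k.
exists (segment (pt i) (pt j) `|` segment (pt j) x); split.
- apply: connectedU; [|exact: connected_segment|exact: connected_segment].
  by exists (pt j); split; [exact: segment_right|exact: segment_left].
- by left; exact: segment_left.
- by right; exact: segment_right.
- move=> z [] hz; split.
  + exact: segment_ball (ptB i) (ptB j) _ hz.
  + by apply: segment_avoid (ptn i) (ptl _ _ _) (ptk j) _ hz; rewrite eq_sym.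
  + exact: segment_ball (ptB j) xB _ hz.
  + exact: segment_avoid (ptn j) (ptl _ _ ij) xi _ hz.
Qed.

End Connectedness.

(** * One-variable estimates *)

Section ConcaveTransforms.
Variable R : realType.

Lemma is_derive_shift_inv m (t : R) : -1 < t ->
  is_derive t 1 (fun t : R => (1 + t)^-1 ^+ m) (- m%:R * (1 + t)^-1 ^+ m.+1).
Proof.
move=> t1; have tn : 1 + t != 0 by apply: lt0r_neq0; lra.
have d1 : is_derive t 1 (fun t : R => 1 + t) (0 + 1) by exact: is_deriveD.
have d2 := @is_derive_expV R m (1 + t) tn.
by apply: is_derive_eq (is_derive1_comp d2 d1) _; rewrite add0r mulr1.
Qed.

Lemma is_derive_flat_shift m (a t : R) :
  is_derive t 1 (fun t => flat_term m (t - a))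
    (- m%:R * flat_term m.+1 (t - a) + flat_term m.+2 (t - a)).
Proof.
have d1 : is_derive t 1 (fun t : R => t - a) (1 - 0) by exact: is_deriveB.
have d2 := @is_derive1_comp _ (flat_term m) (fun t : R => t - a) _ _ _
  (@is_derive_flat_term R m (t - a)) d1.
by apply: is_derive_eq d2 _; rewrite subr0 mulr1.
Qed.

End ConcaveTransforms.

Section OneVariableEstimates.
Variable R : realType.

Lemma increment_le (f f1 : R -> R) (t B : R) : 0 <= t ->
  (forall s : R, 0 <= s <= t -> is_derive s 1 f (f1 s)) ->
  (forall s : R, 0 <= s <= t -> f1 s <= B) -> f t - f 0 <= B * t.
Proof.
rewrite le_eqVlt => /predU1P[<-|t0] df fB; first by rewrite subrr mulr0.
have dI s : s \in `]0, t[%R -> is_derive s 1 f (f1 s).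
  by rewrite in_itv /= => /andP[/ltW s0 /ltW st]; apply: df; rewrite s0.
have cI : {within `[0, t], continuous f}.
  apply: continuous_in_subspaceT => s; rewrite inE /= in_itv /= => /df.
  exact: is_derive_continuous.
have [s + ->] := MVT t0 dI cI; rewrite subr0 in_itv /= => /andP[/ltW s0 /ltW st].
by rewrite ler_pM2r // fB // s0.
Qed.

(** Integrating (a f')' <= k twice from 0, where f and a f' vanish. *)
Lemma second_order_bound (f f1 q q1 a : R -> R) (r al k : R) : 0 < al -> 0 <= k ->
  (forall s : R, 0 <= s <= r -> is_derive s 1 f (f1 s)) ->
  (forall s : R, 0 <= s <= r -> is_derive s 1 q (q1 s)) ->
  (forall s : R, 0 <= s <= r -> al <= a s /\ q s = a s * f1 s) ->
  (forall s : R, 0 <= s <= r -> q1 s <= k) -> f 0 = 0 -> q 0 = 0 ->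
  forall t, 0 <= t <= r -> f t <= k * r / al * r.
Proof.
move=> al0 k0 df dq qa q1k f0 q0 t /andP[t0 tr]; have r0 := le_trans t0 tr.
have sub s : 0 <= s <= t -> 0 <= s <= r by move=> /andP[-> /le_trans]; apply.
have B0 : 0 <= k * r / al by rewrite divr_ge0 ?mulr_ge0 // ltW.
have f1B s : 0 <= s <= r -> f1 s <= k * r / al.
  move=> sr; have [als qs] := qa s sr; have /andP[s0 s1] := sr.
  have subs s' : 0 <= s' <= s -> 0 <= s' <= r by move=> /andP[-> /le_trans]; apply.
  have : q s - q 0 <= k * s.
    by apply: (increment_le s0) => s' ss; [exact: (dq _ (subs _ ss))|exact: q1k _ (subs _ ss)].
  rewrite q0 subr0 qs => h.
  have [f1s|f1s] := leP (f1 s) 0; first exact: le_trans f1s B0.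
  rewrite ler_pdivlMr // mulrC; apply: (@le_trans _ _ (a s * f1 s)).
    by rewrite ler_pM2r.
  by apply: le_trans h _; rewrite ler_wpM2l.
have : f t - f 0 <= k * r / al * t.
  by apply: (increment_le t0) => s st; [exact: (df _ (sub _ st))|exact: f1B _ (sub _ st)].
by rewrite f0 subr0 => h; apply: le_trans h _; rewrite ler_wpM2l.
Qed.

End OneVariableEstimates.

(** * Positive semidefinite forms *)

Section PositiveForms.
Variables (R : realType) (N : nat).
Implicit Types (a H : 'I_N -> 'I_N -> R) (p q : 'I_N -> R) (i j k : 'I_N).

Definition bilin a p q : R := \sum_i \sum_j a i j * p i * q j.

Let unitv k : 'I_N -> R := fun i => (i == k)%:R.

Let sum_unitv k (F : 'I_N -> R) : \sum_i F i * unitv k i = F k.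
Proof.
rewrite (bigD1 k) //= /unitv eqxx mulr1 big1 ?addr0 // => i ik.
by rewrite (negbTE ik) mulr0.
Qed.

Let bilin_unitl a k q : bilin a (unitv k) q = \sum_j a k j * q j.
Proof.
rewrite /bilin exchange_big /=; apply: eq_bigr => j _.
rewrite -(sum_unitv k (fun i => a i j * q j)); apply: eq_bigr => i _; ring.
Qed.

Let bilin_shift a p k (s : R) : (forall i j, a i j = a j i) ->
  bilin a (fun i => p i + s * unitv k i) (fun i => p i + s * unitv k i) =
  bilin a p p + 2 * s * (\sum_j a k j * p j) + s ^+ 2 * a k k.
Proof.
move=> asym.
have e1 : bilin a p (unitv k) = \sum_j a k j * p j.
  rewrite -bilin_unitl /bilin exchange_big /=; apply: eq_bigr => i _.
  by apply: eq_bigr => j _; rewrite asym; ring.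
have e2 : bilin a (unitv k) (unitv k) = a k k by rewrite bilin_unitl sum_unitv.
have e3 := bilin_unitl a k p.
transitivity (bilin a p p + s * bilin a p (unitv k) + s * bilin a (unitv k) p
   + s ^+ 2 * bilin a (unitv k) (unitv k)); last by rewrite e1 e2 e3; ring.
rewrite /bilin !mulr_sumr -!big_split /=; apply: eq_bigr => i _.
by rewrite !mulr_sumr -!big_split /=; apply: eq_bigr => j _; ring.
Qed.

(** An affine function of s that is nonnegative for all s is constant. *)
Lemma psd_diag0 a k : (forall i j, a i j = a j i) -> (forall p, 0 <= bilin a p p) ->
  a k k = 0 -> forall j, a k j = 0.
Proof.
move=> asym apos ak j.
have H s : 0 <= a j j + 2 * s * a j k.
  have := apos (fun i => unitv j i + s * unitv k i).
  rewrite bilin_shift // ak mulr0 addr0 bilin_unitl !sum_unitv.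
  by rewrite (asym k j).
rewrite asym; apply/eqP/negPn/negP => ajk.
have := H (- (a j j + 1) / (2 * a j k)).
have -> : a j j + 2 * (- (a j j + 1) / (2 * a j k)) * a j k = -1.
  by field.
by rewrite ler0N1.
Qed.

(** The trace of a product of positive semidefinite forms is nonnegative:
    Gaussian elimination splits off one square of a linear form at a time. *)
Lemma psd_trace_ge0 a H : (forall i j, a i j = a j i) -> (forall p, 0 <= bilin a p p) ->
  (forall p, 0 <= \sum_i \sum_j p i * p j * H i j) ->
  0 <= \sum_i \sum_j a i j * H i j.
Proof.
move=> + + Hpos; have [m] := ubnP #|[pred k | a k k != 0]|.
elim: m a => // m IH a ltm asym apos.
have [k ak|a0] := pickP (fun k => a k k != 0); last first.
  rewrite big1 // => i _; rewrite big1 // => j _.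
  by rewrite psd_diag0 ?mul0r //; apply/eqP; have := a0 i; rewrite /= => /negbFE.
have diag_ge0 i : 0 <= a i i.
  by have := apos (unitv i); rewrite bilin_unitl sum_unitv.
have akk : 0 < a k k by rewrite lt_def ak diag_ge0.
pose a' i j := a i j - a k i * a k j / a k k.
have a'sym i j : a' i j = a' j i by rewrite /a' asym [_ * a k j]mulrC.
have bil' p : bilin a' p p = bilin a p p - (\sum_j a k j * p j) ^+ 2 / a k k.
  have -> : (\sum_j a k j * p j) ^+ 2 / a k k =
      \sum_i \sum_j a k i * a k j / a k k * p i * p j.
    rewrite expr2 -mulrA mulr_suml; apply: eq_bigr => i _.
    by rewrite mulr_suml mulr_sumr; apply: eq_bigr => j _; ring.
  rewrite /bilin -sumrB; apply: eq_bigr => i _.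
  by rewrite -sumrB; apply: eq_bigr => j _; rewrite /a'; ring.
have a'pos p : 0 <= bilin a' p p.
  rewrite bil'; have := apos (fun i => p i + - (\sum_j a k j * p j) / a k k * unitv k i).
  rewrite bilin_shift //; congr (_ <= _); field.
  exact: lt0r_neq0.
have a'0 i : a i i = 0 -> a' i i = 0.
  by move=> ai; rewrite /a' ai asym psd_diag0 // !mul0r subr0.
have a'k : a' k k = 0 by rewrite /a' mulfK ?subrr.
have : 0 <= \sum_i \sum_j a' i j * H i j.
  apply: IH => //; rewrite -ltnS; apply: leq_trans ltm; rewrite ltnS.
  apply: proper_card; apply/properP; split.
    apply/fintype.subsetP => i; rewrite !inE; apply: contra_neq => ai; exact: a'0.
  by exists k; rewrite !inE //= a'k eqxx.
have hk := Hpos (fun i => a k i).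
move=> h'; have : 0 <= \sum_i \sum_j a' i j * H i j +
    (a k k)^-1 * \sum_i \sum_j a k i * a k j * H i j.
  by rewrite addr_ge0 // mulr_ge0 // invr_ge0 ltW.
congr (_ <= _); rewrite mulr_sumr -big_split /=; apply: eq_bigr => i _.
by rewrite mulr_sumr -big_split /=; apply: eq_bigr => j _; rewrite /a'; ring.
Qed.

End PositiveForms.

(** * Degenerate elliptic operators in divergence form *)

Section DivergenceForm.
Variables (R : realType) (N : nat) (A : 'rV[R]_N -> 'M[R]_N).
Hypothesis A_smooth : forall i j, smooth setT (fun x => A x i j).
Hypothesis A_sym : forall x, (A x)^T = A x.
Hypothesis A_psd : forall (x xi : 'rV[R]_N), 0 <= (xi *m A x *m xi^T) ord0 ord0.
Local Notation rV := 'rV[R]_N.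
Implicit Types (U : set rV) (f g u Q s zeta : rV -> R) (i j : 'I_N) (x : rV).

Definition grad f x : 'rV[R]_N := \row_i partial i f x.

(** The carre du champ, which measures by how much divform fails to be a
    derivation (see divform_mul). *)
Definition carre f g x : R := (grad f x *m A x *m (grad g x)^T) ord0 ord0.

(** The weight Q is V for the given operator, and h^2 V for its conjugate by a
    positive solution h. *)
Definition divform Q u x : R :=
  \sum_(i < N) \sum_(j < N) partial i (fun y => Q y * A y i j * partial j u y) x.

Lemma carreE f g x :
  carre f g x = \sum_i \sum_j A x i j * partial i f x * partial j g x.
Proof.
rewrite /carre mxE; under eq_bigr => j _ do rewrite !mxE mulr_suml.
rewrite exchange_big /=; apply: eq_bigr => i _; apply: eq_bigr => j _.
by rewrite !mxE; ring.
Qed.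

Lemma carreC f g x : carre f g x = carre g f x.
Proof.
rewrite !carreE exchange_big /=; apply: eq_bigr => i _; apply: eq_bigr => j _.
by rewrite -{1}(A_sym x) mxE mulrAC.
Qed.

Lemma carre_ge0 f x : 0 <= carre f f x.
Proof. exact: A_psd. Qed.

(** Nonnegativity of the form at grad f + r grad g and grad f - r grad g. *)
Lemma carre_amgm (r : R) f g x : 0 < r ->
  2 * `|carre f g x| <= r^-1 * carre f f x + r * carre g g x.
Proof.
move=> r0; have H t : 0 <= carre f f x + t * (2 * carre f g x) + t ^+ 2 * carre g g x.
  have := A_psd x (grad f x + t *: grad g x).
  rewrite !(mulmxDl, mulmxDr, linearD, linearZ) /=.
  have e p q : \sum_j (grad p x *m A x) ord0 j * (grad q x)^T j ord0 = carre p q x.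
    by rewrite /carre mxE.
  rewrite -?scalemxAl ?linearZ /= !mxE !e (carreC g f).
  move: (carre f f x) (carre f g x) (carre g g x) {e} => a b d.
  by have -> : a + t * (2 * b) + t ^+ 2 * d = a + t * b + (t * b + t * (t * d)) by ring.
have H1 := H r; have H2 := H (- r).
have e t : r^-1 * (carre f f x + t * (2 * carre f g x) + t ^+ 2 * carre g g x) =
   r^-1 * carre f f x + r^-1 * t * (2 * carre f g x) + r^-1 * t ^+ 2 * carre g g x.
  by rewrite !mulrDr !mulrA.
have r1 : 0 <= r^-1 by rewrite invr_ge0 ltW.
have := mulr_ge0 r1 H1; have := mulr_ge0 r1 H2; rewrite !e.
rewrite mulrN sqrrN expr2 (mulrA _ r r) mulVf ?gt_eqF // !mul1r => h1 h2.
move: (carre f f x) (carre f g x) (carre g g x) (r^-1) h1 h2 {H H1 H2 e r1} => a b d q h1 h2.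
have [c0|c0] := leP 0 b; rewrite ?(ger0_norm c0) ?(ltr0_norm c0) //; lra.
Qed.

Let flux Q u i j x := Q x * A x i j * partial j u x.

Lemma Ck_flux k U Q u i j : open U -> Ck k U Q -> Ck k.+1 U u -> Ck k U (flux Q u i j).
Proof.
move=> oU CQ Cu; apply: CkM => //; last exact: Ck_partial.
by apply: CkM => //; apply: Ck_subset (A_smooth i j k).
Qed.

Lemma Ck_divform k U Q u : open U -> Ck k.+1 U Q -> Ck k.+2 U u -> Ck k U (divform Q u).
Proof.
move=> oU CQ Cu; apply: Ck_sum => // i; apply: Ck_sum => // j.
by apply: Ck_partial; exact: Ck_flux.
Qed.

Lemma divform_eq U Q Q' u u' x : open U -> U x -> (forall y, U y -> Q y = Q' y) ->
  (forall y, U y -> u y = u' y) -> divform Q u x = divform Q' u' x.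
Proof.
move=> oU Ux eQ eu; apply: eq_bigr => i _; apply: eq_bigr => j _.
apply: (partial_eq _ oU _ Ux) => y Uy; rewrite eQ // (partial_eq _ oU eu Uy) //.
Qed.

Lemma flux_derivable U Q u i j x : open U -> Ck 1 U Q -> Ck 2 U u -> U x ->
  derivable (flux Q u i j) x (delta_mx ord0 i).
Proof. by move=> oU CQ Cu Ux; exact: Ck_derivable (Ck_flux i j oU CQ Cu) Ux. Qed.

(** The product rule from which the rules for weights, products and composites
    follow. *)
Lemma div_mul_flux U s Q u x : open U -> Ck 1 U s -> Ck 1 U Q -> Ck 2 U u -> U x ->
  \sum_i \sum_j partial i (fun y => s y * flux Q u i j y) x =
  s x * divform Q u x + Q x * carre s u x.
Proof.
move=> oU Cs CQ Cu Ux; rewrite carreE !mulr_sumr -big_split /=.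
apply: eq_bigr => i _; rewrite !mulr_sumr -big_split /=; apply: eq_bigr => j _.
rewrite partialM; [|exact: Ck_derivable Cs Ux|exact: flux_derivable Ux].
by rewrite /flux; ring.
Qed.

Lemma divform_weight U s Q u x : open U -> Ck 1 U s -> Ck 1 U Q -> Ck 2 U u -> U x ->
  divform (fun y => s y * Q y) u x = s x * divform Q u x + Q x * carre s u x.
Proof.
move=> oU Cs CQ Cu Ux; rewrite -(div_mul_flux oU Cs CQ Cu Ux).
apply: eq_bigr => i _; apply: eq_bigr => j _; congr (partial i _ x).
by apply/funext => y; rewrite /flux !mulrA.
Qed.

Lemma divform_mul U Q f g x : open U -> Ck 1 U Q -> Ck 2 U f -> Ck 2 U g -> U x ->
  divform Q (fun y => f y * g y) x =
  f x * divform Q g x + g x * divform Q f x + 2 * (Q x * carre f g x).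
Proof.
move=> oU CQ Cf Cg Ux.
have -> : divform Q (fun y => f y * g y) x =
   \sum_i \sum_j partial i (fun y => f y * flux Q g i j y) x +
   \sum_i \sum_j partial i (fun y => g y * flux Q f i j y) x.
  rewrite -big_split; apply: eq_bigr => i _; rewrite -big_split; apply: eq_bigr => j _.
  rewrite /= -partialD; last 2 first.
  - by apply: Ck_derivable Ux; apply: CkM => //; [exact: Ck_pred Cf|exact: Ck_flux].
  - by apply: Ck_derivable Ux; apply: CkM => //; [exact: Ck_pred Cg|exact: Ck_flux].
  apply: (partial_eq _ oU _ Ux) => y Uy.
  rewrite partialM; [|exact: Ck_derivable Cf Uy|exact: Ck_derivable Cg Uy].
  by rewrite /flux; ring.
rewrite [X in X + _](div_mul_flux oU (Ck_pred Cf) CQ Cg Ux).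
rewrite [X in _ + X](div_mul_flux oU (Ck_pred Cg) CQ Cf Ux).
rewrite (carreC g f).
by move: (carre f g x) (divform Q g x) (divform Q f x) => a b d; ring.
Qed.

Section Chain.
Variables (U : set rV) (I : set R) (F F1 F2 : R -> R) (u : rV -> R).
Hypothesis oU : open U.
Hypothesis oI : open I.
Hypothesis UI : forall x, U x -> I (u x).
Hypothesis dF : forall t : R, I t -> is_derive t 1 F (F1 t).
Hypothesis dF1 : forall t : R, I t -> is_derive t 1 F1 (F2 t).
Hypothesis cF2 : forall t : R, I t -> {for t, continuous F2}.

Lemma Ck_chain2 : Ck 2 U u -> Ck 2 U (fun x => F (u x)).
Proof. by move=> Cu; apply: Ck_comp UI _ Cu => //; exact: C1k_two dF dF1 cF2. Qed.

Lemma Ck_chain1 : Ck 1 U u -> Ck 1 U (fun x => F1 (u x)).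
Proof. by move=> Cu; apply: Ck_comp UI _ Cu => //; exact: C1k_one dF1 cF2. Qed.

Lemma partial_comp i x : Ck 1 U u -> U x ->
  partial i (fun y => F (u y)) x = F1 (u x) * partial i u x.
Proof.
move=> Cu Ux; have [d e] := dF (UI Ux).
have du := Ck_derivable (i := i) Cu Ux; have [dFu _] := dF (UI Ux).
by rewrite (partial_chain du dFu) derive1E e.
Qed.

Lemma carre_chain g x : Ck 1 U u -> U x ->
  carre (fun y => F (u y)) g x = F1 (u x) * carre u g x.
Proof.
move=> Cu Ux; rewrite !carreE mulr_sumr; apply: eq_bigr => i _.
by rewrite mulr_sumr; apply: eq_bigr => j _; rewrite partial_comp //; ring.
Qed.

Lemma divform_chain Q x : Ck 1 U Q -> Ck 2 U u -> U x ->
  divform Q (fun y => F (u y)) x =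
  F1 (u x) * divform Q u x + F2 (u x) * (Q x * carre u u x).
Proof.
move=> CQ Cu Ux; have Cu1 := Ck_pred Cu.
have -> : divform Q (fun y => F (u y)) x =
    \sum_i \sum_j partial i (fun y => F1 (u y) * flux Q u i j y) x.
  apply: eq_bigr => i _; apply: eq_bigr => j _.
  apply: (partial_eq _ oU _ Ux) => y Uy; rewrite partial_comp // /flux; ring.
rewrite (div_mul_flux oU (Ck_chain1 Cu1) CQ Cu Ux).
have -> : carre (fun y => F1 (u y)) u x = F2 (u x) * carre u u x.
  rewrite !carreE mulr_sumr; apply: eq_bigr => i _.
  rewrite mulr_sumr; apply: eq_bigr => j _.
  have [d e] := dF1 (UI Ux).
  have [dFu _] := dF1 (UI Ux); have du := Ck_derivable (i := i) Cu1 Ux.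
  rewrite (partial_chain du dFu) derive1E e.
  by move: (partial i u x) (partial j u x) => a b; ring.
by rewrite mulrCA.
Qed.

End Chain.

Lemma Cc_carre U Q u zeta : open U -> Ck 0 U Q -> Ck 1 U u -> supported 1 U zeta ->
  compactly_continuous (fun x => Q x * carre zeta u x).
Proof.
move=> oU CQ Cu sz.
have e x : Q x * carre zeta u x = (\sum_i \sum_j flux Q u i j x * partial i zeta x).
  rewrite carreE mulr_sumr; apply: eq_bigr => i _; rewrite mulr_sumr.
  by apply: eq_bigr => j _; rewrite /flux; ring.
rewrite (funext e : (fun x => _) = _).
apply: (integral_Cc_sum _ _).1 => i; apply: (integral_Cc_sum _ _).1 => j.
apply: (Cc_mul_supported oU) (supported_partial i sz).
by move=> y Uy; exact: Ck_continuous (Ck_flux i j oU CQ Cu) Uy.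
Qed.

(** Outside the support of zeta, where the coefficients may be meaningless, all
    terms vanish. *)
Lemma integral_divform U Q u zeta : open U -> Ck 1 U Q -> Ck 2 U u ->
  supported 1 U zeta ->
  integral_rV (fun x => divform Q u x * zeta x) =
  - integral_rV (fun x => Q x * carre zeta u x).
Proof.
move=> oU CQ Cu sz; have [K [cK KU Cz z0]] := sz.
pose G i j := fun x => flux Q u i j x * zeta x.
have CG i j : supported 1 U (G i j) by apply: supported_mul => //; exact: Ck_flux.
have CcG i j : compactly_continuous (partial i (G i j)).
  exact: supported_Cc (supported_partial i (CG i j)).
have oK : open (~` K) by apply: closed_openC; exact: compact_closed_rV.
have key x : divform Q u x * zeta x =
    -1 * (Q x * carre zeta u x) + \sum_i \sum_j partial i (G i j) x.
  have [Ux|nUx] := pselect (U x).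
    have -> : \sum_i \sum_j partial i (G i j) x =
        \sum_i \sum_j partial i (fun y => zeta y * flux Q u i j y) x.
      apply: eq_bigr => i _; apply: eq_bigr => j _; congr (partial i _ x).
      by apply/funext => y; rewrite /G mulrC.
    have Cz1 : Ck 1 U zeta by exact: Ck_subset Cz.
    rewrite (div_mul_flux oU Cz1 CQ Cu Ux).
    by move: (carre zeta u x) (divform Q u x) => a b; ring.
  have Kx : ~ K x by move=> /KU.
  have dz i : partial i zeta x = 0.
    by rewrite (@partial_eq _ _ (~` K) _ (fun=> 0)) // ?partial_cst.
  have dG i j : partial i (G i j) x = 0.
    rewrite (@partial_eq _ _ (~` K) _ (fun=> 0)) // ?partial_cst // => y Ky.
    by rewrite /G z0 // mulr0.
  rewrite z0 // mulr0 carreE big1 ?mulr0 => [|i _]; last first.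
    by rewrite big1 // => j _; rewrite dz mulr0 mul0r.
  by rewrite add0r big1 // => i _; rewrite big1.
rewrite (funext key : (fun x => _) = _) integral_rVDZ; last 2 first.
- exact: Cc_carre (Ck_pred CQ) (Ck_pred Cu) sz.
- by apply: (integral_Cc_sum _ _).1 => i; apply: (integral_Cc_sum _ _).1 => j.
rewrite mulN1r (integral_Cc_sum _ _).2; last by move=> i; apply: (integral_Cc_sum _ _).1.
rewrite big1 ?addr0 // => i _; rewrite (integral_Cc_sum _ _).2 // big1 // => j _.
have [K' [_ _ CG' _]] := CG i j.
by apply: integral_partial0 => //; exact: supported_supp (CG i j).
Qed.

(** The same formula when the derivatives fall on the compactly supported
    factor: the two versions differ by the integral of divform Q (u zeta),
    which is zero. *)
Lemma integral_divform_sym U Q u zeta : open U -> Ck 1 U Q -> Ck 2 U u ->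
  supported 2 U zeta ->
  compactly_continuous (fun x => u x * divform Q zeta x) /\
  integral_rV (fun x => u x * divform Q zeta x) =
  - integral_rV (fun x => Q x * carre zeta u x).
Proof.
move=> oU CQ Cu sz; have [K [cK KU Cz z0]] := sz.
have oK : open (~` K) by apply: closed_openC; exact: compact_closed_rV.
pose w := fun x => u x * zeta x.
have sw : supported 2 U w by exact: supported_mul.
have CzU : Ck 2 U zeta by exact: Ck_subset Cz.
have CwU : Ck 2 U w by exact: CkM.
have partialK i f x : (forall y, ~ K y -> f y = 0) -> ~ K x -> partial i f x = 0.
  by move=> f0 Kx; rewrite (@partial_eq _ _ (~` K) _ (fun=> 0)) // ?partial_cst.
have fluxK f i j x : (forall y, ~ K y -> f y = 0) -> ~ K x -> flux Q f i j x = 0.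
  by move=> f0 Kx; rewrite /flux partialK // mulr0.
have divK f x : (forall y, ~ K y -> f y = 0) -> ~ K x -> divform Q f x = 0.
  move=> f0 Kx; rewrite /divform big1 // => i _; rewrite big1 // => j _.
  by apply: partialK => // y Ky; exact: fluxK.
have w0 y : ~ K y -> w y = 0 by move=> Ky; rewrite /w z0 // mulr0.
have sG i j : supported 1 U (flux Q w i j).
  exists K; split=> // [|x Kx]; last exact: fluxK.
  apply: Ck_local => x _; have [Ux|nUx] := pselect (U x).
    by exists U => //; exact: Ck_flux.
  exists (~` K); first by move=> /KU.
  apply: Ck_eq (@Ck_cst R N 1 (~` K) 0) => // y Ky; exact/esym/fluxK.
have CcG i j : compactly_continuous (partial i (flux Q w i j)).
  exact: supported_Cc (supported_partial i (sG i j)).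
have CDi i : compactly_continuous (fun x => \sum_j partial i (flux Q w i j) x).
  by apply: (integral_Cc_sum _ _).1 => j; exact: CcG.
have CDw : compactly_continuous (divform Q w) := (integral_Cc_sum _ CDi).1.
have IDw : integral_rV (divform Q w) = 0.
  rewrite [LHS](integral_Cc_sum _ CDi).2 big1 // => i _.
  rewrite (integral_Cc_sum _ (CcG i)).2 big1 // => j _.
  have [K' [_ _ CG' _]] := sG i j.
  by apply: integral_partial0 => //; exact: supported_supp (sG i j).
have sz1 : supported 1 U zeta by exact: supported_le sz.
have Cc1 := Cc_carre oU (Ck_pred CQ) (Ck_pred Cu) sz1.
have Cc2 : compactly_continuous (fun x => divform Q u x * zeta x).
  apply: (Cc_mul_supported oU _ sz) => x Ux.
  exact: Ck_continuous (Ck_divform oU CQ Cu) Ux.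
have key : (fun x => u x * divform Q zeta x) =
    (fun x => -1 * (divform Q u x * zeta x) +
       (- 2 * (Q x * carre zeta u x) + divform Q w x)).
  apply/funext => x; have [Ux|nUx] := pselect (U x).
    rewrite (divform_mul oU CQ Cu CzU Ux) (carreC zeta u).
    by move: (carre u zeta x) (divform Q u x) (divform Q zeta x) => a b d; ring.
  have Kx : ~ K x by move=> /KU.
  rewrite (divK zeta x z0 Kx) (divK w x w0 Kx) (z0 x Kx) carreE big1 => [|i _]; last first.
    by rewrite big1 // => j _; rewrite (partialK i zeta) // mulr0 mul0r.
  by rewrite !mulr0 !addr0.
rewrite key; split; first by do 2! apply: CcDZ => //.
have Cc3 := CcDZ (- 2) Cc1 CDw.
rewrite (integral_rVDZ _ Cc2 Cc3) (integral_rVDZ _ Cc1 CDw) IDw addr0.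
rewrite (integral_divform oU CQ Cu sz1).
by move: (integral_rV _) => a; ring.
Qed.

End DivergenceForm.
(** * The weak minimum principle *)

Section Operators.
Variables (R : realType) (N : nat) (V : 'rV[R]_N -> R) (A : 'rV[R]_N -> 'M[R]_N).
Variable c : 'rV[R]_N -> R.
Hypothesis V_smooth : smooth setT V.
Hypothesis V_gt0 : forall x, 0 < V x.
Hypothesis A_smooth : forall i j, smooth setT (fun x => A x i j).
Hypothesis A_sym : forall x, (A x)^T = A x.
Hypothesis A_psd : forall (x xi : 'rV[R]_N), 0 <= (xi *m A x *m xi^T) ord0 ord0.
Hypothesis A_neq0 : forall x, A x != 0.
Hypothesis c_smooth : smooth setT c.
Hypothesis c_ge0 : forall x, 0 <= c x.
Hypothesis Lc_hypo : forall Omega : set 'rV[R]_N,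
  open Omega -> hypoelliptic (Lc_distr V A c) Omega.
Local Notation rV := 'rV[R]_N.
Local Notation Cc := (@compactly_continuous R N).
Implicit Types (U K W B Omega : set rV) (i j : 'I_N) (x y z : rV).
Implicit Types (f g h u v w q phi psi zeta eta H Q : rV -> R) (T : functional R N).

(** V times the operator; unlike the operator itself it is formally symmetric. *)
Definition Mop u x : R := divform A V u x - c x * V x * u x.

Local Notation M := Mop.

Lemma A_symE x i j : A x i j = A x j i.
Proof. by rewrite -{1}(A_sym x) mxE. Qed.

Lemma A_bilin_ge0 x p : 0 <= bilin (fun i j => A x i j) p p.
Proof.
have := A_psd x (\row_i p i); congr (_ <= _).
rewrite mxE /bilin exchange_big /=; apply: eq_bigr => j _.
by rewrite !mxE mulr_suml; apply: eq_bigr => i _; rewrite !mxE; ring.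
Qed.

Lemma Ck_V U k : Ck k U V.
Proof. by apply: Ck_subset (V_smooth k). Qed.

Lemma divformDZ U Q (a : R) f g x : open U -> Ck 1 U Q -> Ck 2 U f -> Ck 2 U g -> U x ->
  divform A Q (fun y => a * f y + g y) x = a * divform A Q f x + divform A Q g x.
Proof.
move=> oU CQ Cf Cg Ux; rewrite /divform mulr_sumr -big_split /=; apply: eq_bigr => i _.
rewrite mulr_sumr -big_split /=; apply: eq_bigr => j _.
have df := flux_derivable A_smooth (i := i) (j := j) oU CQ Cf Ux.
have dg := flux_derivable A_smooth (i := i) (j := j) oU CQ Cg Ux.
have daf := derivable_scale (a := a) df.
rewrite -(partialZ a df) -(partialD daf dg).
apply: (partial_eq _ oU _ Ux) => y Uy.
have d1 := Ck_derivable (i := j) Cf Uy; have d2 := Ck_derivable (i := j) Cg Uy.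
have da1 := derivable_scale (a := a) d1.
rewrite (partialD da1 d2) (partialZ a d1).
by move: (partial j f y) (partial j g y) => p q; ring.
Qed.

Lemma MopDZ U (a : R) f g x : open U -> Ck 2 U f -> Ck 2 U g -> U x ->
  Mop (fun y => a * f y + g y) x = a * Mop f x + Mop g x.
Proof.
move=> oU Cf Cg Ux; rewrite /Mop (divformDZ a oU (Ck_V U 1) Cf Cg Ux).
by move: (divform A V f x) (divform A V g x) => p q; ring.
Qed.

(** At a minimum the first-order terms vanish, and what remains is the trace of
    the product of A with the positive semidefinite Hessian. *)
Lemma min_divform_ge0 U u z : open U -> Ck 2 U u -> U z ->
  (forall x, U x -> u z <= u x) -> 0 <= divform A V u z.
Proof.
move=> oU Cu Uz umin; have [g0 h0] := local_min_test oU Cu Uz umin.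
have -> : divform A V u z =
    V z * \sum_i \sum_j A z i j * partial i (partial j u) z.
  rewrite mulr_sumr; apply: eq_bigr => i _; rewrite mulr_sumr; apply: eq_bigr => j _.
  have CVA : Ck 1 U (fun y => V y * A y i j).
    by apply: CkM => //; [exact: Ck_V|exact: Ck_subset (A_smooth i j 1%N)].
  rewrite partialM; first by rewrite g0 mulr0 add0r mulrA.
  - exact: (Ck_derivable (i := i) CVA Uz).
  - exact: (Ck_derivable (i := i) (Ck_partial j Cu) Uz).
rewrite mulr_ge0 ?(ltW (V_gt0 z)) // psd_trace_ge0 //.
- by move=> i j; exact: A_symE.
- exact: A_bilin_ge0.
- move=> p; have := h0 (\row_i p i); congr (_ <= _); apply: eq_bigr => i _.
  by apply: eq_bigr => j _; rewrite !mxE.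
Qed.

(** If phi were negative somewhere, phi + e b would, for small e, have a negative
    minimum; it lies in B, where the second-order test contradicts
    M (phi + e b) < 0. *)
Lemma weak_minimum_principle U K B b phi : open U -> K `<=` U -> compact K -> open B ->
  B `<=` K -> Ck 2 U phi -> Ck 2 U b ->
  (forall x, K x -> 0 <= b x) -> (forall x, B x -> Mop b x < 0) ->
  (forall x, K x -> ~ B x -> 0 <= phi x) -> (forall x, B x -> Mop phi x <= 0) ->
  forall x, K x -> 0 <= phi x.
Proof.
move=> oU KU cK oB BK Cphi Cb b0 Mb phib Mphi x1 Kx1; rewrite leNgt; apply/negP => phi1.
have b1 : 0 < b x1 + 1 by rewrite ltr_wpDl // b0.
pose e : R := - phi x1 / (2 * (b x1 + 1)).
have e0 : 0 < e by rewrite divr_gt0 ?oppr_gt0 // mulr_gt0.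
pose psi y := e * b y + phi y.
have psi1 : psi x1 < 0.
  have : e * (2 * (b x1 + 1)) = - phi x1 by rewrite /e divfK // gt_eqF // mulr_gt0.
  have := b0 _ Kx1; rewrite /psi; nra.
have Cpsi : Ck 2 U psi := CkD oU (CkZ e oU Cb) Cphi.
have cpsi : {within K, continuous psi}.
  by apply: continuous_in_subspaceT => y /set_mem /KU; exact: (Ck_continuous Cpsi).
have K0 : K !=set0 by exists x1.
have [z /set_mem Kz zmin] := EVT_min_rV K0 cK cpsi.
have psiz : psi z < 0 by apply: le_lt_trans psi1; apply: zmin; exact: mem_set.
have Bz : B z.
  apply: contrapT => nB; move: psiz; rewrite ltNge => /negP; apply.
  by rewrite addr_ge0 ?(phib _ Kz) // mulr_ge0 ?(ltW e0) ?b0.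
have BU : B `<=` U := subset_trans BK KU.
have D0 : 0 <= divform A V psi z.
  apply: (min_divform_ge0 oB (Ck_subset BU Cpsi) Bz) => y /BK Ky.
  by apply: zmin; exact: mem_set.
have M0 : 0 <= Mop psi z.
  have cV : 0 <= c z * V z by rewrite mulr_ge0 // ltW.
  by rewrite /Mop; nra.
move: M0; rewrite (MopDZ e oU Cb Cphi (BU _ Bz)).
have := Mb _ Bz; have := Mphi _ Bz; nra.
Qed.

(** A positive semidefinite matrix with zero diagonal is zero. *)
Lemma A_diag_gt0 x : exists i, 0 < A x i i.
Proof.
apply: contrapT => nA; move: (A_neq0 x) => /eqP; apply; apply/matrixP => i j.
rewrite mxE; apply: (@psd_diag0 R N (fun i j => A x i j)).
- by move=> i' j'; exact: A_symE.
- exact: A_bilin_ge0.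
- apply/eqP; rewrite eq_le; apply/andP; split.
    by rewrite leNgt; apply/negP => Ai; apply: nA; exists i.
  have := A_psd x (delta_mx ord0 i); congr (_ <= _).
  by rewrite trmx_delta -rowE -colE !mxE.
Qed.

Definition parabola x0 i (r : R) x : R := r ^+ 2 - (x ord0 i - x0 ord0 i) ^+ 2.

Lemma smooth_parabola U x0 i r : open U -> smooth U (parabola x0 i r).
Proof.
move=> oU; have s1 : smooth U (fun y : rV => y ord0 i - x0 ord0 i).
  by apply: smoothB => //; [move=> k; exact: Ck_coord|exact: smooth_cst].
apply: smoothB => //; first exact: smooth_cst.
by apply: (smooth_eq oU _ (smoothM oU s1 s1)) => y _; rewrite expr2.
Qed.

Lemma parabola_bounds x0 i (r : R) x : `|x0 - x| <= r ->
  0 <= parabola x0 i r x <= r ^+ 2.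
Proof.
move=> xr; rewrite /parabola subr_ge0 lerBlDr lerDl sqr_ge0 andbT.
have := coord_norm_le (x0 - x) i; rewrite !mxE => h.
have h2 := le_trans h xr; rewrite -real_normK ?num_real // distrC.
by rewrite lerXn2r // nnegrE // (le_trans _ xr).
Qed.

Lemma divform_parabola x0 i (r : R) x :
  divform A V (parabola x0 i r) x =
  - 2 * (x ord0 i - x0 ord0 i) * divform A V (fun y => y ord0 i) x - 2 * (V x * A x i i).
Proof.
have oT : open (setT : set rV) by exact: openT.
have oTR : open (setT : set R) by exact: openT.
pose F (t : R) := r ^+ 2 - (t - x0 ord0 i) ^+ 2.
have dF (t : R) : setT t -> is_derive t 1 F (- 2 * (t - x0 ord0 i)).
  move=> _.
  have d1 : is_derive t 1 (fun t : R => t - x0 ord0 i) (1 - 0).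
    by apply: is_deriveB.
  have d2 := is_deriveM d1 d1.
  have d3 := is_deriveB (is_derive_cst (r ^+ 2) t (1 : R)) d2.
  have -> : F = cst (r ^+ 2) - (fun t : R => t - x0 ord0 i) * (fun t : R => t - x0 ord0 i).
    by apply/funext => s; rewrite /F expr2.
  by apply: is_derive_eq d3 _; rewrite /GRing.scale /=; ring.
have dF1 (t : R) : setT t -> is_derive t 1 (fun t => - 2 * (t - x0 ord0 i)) (- 2).
  move=> _.
  have d1 : is_derive t 1 (fun t : R => t - x0 ord0 i) (1 - 0).
    by apply: is_deriveB.
  apply: is_derive_eq (is_deriveZ (- 2) d1) _.
  by rewrite /GRing.scale /= subr0 mulr1.
have cF2 (t : R) : setT t -> {for t, continuous (fun _ : R => - 2 : R)}.
  by move=> _; exact: cst_continuous.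
have UT (y : rV) : setT y -> (setT : set R) (y ord0 i) by [].
have Cu : Ck 2 setT (fun y : rV => y ord0 i) by exact: Ck_coord.
have := divform_chain A_smooth oT oTR UT dF dF1 cF2 (Ck_V setT 1) Cu (Logic.I : setT x).
rewrite -/(parabola x0 i r) => ->.
have -> : carre A (fun y : rV => y ord0 i) (fun y => y ord0 i) x = A x i i.
  have dc k : partial k (fun y : rV => y ord0 i) x = (k == i)%:R.
    by have [_] := is_derive_coord k i x.
  rewrite carreE (bigD1 i) //= (bigD1 i) //= !dc eqxx !mulr1 big1 ?addr0.
    rewrite big1 ?addr0 // => k ki; rewrite big1 // => l _.
    by rewrite dc (negbTE ki) mulr0 mul0r.
  by move=> l li; rewrite dc (negbTE li) mulr0.
by move: (divform A V _ x) => q; ring.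
Qed.

(** Near x0 some coordinate direction is elliptic, and a parabola in that
    direction is a strict supersolution on every small ball. *)
Lemma barrier x0 : exists i (alpha r0 : R), [/\ 0 < alpha, 0 < r0 &
  forall r x, 0 < r <= r0 -> `|x0 - x| <= r -> Mop (parabola x0 i r) x <= - alpha].
Proof.
have [i Ai] := A_diag_gt0 x0.
have VA0 : 0 < V x0 * A x0 i i by rewrite mulr_gt0.
pose beta := divform A V (fun y : rV => y ord0 i).
have oT : open (setT : set rV) by exact: openT.
have c1 : {for x0, continuous (fun x => V x * A x i i)}.
  have CV : Ck 0 setT (fun x => V x * A x i i) := CkM oT (V_smooth 0) (A_smooth i i 0).
  exact: (Ck_continuous CV).
have c2 : {for x0, continuous beta}.
  have Cb : Ck 0 setT beta := Ck_divform A_smooth oT (V_smooth 1) (@Ck_coord R N 2 setT i).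
  exact: (Ck_continuous Cb).
pose alpha := V x0 * A x0 i i / 2.
have al0 : 0 < alpha by rewrite divr_gt0.
have /continuous_epsP/(_ _ al0)[d1 d10 H1] := c1.
have /continuous_epsP/(_ 1 ltr01)[d2 d20 H2] := c2.
pose b0 := `|beta x0| + 1.
have b00 : 0 < b0 by rewrite ltr_wpDl.
pose r0 := Num.min (d1 / 2) (Num.min (d2 / 2) (alpha / (2 * b0))).
exists i, alpha, r0; split=> //.
  by rewrite !lt_min !divr_gt0 // mulr_gt0.
move=> r x /andP[r_gt0 rr0] xr.
have /andP[p0 _] := parabola_bounds i xr.
move: rr0; rewrite !le_min => /and3P[rd1 rd2 ra].
have hV : alpha <= V x * A x i i.
  have := H1 x; rewrite ltr_norml => /(_ _)/andP[]; first by lra.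
  by rewrite /alpha; lra.
have hb : `|beta x| <= b0.
  have h2 : `|beta x0 - beta x| < 1 by apply: H2; lra.
  rewrite -[beta x](subKr (beta x0)) (le_trans (ler_normB _ _)) // lerD2l; exact: ltW.
have hs : `|x ord0 i - x0 ord0 i| <= r.
  by have := coord_norm_le (x0 - x) i; rewrite !mxE distrC => h; apply: le_trans h xr.
have hsb : `|(x ord0 i - x0 ord0 i) * beta x| <= alpha / 2.
  rewrite normrM; apply: (@le_trans _ _ (r * b0)); first by rewrite ler_pM.
  by move: ra; rewrite ler_pdivlMr ?mulr_gt0 // => h; lra.
move: hsb; rewrite ler_norml => /andP[hsb _].
have cp : 0 <= c x * V x * parabola x0 i r x.
  by rewrite mulr_ge0 // mulr_ge0 // ltW.
rewrite /Mop divform_parabola -/beta.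
move: hsb; rewrite -/beta; move: (beta x) (x ord0 i - x0 ord0 i) => q s hsb.
have -> : - 2 * s * q = - 2 * (s * q) by ring.
lra.
Qed.

(** * Weak solutions *)

Lemma test_mulT U g phi : smooth setT g -> test_function U phi ->
  test_function U (fun x => g x * phi x).
Proof.
move=> sg [K [cK KU [sp p0]]]; exists K; split=> //; split.
  by apply: smoothM => //; exact: openT.
by move=> x Kx; rewrite p0 // mulr0.
Qed.

Lemma test_div_term U zeta i j : test_function U zeta ->
  test_function U (partial i (fun y => V y * A y i j * partial j zeta y)).
Proof.
move=> tz; apply: test_partial; apply: test_mulT; last exact: test_partial.
by apply: smoothM => //; exact: openT.
Qed.

Lemma test_divform U zeta : test_function U zeta -> test_function U (divform A V zeta).
Proof. by move=> tz; apply: test_sum => i; apply: test_sum => j; exact: test_div_term. Qed.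

Lemma test_Mop U zeta : test_function U zeta -> test_function U (M zeta).
Proof.
move=> tz; have scV : smooth setT (fun x => - (c x * V x)).
  move=> k; apply: CkN; first exact: openT.
  by apply: (smoothM _ c_smooth V_smooth); exact: openT.
have := testD (test_divform tz) (test_mulT scV tz).
by congr test_function; apply/funext => x; rewrite /Mop; ring.
Qed.

(** Both derivatives are passed to the test function; the indices change places,
    which the symmetry of A repairs. *)
Lemma Lc_distrE U T phi : linear_on U T -> test_function U phi ->
  Lc_distr V A c T phi = T (M (fun x => (V x)^-1 * phi x)).
Proof.
move=> lin tp; set zeta := fun x => (V x)^-1 * phi x.
have sV : smooth setT (fun x => (V x)^-1).
  by apply: smooth_inv => //; [exact: openT|move=> x _; rewrite gt_eqF].
have tz : test_function U zeta by exact: test_mulT.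
have tcp : test_function U (fun x => c x * phi x) by exact: test_mulT.
have -> : M zeta = fun x => divform A V zeta x - c x * phi x.
  apply/funext => x; rewrite /Mop /zeta; congr (_ - _).
  by rewrite -mulrA mulVKf // gt_eqF.
rewrite (linear_onB lin (test_divform tz) tcp) /Lc_distr /mul_distr /partial_distr.
congr (_ - _); rewrite (linear_on_sum _ lin) => [|i]; last first.
  by apply: test_sum => j; exact: test_div_term.
rewrite exchange_big /=; apply: eq_bigr => i _.
rewrite (linear_on_sum _ lin) => [|j]; last exact: test_div_term.
apply: eq_bigr => j _; rewrite opprK; congr (T (partial i _)).
by apply/funext => y; rewrite -{1}(A_sym y) mxE.
Qed.

(** Hypoellipticity in the form in which it is used: a functional of order zero
    is a distribution, so that a weak solution with smooth right-hand side has
    a smooth density. *)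
Lemma weak_solution_smooth U T f : open U -> linear_on U T ->
  (forall K, compact K -> K `<=` U -> exists2 C : R, 0 <= C & forall phi (B : R),
     smooth_supported_in K phi -> (forall x, `|phi x| <= B) -> `|T phi| <= C * B) ->
  smooth U f ->
  (forall zeta, test_function U zeta ->
     T (M zeta) = integral_rV (fun x => f x * V x * zeta x)) ->
  exists2 g, smooth U g & forall phi, test_function U phi ->
    T phi = integral_rV (fun x => g x * phi x).
Proof.
move=> oU lin bnd sf TM.
have dT : Defs.distribution U T.
  split=> // K cK KU; have [C C0 HC] := bnd K cK KU; exists C, 0%N => phi sp.
  apply: HC => // x; apply: sup_le_Ck_norm; apply: (test_Cc (U := U)).
  by exists K.
have E : eq_distr U (Lc_distr V A c T) (function_distr f).
  move=> phi tp; rewrite (Lc_distrE lin tp) TM.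
    congr integral_rV; apply/funext => x.
    by rewrite -mulrA mulVKf // gt_eqF.
  apply: test_mulT => //; apply: smooth_inv => //; first exact: openT.
  by move=> x _; rewrite gt_eqF.
have [g sg eg] := Lc_hypo oU dT oU (@subset_refl _ U) sf E.
by exists g.
Qed.

(** * Positive local solutions *)

Lemma Ck_Mop U k u : open U -> Ck k.+2 U u -> Ck k U (M u).
Proof.
move=> oU Cu; have CV := @Ck_V U.
apply: CkB => //; first exact: (Ck_divform A_smooth oU (CV _) Cu).
apply: CkM => //; last exact: Ck_pred (Ck_pred Cu).
by apply: CkM => //; apply: Ck_subset (c_smooth k).
Qed.

(** Formal self-adjointness. *)
Lemma integral_Mop_sym U u zeta : open U -> Ck 2 U u -> supported 2 U zeta ->
  [/\ Cc (fun x => M u x * zeta x), Cc (fun x => u x * M zeta x) &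
   integral_rV (fun x => M u x * zeta x) = integral_rV (fun x => u x * M zeta x)].
Proof.
move=> oU Cu sz; have CV := Ck_V U 1.
have [C1 e1] := integral_divform_sym A_smooth A_sym oU CV Cu sz.
have e2 := integral_divform A_smooth oU CV Cu (supported_le (isT : (1 <= 2)%N) sz).
have Ccu : Ck 0 U (fun x => c x * V x * u x).
  apply: CkM => //; last exact: Ck_le Cu.
  by apply: CkM => //; [exact: Ck_subset (c_smooth 0)|exact: Ck_pred].
have C2 : Cc (fun x => divform A V u x * zeta x).
  apply: (Cc_mul_supported oU _ sz) => x; exact: (Ck_continuous (Ck_divform A_smooth oU CV Cu)).
have C3 : Cc (fun x => c x * V x * u x * zeta x).
  by apply: (Cc_mul_supported oU _ sz) => x; exact: (Ck_continuous Ccu).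
have eM1 : (fun x => M u x * zeta x) =
    (fun x => -1 * (c x * V x * u x * zeta x) + divform A V u x * zeta x).
  by apply/funext => x; rewrite /Mop; move: (divform A V u x) => d; ring.
have eM2 : (fun x => u x * M zeta x) =
    (fun x => -1 * (c x * V x * u x * zeta x) + u x * divform A V zeta x).
  by apply/funext => x; rewrite /Mop; move: (divform A V zeta x) => d; ring.
rewrite eM1 eM2; split; [exact: CcDZ|exact: CcDZ|].
by rewrite !integral_rVDZ // e1 e2.
Qed.

(** When F is convex with F 0 = 0 the last two terms are nonnegative; when F is
    concave they are nonpositive. *)
Lemma Mop_chain U (I : set R) (F F1 F2 : R -> R) u x : open U -> open I ->
  (forall y, U y -> I (u y)) -> (forall t : R, I t -> is_derive t 1 F (F1 t)) ->
  (forall t : R, I t -> is_derive t 1 F1 (F2 t)) ->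
  (forall t : R, I t -> {for t, continuous F2}) -> Ck 2 U u -> U x ->
  M (fun y => F (u y)) x = F1 (u x) * M u x + F2 (u x) * (V x * carre A u u x)
    + c x * V x * (u x * F1 (u x) - F (u x)).
Proof.
move=> oU oI UI dF dF1 cF2 Cu Ux; have CV := Ck_V U 1.
rewrite /Mop (divform_chain A_smooth oU oI UI dF dF1 cF2 CV Cu Ux).
by move: (divform A V u x) (carre A u u x) => p q; ring.
Qed.

Lemma integral_le_bound (r : R) : exists2 C : R, 0 < C & forall f (m : R),
  continuous f -> supp_in r f -> 0 <= m -> (forall x, f x <= m) -> integral_rV f <= m * C.
Proof.
have [C C0 bnd] := integral_rV_bound N r; exists C => // f m cf fr m0 fm.
pose g x := Num.max (f x) 0.
have Cf : Cc f by split=> //; exists r.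
have cmax : continuous (fun t : R => Num.max t 0).
  by move=> t; apply: continuous_max; [exact: cvg_id|exact: cvg_cst].
have Cg : Cc g by apply: (@Cc_comp R N (fun t : R => Num.max t 0)) => //; rewrite maxxx.
have gr : supp_in r g by move=> x /fr fx; rewrite /g fx maxxx.
apply: (@le_trans _ _ (integral_rV g)).
  by apply: le_integral_rV => // x; rewrite le_max lexx.
apply: le_trans (ler_norm _) _; apply: bnd => //; first by case: Cg.
by move=> x; rewrite ger0_norm ?le_max ?lexx ?orbT // ge_max fm.
Qed.

(** Kato's inequality M theta^+ >= - q, tested against the supersolution H:
    int c V theta^+ <= - int (M H) theta^+ = - int H (M theta^+) <= 1/2 int q.
    A smooth convex function stands for the positive part. *)
Lemma kato_estimate U H theta q : open U -> Ck 2 U H ->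
  (forall x, U x -> 0 <= H x <= 2^-1) -> (forall x, U x -> M H x <= - (c x * V x)) ->
  test_function U theta -> Cc q -> (forall x, 0 <= q x) ->
  (forall x, - M theta x <= q x) ->
  integral_rV (fun x => c x * V x * theta x) <= 2^-1 * integral_rV q.
Proof.
move=> oU CH H01 MH tth Cq q0 Mq.
have cV0 x : 0 <= c x * V x by rewrite mulr_ge0 // ltW.
have [K [cK KU [sth th0]]] := tth.
have [r Kr] := compact_bounded_norm cK.
have [C C0 bnd] := integral_le_bound r.
(* a bound for - M H on the support of theta *)
have [B B0 HB] : exists2 B : R, 0 <= B & forall x, K x -> - M H x <= B.
  have [K0|nK0] := pselect (K !=set0); last first.
    by exists 0 => // x Kx; case: nK0; exists x.
  have cM : {within K, continuous (M H)}.
    apply: continuous_in_subspaceT => x /set_mem /KU; exact: (Ck_continuous (Ck_Mop oU CH)).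
  have [z _ zmin] := EVT_min_rV K0 cK cM.
  exists `|M H z| => // x Kx; have := zmin x (mem_set Kx).
  by have := ler_norm (- M H z); rewrite normrN; lra.
have key (e : R) : 0 < e -> integral_rV (fun x => c x * V x * theta x) <=
    2^-1 * integral_rV q + e * (B * C).
  move=> e0; pose j x := softpos e (theta x).
  have oT : open (setT : set rV) by exact: openT.
  have oTR : open (setT : set R) by exact: openT.
  have UT (y : rV) : setT y -> (setT : set R) (theta y) by [].
  have d1 (t : R) : setT t -> is_derive t 1 (softpos e) (softpos1 e t).
    by move=> _; exact: is_derive_softpos.
  have d2 (t : R) : setT t -> is_derive t 1 (softpos1 e) (softpos2 e t).
    by move=> _; exact: is_derive_softpos1.
  have d3 (t : R) : setT t -> {for t, continuous (softpos2 e)}.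
    by move=> _; exact: continuous_softpos2.
  have sj : supported 2 U j.
    exists K; split=> //; first exact: Ck_chain2 oT oTR UT d1 d2 d3 (sth 2).
    by move=> x Kx; rewrite /j th0 // softpos0.
  have Mj x : - q x <= M j x.
    rewrite (Mop_chain oT oTR UT d1 d2 d3 (sth 2) (Logic.I : setT x)).
    have /andP[s0 s1] := softpos1_bounds e0 (theta x).
    have s2 : 0 <= softpos2 e (theta x) * (V x * carre A theta theta x).
      by rewrite mulr_ge0 ?softpos2_ge0 // mulr_ge0 ?carre_ge0 // ltW.
    have s3 : 0 <= c x * V x * (theta x * softpos1 e (theta x) - softpos e (theta x)).
      by rewrite mulr_ge0 // subr_ge0 softpos_convex.
    have s4 : - q x <= softpos1 e (theta x) * M theta x.
      have := Mq x; have := q0 x; move: s0 s1; move: (softpos1 e _) (M theta x) (q x).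
      by move=> a b d; nra.
    by rewrite -[leLHS]addr0 lerD // -[leLHS]addr0 lerD.
  have [C1 C2 e1] := integral_Mop_sym oU CH sj.
  have h1 : - (2^-1 * integral_rV q) <= integral_rV (fun x => M H x * j x).
    rewrite e1 -mulNr -integral_rVZ //; apply: le_integral_rV => // [|x].
      by have := CcDZ (- 2^-1) Cq (Cc0 R N); congr compactly_continuous;
        apply/funext => x; rewrite addr0.
    have [Ux|nUx] := pselect (U x).
      have /andP[h0 hh] := H01 x Ux; have := Mj x; have := q0 x.
      by move: (M j x) (q x) (H x) h0 hh => a b d; nra.
    have nK : ~ K x by move=> /KU.
    have oK : open (~` K) by apply: closed_openC; exact: compact_closed_rV.
    have -> : M j x = 0.
      have j0 y : ~ K y -> j y = 0 by move=> Ky; rewrite /j th0 // softpos0.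
      have dj i : forall y, (~` K) y -> partial i j y = 0.
        by move=> y Ky; rewrite (@partial_eq _ _ (~` K) _ (fun=> 0)) // ?partial_cst.
      rewrite /Mop j0 // mulr0 subr0 /divform big1 // => i _; rewrite big1 // => l _.
      rewrite (@partial_eq _ _ (~` K) _ (fun=> 0)) // ?partial_cst // => y Ky.
      by rewrite dj // mulr0.
    by rewrite mulr0 mulNr oppr_le0 mulr_ge0.
  pose G x := 1 * (M H x * j x) + c x * V x * theta x.
  have tcV : test_function U (fun x => c x * V x * theta x).
    by apply: test_mulT => //; apply: smoothM => //.
  have CG : Cc G by apply: CcDZ => //; exact: test_Cc tcV.
  have Gr : supp_in r G.
    move=> x rx; have nK : ~ K x by move=> /Kr; rewrite leNgt rx.
    by rewrite /G /j th0 // softpos0 // !mulr0 addr0.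
  have Ge : integral_rV G <= e * B * C.
    apply: bnd => //; [by case: CG|by rewrite mulr_ge0 // ltW|move=> x].
    have [Kx|nK] := pselect (K x); last first.
      by rewrite /G /j th0 // softpos0 // !mulr0 addr0 mulr_ge0 // ltW.
    have Ux := KU _ Kx; have b1 := HB x Kx; have b2 := MH x Ux; have b3 := cV0 x.
    have [p1 p2] := softpos_ge e0 (theta x).
    rewrite /G /j mul1r; move: (softpos e (theta x)) p1 p2 => p p1 p2.
    move: (M H x) (c x * V x) b1 b2 b3 => a b b1 b2 b3.
    (* theta b <= (p + e) (- a) since p + e >= max theta 0 and - a >= b >= 0 *)
    have : b * theta x <= (p + e) * (- a).
      have [t0|t0] := leP 0 (theta x); nra.
    nra.
  move: Ge; rewrite /G integral_rVDZ //; last exact: test_Cc tcV.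
  by rewrite mul1r mulrA; lra.
apply/ler_addgt0Pr => e e0.
have BC : 0 < B * C + 1 by rewrite ltr_wpDl // mulr_ge0 // ltW.
have := key (e / (B * C + 1)) (divr_gt0 e0 BC).
move=> h; apply: le_trans h _; rewrite lerD2l mulrAC ler_pdivrMr //.
by rewrite ler_pM2l // lerDl.
Qed.

Lemma Mop_cst (k : R) x : M (fun=> k) x = - (c x * V x * k).
Proof.
rewrite /Mop /divform big1 ?sub0r // => i _; rewrite big1 // => j _.
rewrite partial_cst (_ : (fun y => _) = fun=> 0) ?partial_cst //.
by apply/funext => y; rewrite mulr0.
Qed.

Lemma Mop0 x : M (fun=> 0) x = 0.
Proof. by rewrite Mop_cst mulr0 oppr0. Qed.

Lemma test_C2 U phi : test_function U phi -> Ck 2 setT phi.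
Proof. by move=> /test_smooth. Qed.

Lemma Mop_testDZ U (a : R) phi psi x : test_function U phi -> test_function U psi ->
  M (fun y => a * phi y + psi y) x = a * M phi x + M psi x.
Proof.
move=> tp tq; have oT : open (setT : set rV) by exact: openT.
exact: (MopDZ a oT (test_C2 tp) (test_C2 tq) (Logic.I : setT x)).
Qed.

Lemma Mop_testZ U (a : R) phi x : test_function U phi ->
  M (fun y => a * phi y) x = a * M phi x.
Proof.
move=> tp; have := Mop_testDZ a x tp (test0 U); rewrite Mop0 addr0 => <-.
by congr (M _ x); apply/funext => y; rewrite addr0.
Qed.

Lemma Mop_testD U phi psi x : test_function U phi -> test_function U psi ->
  M (fun y => phi y + psi y) x = M phi x + M psi x.
Proof.
move=> tp tq; have := Mop_testDZ 1 x tp tq; rewrite mul1r => <-.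
by congr (M _ x); apply/funext => y; rewrite mul1r.
Qed.

(** By formal symmetry and the fundamental lemma of the calculus of variations. *)
Lemma classical_of_weak U u f : open U -> smooth U u -> smooth U f ->
  (forall zeta, test_function U zeta ->
     integral_rV (fun x => u x * M zeta x) = integral_rV (fun x => f x * zeta x)) ->
  forall x, U x -> M u x = f x.
Proof.
move=> oU su sf H; apply: eq_of_integral => //.
- by move=> x; exact: (Ck_continuous (Ck_Mop oU (su 2))).
- by move=> x; exact: smooth_continuous sf.
move=> phi tp.
by have [_ _ ->] := integral_Mop_sym oU (su 2%N) (test_supported 2 tp); exact: H.
Qed.

(** With k the solution of M k = - c V that vanishes at the boundary in the
    generalized sense, 1 - k solves the homogeneous equation; Kato's estimate
    keeps k at most 1/2, by duality, when the supersolution H is at most 1/2. *)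
Lemma harmonic_of_supersolution U H : open U -> Ck 2 U H ->
  (forall x, U x -> 0 <= H x <= 2^-1) -> (forall x, U x -> M H x <= - (c x * V x)) ->
  exists2 h, smooth U h & forall x, U x -> 2^-1 <= h x /\ M h x = 0.
Proof.
move=> oU CH H01 MH.
have tcV phi : test_function U phi -> test_function U (fun x => c x * V x * phi x).
  by move=> tp; apply: test_mulT => //; apply: smoothM => //; exact: openT.
have IcZ a phi : test_function U phi -> integral_rV (fun x => c x * V x * (a * phi x)) =
    a * integral_rV (fun x => c x * V x * phi x).
  move=> tp; rewrite -integral_rVZ; last exact: test_Cc (tcV _ tp).
  by congr integral_rV; apply/funext => x; ring.
pose S f (s : R) := exists phi q, [/\ test_function U phi, Cc q, (forall x, 0 <= q x),
  (forall x, f x + M phi x <= q x) &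
  integral_rV (fun x => c x * V x * phi x) + 2^-1 * integral_rV q <= s].
have Ic0 : integral_rV (fun x => c x * V x * 0) = 0.
  by rewrite -[RHS](integral_rV0 R N); congr integral_rV; apply/funext => x; rewrite mulr0.
have [] := @dominated_functional R rV (test_function U) S.
- by move=> a f g; exact: testDZ.
- exists (fun=> 0), (fun=> 0); split=> //; [exact: test0|exact: Cc0|..].
    by move=> x; rewrite Mop0 addr0.
  by rewrite Ic0 integral_rV0 mulr0 addr0.
- move=> f g r s [phi [q [tp Cq q0 fq Ir]]] [psi [p [tp' Cp p0 gp Is]]].
  exists (fun x => phi x + psi x), (fun x => 1 * q x + p x); split.
  + exact: testD.
  + exact: CcDZ.
  + by move=> x; rewrite mul1r addr_ge0.
  + by move=> x; rewrite (Mop_testD x tp tp') mul1r addrACA lerD.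
  + rewrite integral_rVDZ // mul1r.
    have -> : integral_rV (fun x => c x * V x * (phi x + psi x)) =
       integral_rV (fun x => c x * V x * phi x) + integral_rV (fun x => c x * V x * psi x).
      have := integral_rVDZ 1 (test_Cc (tcV _ tp)) (test_Cc (tcV _ tp')).
      rewrite mul1r => <-; congr integral_rV; apply/funext => x; ring.
    lra.
- move=> a f r a0 [phi [q [tp Cq q0 fq Ir]]].
  exists (fun x => a * phi x), (fun x => a * q x + 0); split.
  + exact: testZ.
  + by apply: CcDZ => //; exact: Cc0.
  + by move=> x; rewrite addr0 mulr_ge0 // ltW.
  + by move=> x; rewrite (Mop_testZ a x tp) -mulrDr addr0 ler_pM2l.
  + rewrite integral_rVDZ ?integral_rV0 //; last exact: Cc0.
    rewrite (IcZ a phi tp) addr0 mulrCA -mulrDr ler_pM2l //.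
- move=> r [phi [q [tp Cq q0 fq Ir]]].
  have := kato_estimate oU CH H01 MH
    (testZ (-1) tp) Cq q0.
  rewrite (IcZ (-1) phi tp) mulN1r => kato; apply: le_trans Ir; rewrite addrC -lerBlDr sub0r; apply: kato => x.
  by rewrite (Mop_testZ (-1) x tp) mulN1r opprK -[leLHS]add0r.
- move=> f tf; exists (0 + 2^-1 * integral_rV (fun x => `|f x|)).
  exists (fun=> 0), (fun x => `|f x|); split=> //; [exact: test0|exact: Cc_norm (test_Cc tf)|..].
    by move=> x; rewrite Mop0 addr0 ler_norm.
  by rewrite Ic0.
move=> T [Tlin Tdom].
have Tlin' : linear_on U T by move=> a f g; exact: Tlin.
have Tbound f q : test_function U f -> Cc q -> (forall x, 0 <= q x) ->
    (forall x, f x <= q x) -> T f <= 2^-1 * integral_rV q.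
  move=> tf Cq q0 fq; apply: Tdom => //; exists (fun=> 0), q; split=> //; first exact: test0.
    by move=> x; rewrite Mop0 addr0.
  by rewrite Ic0 add0r.
have TN f : test_function U f -> T (fun x => -1 * f x) = - T f.
  by move=> tf; rewrite (linear_onZ (-1) Tlin' tf) mulN1r.
have TM zeta : test_function U zeta ->
    T (M zeta) = integral_rV (fun x => - c x * V x * zeta x).
  have half phi : test_function U phi ->
      T (fun x => -1 * M phi x) <= integral_rV (fun x => c x * V x * phi x).
    move=> tp; apply: Tdom; first exact: testZ (test_Mop tp).
    exists phi, (fun=> 0); split=> //; first exact: Cc0.
      by move=> x; rewrite mulN1r addNr.
    by rewrite integral_rV0 mulr0 addr0.
  move=> tz; have tM := test_Mop tz.
  have e1 : integral_rV (fun x => c x * V x * (-1 * zeta x)) =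
     - integral_rV (fun x => c x * V x * zeta x) by rewrite (IcZ (-1) zeta tz) mulN1r.
  have e2 : integral_rV (fun x => - c x * V x * zeta x) =
     - integral_rV (fun x => c x * V x * zeta x).
    by rewrite -e1; congr integral_rV; apply/funext => x; ring.
  have h1 := half _ tz; have h2 := half _ (testZ (-1) tz).
  have e3 : (fun x => -1 * M (fun y => -1 * zeta y) x) = M zeta.
    by apply/funext => x; rewrite (Mop_testZ (-1) x tz); ring.
  move: h1 h2; rewrite (TN _ tM) e3 e1 e2; lra.
have bnd := order0_of_L1 Tlin' (fun f tf => Tbound f _ tf (Cc_norm (test_Cc tf))
  (fun x => normr_ge0 _) (fun x => ler_norm _)).
have sc : smooth U (fun x => - c x).
  by apply: (smooth_subset (U := setT)) => // k; apply: CkN => //; exact: openT.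
have [k sk Tk] := weak_solution_smooth
  oU Tlin' bnd sc TM.
have khalf x : U x -> k x <= 2^-1.
  apply: (le_of_integral oU) => [y|y _|phi tp p0].
  - exact: smooth_continuous sk.
  - exact: cst_continuous.
  - rewrite -Tk // integral_rVZ; last exact: test_Cc tp.
    by apply: Tbound => //; exact: test_Cc tp.
have Mk : forall x, U x -> M k x = - c x * V x.
  have sr : smooth U (fun x => - c x * V x).
    by apply: smoothM => //; exact: smooth_subset V_smooth.
  apply: (classical_of_weak oU sk sr) => zeta tz.
  by rewrite -TM // Tk //; exact: test_Mop.
exists (fun x => 1 - k x).
  by apply: smoothB => //; exact: smooth_cst.
move=> x Ux; split; first by have := khalf x Ux; lra.
have C1 : Ck 2 U (fun _ : rV => 1 : R) by exact: Ck_cst.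
have := MopDZ (-1) oU (sk 2) C1 Ux.
have -> : (fun y => -1 * k y + 1) = (fun y => 1 - k y) by apply/funext => y; ring.
move=> ->; rewrite Mk //.
by rewrite Mop_cst; ring.
Qed.

(** On a small ball a multiple of the barrier has the properties of the
    supersolution H above. *)
Lemma local_harmonic (x0 : rV) : exists2 r : R, 0 < r &
  exists2 h, smooth [set x | `|x0 - x| < r] h &
    forall x, `|x0 - x| < r -> 2^-1 <= h x /\ M h x = 0.
Proof.
have [i [al [r0 [al0 r00 Hb]]]] := barrier x0.
have ccV : {for x0, continuous (fun x => c x * V x)}.
  have oT : open (setT : set rV) by exact: openT.
  have C := CkM oT (c_smooth 0) (V_smooth 0); exact: (Ck_continuous C).
have /continuous_epsP/(_ 1 ltr01)[d d0 Hd] := ccV.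
pose B := `|c x0 * V x0| + 1; have B0 : 0 < B by rewrite ltr_wpDl.
pose r := Num.min r0 (Num.min d (Num.min 1 (al / (2 * B)))).
have r_gt0 : 0 < r by rewrite !lt_min r00 d0 ltr01 divr_gt0 // mulr_gt0.
have : r <= r by []; rewrite {2}/r !le_min => /and4P[rr0 rd r1 ra].
exists r => //.
pose H x := B / al * parabola x0 i r x.
apply: (@harmonic_of_supersolution _ H).
- exact: open_center_ball.
- apply: CkZ; first exact: open_center_ball.
  by apply: smooth_parabola; exact: open_center_ball.
- move=> x /= xr; have /andP[p0 p1] := parabola_bounds i (ltW xr).
  have Ba : 0 < B / al by rewrite divr_gt0.
  rewrite /H mulr_ge0 // ?(ltW Ba) //=.
  apply: (@le_trans _ _ (B / al * r ^+ 2)); first by rewrite ler_pM2l.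
  apply: (@le_trans _ _ (B / al * r)).
    by rewrite ler_pM2l // expr2 ler_piMl // ltW.
  rewrite mulrAC ler_pdivrMr //; move: ra; rewrite ler_pdivlMr ?mulr_gt0 //; lra.
- move=> x /= xr.
  have oU := @open_center_ball R N x0 r.
  have sp := @smooth_parabola _ x0 i r oU.
  have C0 : Ck 2 [set x | `|x0 - x| < r] (fun _ : rV => 0 : R) by exact: Ck_cst.
  have := MopDZ (B / al) oU (sp 2) C0 (xr : [set x | `|x0 - x| < r] x).
  rewrite Mop0 addr0 (_ : (fun y => _) = H); last by apply/funext => y; rewrite addr0.
  move=> ->; apply: (@le_trans _ _ (B / al * (- al))).
    by rewrite ler_pM2l ?divr_gt0 //; apply: Hb (ltW xr); rewrite r_gt0.
  rewrite mulrN divfK ?gt_eqF // lerN2.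
  have h2 : `|c x0 * V x0 - c x * V x| < 1 by apply: Hd; lra.
  rewrite -[c x * V x](subKr (c x0 * V x0)) (le_trans (ler_norm _)) //.
  by rewrite (le_trans (ler_normB _ _)) // lerD2l; exact: ltW.
Qed.

(** * The positivity set of a supersolution *)

(** Conjugation by a positive solution h removes the zero-order term. *)
Lemma ground_state U h psi x : open U -> Ck 2 U h -> Ck 2 U psi -> U x -> M h x = 0 ->
  h x * M (fun y => h y * psi y) x = divform A (fun y => h y * (h y * V y)) psi x.
Proof.
move=> oU Ch Cpsi Ux Mh; have CV := Ck_V U 1.
have Ch1 := Ck_pred Ch.
rewrite (divform_weight A_smooth oU Ch1 (CkM oU Ch1 CV) Cpsi Ux).
rewrite (divform_weight A_smooth oU Ch1 CV Cpsi Ux).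
rewrite /Mop (divform_mul A_smooth A_sym oU CV Ch Cpsi Ux).
have -> : divform A V h x = c x * V x * h x.
  by apply/eqP; rewrite -subr_eq0 -[X in X == _]/(M h x) Mh.
by move: (divform A V psi x) (carre A h psi x) => p q; ring.
Qed.

Lemma partial_out K f i x : closed K -> (forall y, ~ K y -> f y = 0) -> ~ K x ->
  partial i f x = 0.
Proof.
move=> cK f0 Kx; have oK : open (~` K) by exact: closed_openC.
by rewrite (@partial_eq _ _ (~` K) _ (fun=> 0)) // ?partial_cst.
Qed.

Lemma divform_out K Q f x : closed K -> (forall y, ~ K y -> f y = 0) -> ~ K x ->
  divform A Q f x = 0.
Proof.
move=> cK f0 Kx; rewrite /divform big1 // => i _; rewrite big1 // => j _.
by apply: (partial_out i cK _ Kx) => y Ky; rewrite (partial_out j cK f0 Ky) mulr0.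
Qed.

Lemma carre_out K f g x : closed K -> (forall y, ~ K y -> f y = 0) -> ~ K x ->
  carre A f g x = 0.
Proof.
move=> cK f0 Kx; rewrite carreE big1 // => i _; rewrite big1 // => j _.
by rewrite (partial_out i cK f0 Kx) mulr0 mul0r.
Qed.

Lemma norm_integral_le f : Cc f -> `|integral_rV f| <= integral_rV (fun x => `|f x|).
Proof.
move=> Cf; have CN := Cc_norm Cf; rewrite ler_norml -mulN1r -integral_rVZ //.
apply/andP; split; apply: le_integral_rV => //.
- by have := CcDZ (-1) CN (Cc0 R N); congr Cc; apply/funext => x; rewrite addr0.
- by move=> x; rewrite mulN1r lerNl -normrN ler_norm.
- by move=> x; exact: ler_norm.
Qed.

(** Energy estimate for chi with D chi <= - |grad chi|^2 / d: test functions
    nearly do not see the gradient of chi when d is small. *)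
Lemma concave_energy U W K Q chi eta zeta (d rho b : R) : open U -> open W -> U `<=` W ->
  smooth W Q -> (forall x, W x -> 0 < Q x) -> Ck 2 W chi ->
  (forall x, W x -> Q x * carre A chi chi x <= - d * divform A Q chi x) ->
  compact K -> K `<=` W -> smooth_supported_in K eta ->
  (forall x, 0 <= eta x) -> (forall x, U x -> 1 <= eta x) ->
  test_function U zeta -> 0 < d -> 0 < rho ->
  (forall x, K x -> 0 <= chi x <= b) ->
  2 * `|integral_rV (fun x => chi x * divform A Q zeta x)| <=
  rho^-1 * d * (b * integral_rV (fun x => `|1 * divform A Q eta x|)) +
  rho * integral_rV (fun x => Q x * carre A zeta zeta x).
Proof.
move=> oU oW UW sQ Q0 Cchi Hchi cK KW [se e0] eta0 eta1 tz d0 rho0 chib.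
have clK := compact_closed_rV cK.
have teta : test_function W eta by exists K.
have tzW := test_subset UW tz; have [L [cL LU [sz z0]]] := tz.
have clL := compact_closed_rV cL.
have seta := test_supported 2 teta; have szeta := test_supported 2 tzW.
have CQ := sQ 1%N.
have [CZ IZ] := integral_divform_sym A_smooth A_sym oW CQ Cchi szeta.
have [CE IE] := integral_divform_sym A_smooth A_sym oW CQ Cchi seta.
have ID := integral_divform A_smooth oW CQ Cchi (test_supported 1 teta).
have C1 : Ck 2 W (fun _ : rV => 1 : R) by exact: Ck_cst.
have [C1E _] := integral_divform_sym A_smooth A_sym oW CQ C1 seta.
have CN := Cc_norm C1E.
have CG := Cc_carre A_smooth oW (sQ 0%N) (Ck_pred Cchi) (test_supported 1 tzW).
have Cz1 : Ck 1 W zeta by apply: Ck_subset (test_smooth tz 1).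
have CZZ := Cc_carre A_smooth oW (sQ 0%N) Cz1 (test_supported 1 tzW).
have CDE : Cc (fun x => divform A Q chi x * eta x).
  apply: (Cc_mul oW _ teta) => x; exact: (Ck_continuous (Ck_divform A_smooth oW CQ Cchi)).
have hE : - integral_rV (fun x => divform A Q chi x * eta x) <=
    b * integral_rV (fun x => `|1 * divform A Q eta x|).
  rewrite ID -IE -integral_rVZ // -[leLHS]mulN1r -integral_rVZ //.
  apply: le_integral_rV.
  - by have := CcDZ (-1) CE (Cc0 R N); congr Cc; apply/funext => x; rewrite addr0.
  - by have := CcDZ b CN (Cc0 R N); congr Cc; apply/funext => x; rewrite addr0.
  move=> x; rewrite mul1r mulN1r; have [Kx|Kx] := pselect (K x).
    have /andP[h0 h1] := chib _ Kx; apply: le_trans (ler_norm _) _.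
    by rewrite normrN normrM (ger0_norm h0) ler_wpM2r.
  by rewrite (divform_out Q clK e0 Kx) mulr0 normr0 mulr0 oppr0.
rewrite IZ normrN; apply: (@le_trans _ _ (2 * integral_rV (fun x => `|Q x * carre A zeta chi x|))).
  by rewrite ler_pM2l // norm_integral_le.
pose Y x := rho * (Q x * carre A zeta zeta x) + 0.
have CY : Cc Y by apply: CcDZ => //; exact: Cc0.
have hI : 2 * integral_rV (fun x => `|Q x * carre A zeta chi x|) <=
    integral_rV (fun x => - (rho^-1 * d) * (divform A Q chi x * eta x) + Y x).
  rewrite -integral_rVZ; last exact: Cc_norm.
  apply: le_integral_rV.
  - have := CcDZ 2 (Cc_norm CG) (Cc0 R N); congr Cc; apply/funext => x; by rewrite addr0.
  - exact: CcDZ.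
  move=> x; rewrite /Y addr0; have [Ux|nUx] := pselect (U x).
    have Wx := UW _ Ux; have q0 := Q0 _ Wx; have := carre_amgm A_sym A_psd chi zeta x rho0.
    rewrite (carreC A_sym zeta chi) normrM (gtr0_norm q0).
    have := Hchi _ Wx; have := carre_ge0 A_psd chi x; have := eta1 _ Ux.
    have r0 : 0 < rho^-1 by rewrite invr_gt0.
    move: `|carre A chi zeta x| (carre A chi chi x) (carre A zeta zeta x) => p a e.
    move: (divform A Q chi x) (eta x) (Q x) q0 => D et q q0 et1 a0 Ha Hp.
    have h1 : - d * D <= - d * D * et.
      have : 0 <= - d * D by apply: le_trans Ha; rewrite mulr_ge0 // ltW.
      by move=> h; rewrite ler_peMr.
    have h2 : rho^-1 * (q * a) <= rho^-1 * (- d * D * et).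
      by rewrite ler_pM2l // (le_trans Ha).
    have h3 : q * (2 * p) <= q * (rho^-1 * a + rho * e) by rewrite ler_pM2l.
    have -> : 2 * (q * p) = q * (2 * p) by ring.
    apply: le_trans h3 _.
    have -> : q * (rho^-1 * a + rho * e) = rho^-1 * (q * a) + rho * (q * e) by ring.
    rewrite lerD2r; apply: le_trans h2 _.
    by rewrite le_eqVlt; apply/orP; left; apply/eqP; ring.
  have Lx : ~ L x by move=> /LU.
  rewrite !(carre_out _ clL z0 Lx) !mulr0 normr0 mulr0 addr0.
  have [Wx|nWx] := pselect (W x).
    have : 0 <= - d * divform A Q chi x.
      by apply: le_trans (Hchi _ Wx); rewrite mulr_ge0 ?(ltW (Q0 _ Wx)) // carre_ge0.
    have r0 : 0 < rho^-1 by rewrite invr_gt0.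
    have -> : - (rho^-1 * d) * (divform A Q chi x * eta x) =
      rho^-1 * (- d * divform A Q chi x * eta x) by ring.
    by move=> h; rewrite mulr_ge0 ?(ltW r0) // mulr_ge0.
  by rewrite e0 ?mulr0 // => /KW.
apply: le_trans hI _; rewrite integral_rVDZ // /Y integral_rVDZ //; last exact: Cc0.
rewrite integral_rV0 addr0 lerD2r mulNr -mulrN ler_wpM2l //.
by rewrite mulr_ge0 // ?invr_ge0 ltW.
Qed.

Lemma Mop_eq U f g x : open U -> U x -> (forall y, U y -> f y = g y) -> M f x = M g x.
Proof.
move=> oU Ux e; have := divform_eq A oU Ux (fun y _ => erefl (V y)) e.
by rewrite /Mop (e x Ux) => ->.
Qed.

(** The cutoffs chi = logcut d (w / h) satisfy D chi <= - |grad chi|^2 / d for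
    the operator D obtained by conjugation with h, so concave_energy makes
    h chi a solution in the limit where d tends to 0.  This limit is h where
    w > 0 and 0 where w = 0.  Since the integrals against a test function
    may fail to converge, T is a linear functional below their upper limits. *)
Lemma log_limit U W h w (b : R) : open U -> open W -> U `<=` W ->
  smooth W h -> (forall x, W x -> 0 < h x /\ M h x = 0) ->
  Ck 2 W w -> (forall x, W x -> 0 <= w x) -> (forall x, W x -> M w x <= 0) ->
  (exists K eta, [/\ compact K, K `<=` W, smooth_supported_in K eta,
     (forall x, 0 <= eta x /\ (U x -> 1 <= eta x)) &
     forall x, K x -> w x / h x <= b /\ h x <= b]) ->
  exists T : functional R N, [/\ linear_on U T,
    (forall f, test_function U f -> T f <= b * (1 + ln (1 + b)) * integral_rV (fun x => `|f x|)),
    (forall zeta, test_function U zeta -> T (M zeta) = 0),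
    (forall (m : R) f, 0 < m -> test_function (U `&` [set x | m < w x / h x]) f ->
       T f = integral_rV (fun x => h x * f x)) &
    (forall f, (forall x, f x != 0 -> w x = 0) -> test_function U f -> T f = 0)].
Proof.
move=> oU oW UW sh hW Cw w0 Mw [K [eta [cK KW seta etaP Kb]]].
have eta0 x : 0 <= eta x by have [] := etaP x.
have eta1 x : U x -> 1 <= eta x by have [] := etaP x.
have h0 x : W x -> 0 < h x by move=> /hW[].
have hn0 x : W x -> h x != 0 by move=> /h0; exact: lt0r_neq0.
have Mh x : W x -> M h x = 0 by move=> /hW[].
pose v x := w x / h x.
have sV1 : smooth W (fun x => (h x)^-1) by exact: smooth_inv.
have Cv : Ck 2 W v by exact: (CkM oW Cw (sV1 2%N)).
have v0 x : W x -> 0 <= v x by move=> Wx; rewrite divr_ge0 ?w0 // ltW // h0.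
pose Q x := h x * (h x * V x).
have sVW : smooth W V by exact: smooth_subset V_smooth.
have sQ : smooth W Q by exact: (smoothM oW sh (smoothM oW sh sVW)).
have Q0 x : W x -> 0 < Q x by move=> /h0 hx; rewrite mulr_gt0 // mulr_gt0.
have CQ := sQ 1%N.
have hv x : W x -> h x * v x = w x by move=> Wx; rewrite /v mulrC divfK // hn0.
have Dv x : W x -> divform A Q v x <= 0.
  move=> Wx; rewrite -(ground_state oW (sh 2%N) Cv Wx (Mh x Wx)).
  have -> : M (fun y => h y * v y) x = M w x.
    exact: (Mop_eq oW Wx hv).
  by rewrite pmulr_rle0 ?h0 // Mw.
have UK x : U x -> K x.
  move=> Ux; apply: contrapT => nK; have := eta1 _ Ux.
  by case: seta => _ ->//; rewrite ler10.
pose chi (d : R) x := logcut d (v x).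
have vdom d x : W x -> logdom d (v x) by move=> Wx; apply: logdom_ge0; exact: v0.
have dl (d : R) : 0 < d -> forall t : R, logdom d t -> is_derive t 1 (logcut d) (logcut1 d t).
  by move=> d0 t; exact: is_derive_logcut.
have dl1 (d : R) : 0 < d -> forall t : R, logdom d t -> is_derive t 1 (logcut1 d) (logcut2 d t).
  by move=> d0 t; exact: is_derive_logcut1.
have cl2 (d : R) : 0 < d -> forall t : R, logdom d t -> {for t, continuous (logcut2 d)}.
  by move=> d0 t; exact: continuous_logcut2.
have Cchi (d : R) : 0 < d -> Ck 2 W (chi d).
  by move=> d0; exact: (Ck_chain2 oW (@open_logdom R d) (vdom d) (dl d d0) (dl1 d d0) (cl2 d d0) Cv).
have Dchi (d : R) x : 0 < d -> W x ->
    Q x * carre A (chi d) (chi d) x <= - d * divform A Q (chi d) x.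
  move=> d0 Wx; have Cv1 := Ck_pred Cv.
  rewrite (divform_chain A_smooth oW (@open_logdom R d) (vdom d) (dl d d0) (dl1 d d0) (cl2 d d0) CQ Cv Wx).
  rewrite (carre_chain A (vdom d) (dl d d0) _ Cv1 Wx) (carreC A_sym) (carre_chain A (vdom d) (dl d d0) _ Cv1 Wx).
  have l1 : 0 <= logcut1 d (v x).
    rewrite mulr_ge0 ?(ltW d0) // divr_ge0 ?expR_ge0 // ltW //; exact: vdom.
  rewrite /logcut2; have := Dv x Wx; move: (logcut1 d (v x)) l1 (carre A v v x) (divform A Q v x).
  move=> p p0 a D D0.
  have -> : - d * (p * D + - (d^-1 * p ^+ 2) * (Q x * a)) =
      d * p * (- D) + (d * d^-1) * (Q x * (p * (p * a))) by ring.
  by rewrite mulfV ?gt_eqF // mul1r lerDr mulr_ge0 ?oppr_ge0 // mulr_ge0 // ltW.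
pose L := ln (1 + b).
have b0 x : K x -> 0 <= b by move=> Kx; have [_ hb] := Kb _ Kx; apply: le_trans hb; apply/ltW/h0/KW.
have L0 x : K x -> 0 <= L by move=> /b0 b0'; rewrite ln_ge0 // lerDl.
have chib (d : R) x : 0 < d <= 1 -> K x -> 0 <= chi d x <= 1 + L.
  move=> /andP[d0 d1] Kx; have Wx := KW _ Kx; rewrite logcut_ge0 ?v0 //=.
  apply: (@le_trans _ _ (1 + d * L)).
    by apply: logcut_le => //; rewrite v0 //=; have [] := Kb _ Kx.
  by rewrite lerD2l ler_piMl // (L0 x).
pose a (d : R) f := integral_rV (fun x => h x * chi d x * f x).
have Chx (d : R) : 0 < d -> forall x, U x -> {for x, continuous (fun x => h x * chi d x)}.
  move=> d0 x /UW Wx; have C := CkM oW (sh 0%N) (Ck_pred (Ck_pred (Cchi d d0))).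
  exact: (Ck_continuous C).
have Ca (d : R) f : 0 < d -> test_function U f -> Cc (fun x => h x * chi d x * f x).
  by move=> d0 tf; exact: Cc_mul oU (Chx d d0) tf.
have aDZ (d al : R) f g : 0 < d -> test_function U f -> test_function U g ->
    a d (fun x => al * f x + g x) = al * a d f + a d g.
  move=> d0 tf tg; rewrite /a -integral_rVDZ; [|exact: Ca|exact: Ca].
  by congr integral_rV; apply/funext => x; ring.
have abound (d : R) f : 0 < d <= 1 -> test_function U f ->
    a d f <= b * (1 + L) * integral_rV (fun x => `|f x|).
  move=> d01 tf; have /andP[d0 _] := d01; have CN := Cc_norm (test_Cc tf).
  rewrite -integral_rVZ //; apply: le_integral_rV; first exact: Ca.
    by have := CcDZ (b * (1 + L)) CN (Cc0 R N); congr Cc; apply/funext => x; rewrite addr0.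
  move=> x; have [Ux|nUx] := pselect (U x); last first.
    by rewrite (test_out tf nUx) normr0 !mulr0.
  have Kx := UK _ Ux; have [_ hb] := Kb _ Kx; have /andP[c0 c1] := chib d x d01 Kx.
  apply: le_trans (ler_norm _) _; rewrite normrM (normrM (h x)) ler_wpM2r // (ger0_norm c0).
  have hx := h0 _ (KW _ Kx); rewrite (gtr0_norm hx).
  by apply: ler_pM => //; exact: ltW.
(* S f s says that the upper limit of a d f, as d tends to 0, is at most s *)
pose S f (s : R) := forall e : R, 0 < e -> exists2 d0 : R, 0 < d0 &
  forall d, 0 < d < d0 -> a d f <= s + e.
have [] := @dominated_functional R rV (test_function U) (fun f s => test_function U f /\ S f s).
- by move=> al f g; exact: testDZ.
- split; first exact: test0.
  move=> e e0; exists 1 => // d _; rewrite /a add0r (_ : (fun x => _) = fun=> 0) ?integral_rV0 ?ltW //.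
  by apply/funext => x; rewrite mulr0.
- move=> f g r s [tf Sf] [tg Sg]; split; first exact: testD.
  move=> e e0; have e20 : 0 < e / 2 by rewrite divr_gt0.
  have [d1 d10 H1] := Sf _ e20; have [d2 d20 H2] := Sg _ e20.
  exists (Num.min d1 d2); first by rewrite lt_min d10.
  move=> d; rewrite lt_min => /and3P[d0 dd1 dd2].
  have := aDZ d 1 f g d0 tf tg; rewrite mul1r.
  have -> : (fun x => 1 * f x + g x) = (fun x => f x + g x) by apply/funext => x; rewrite mul1r.
  move=> ->; have := H1 d; have := H2 d; rewrite d0 dd1 dd2 => /(_ isT) h2 /(_ isT) h1; lra.
- move=> al f r al0 [tf Sf]; split; first exact: testZ.
  move=> e e0; have ea : 0 < e / al by rewrite divr_gt0.
  have [d1 d10 H1] := Sf _ ea; exists d1 => // d dd; have /andP[d0 _] := dd.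
  have := aDZ d al f _ d0 tf (test0 U).
  have -> : a d (fun=> 0) = 0.
    by rewrite /a (_ : (fun x => _) = fun=> 0) ?integral_rV0 //; apply/funext => x; rewrite mulr0.
  have -> : (fun x => al * f x + 0) = (fun x => al * f x) by apply/funext => x; rewrite addr0.
  rewrite addr0 => ->; have -> : al * r + e = al * (r + e / al) by field; rewrite gt_eqF.
  by rewrite ler_pM2l // H1.
- move=> r [_ Sr]; rewrite leNgt; apply/negP => r0.
  have r20 : 0 < - r / 2 by lra.
  have [d1 d10 H1] := Sr _ r20; have d1d : 0 < d1 / 2 < d1 by lra.
  have := H1 _ d1d; have -> : a (d1 / 2) (fun=> 0) = 0.
    by rewrite /a (_ : (fun x => _) = fun=> 0) ?integral_rV0 //; apply/funext => x; rewrite mulr0.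
  by lra.
- move=> f tf; exists (b * (1 + L) * integral_rV (fun x => `|f x|)); split=> // e e0.
  exists 1 => // d /andP[d0 d1]; apply: le_trans (abound d f _ tf) _; last by rewrite lerDl ltW.
  by rewrite d0 ltW.
move=> T [Tlin Tdom]; exists T.
have Tlin' : linear_on U T by move=> al f g; exact: Tlin.
have Tdom' f s : test_function U f -> S f s -> T f <= s by move=> tf Sf; exact: Tdom.
(* T is a generalized limit of the functionals a d *)
have Tlim f (l : R) : test_function U f -> (forall e : R, 0 < e -> exists2 d0 : R, 0 < d0 &
    forall d, 0 < d < d0 -> `|a d f - l| <= e) -> T f = l.
  move=> tf H; apply/eqP; rewrite eq_le; apply/andP; split.
    apply: Tdom' => // e e0; have [d0 d00 Hd] := H e e0; exists d0 => // d dd.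
    by have := Hd d dd; rewrite ler_norml => /andP[_]; lra.
  rewrite -lerN2 -mulN1r -(linear_onZ (-1) Tlin' tf); apply: Tdom'; first exact: testZ.
  move=> e e0; have [d0 d00 Hd] := H e e0; exists d0 => // d dd; have /andP[dp _] := dd.
  have := aDZ d (-1) f _ dp tf (test0 U).
  have -> : a d (fun=> 0) = 0.
    by rewrite /a (_ : (fun x => _) = fun=> 0) ?integral_rV0 //; apply/funext => x; rewrite mulr0.
  have -> : (fun x => -1 * f x + 0) = (fun x => -1 * f x) by apply/funext => x; rewrite addr0.
  by rewrite addr0 mulN1r => ->; have := Hd d dd; rewrite ler_norml => /andP[+ _]; lra.
split=> //.
- move=> f tf; apply: Tdom' => // e e0; exists 1 => // d /andP[d0 d1].
  apply: le_trans (abound d f _ tf) _; last by rewrite lerDl ltW.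
  by rewrite d0 ltW.
- move=> xi tx; have tM := test_Mop tx.
  pose zeta x := (h x)^-1 * xi x.
  have tz : test_function U zeta by apply: test_mul => //; exact: smooth_subset sV1.
  have CzW : Ck 2 W zeta by apply: Ck_subset (test_smooth tz 2).
  have aM (d : R) : a d (M xi) = integral_rV (fun x => chi d x * divform A Q zeta x).
    congr integral_rV; apply/funext => x; have [Wx|nWx] := pselect (W x).
      rewrite -(ground_state oW (sh 2%N) CzW Wx (Mh x Wx)).
      have -> : M (fun y => h y * zeta y) x = M xi x.
        have e y : W y -> h y * zeta y = xi y by move=> Wy; rewrite /zeta mulVKf // hn0.
        exact: (Mop_eq oW Wx e).
      by rewrite mulrA; congr (_ * _); rewrite mulrC.
    have nUx : ~ U x by move=> /UW.
    have [L' [cL LU [sz z0]]] := tz.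
    rewrite (divform_out Q (compact_closed_rV cL) z0) ?mulr0; last by move=> /LU.
    by rewrite (test_out tM nUx) mulr0.
  apply: (Tlim _ _ tM) => e e0.
  pose C1 := (1 + L) * integral_rV (fun x => `|1 * divform A Q eta x|).
  pose C2 := integral_rV (fun x => Q x * carre A zeta zeta x).
  pose rho := e / (`|C2| + 1).
  have rho0 : 0 < rho by rewrite divr_gt0 // ltr_wpDl.
  pose d1 := e * rho / (`|C1| + 1).
  have d10 : 0 < d1 by rewrite divr_gt0 ?mulr_gt0 // ltr_wpDl.
  exists (Num.min 1 d1); first by rewrite lt_min ltr01.
  move=> d; rewrite lt_min => /and3P[d0 dd1 dd2]; rewrite subr0 aM.
  have db : forall x, K x -> 0 <= chi d x <= 1 + L by move=> x; apply: chib; rewrite d0 ltW.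
  have := concave_energy oU oW UW sQ Q0 (Cchi d d0) (fun x => Dchi d x d0)
    cK KW seta eta0 eta1 tz d0 rho0 db.
  rewrite -/C1 -/C2 => H.
  have h1 : rho^-1 * d * C1 <= e.
    apply: (@le_trans _ _ (rho^-1 * d * (`|C1| + 1))).
      rewrite ler_wpM2l ?mulr_ge0 ?invr_ge0 ?(ltW rho0) ?(ltW d0) //.
      by have := ler_norm C1; lra.
    move: (ltW dd2); rewrite /d1 ler_pdivlMr; last by rewrite ltr_wpDl.
    by rewrite -mulrA ler_pdivrMl // mulrC [rho * e]mulrC.
  have h2 : rho * C2 <= e.
    apply: (@le_trans _ _ (rho * (`|C2| + 1))).
      by rewrite ler_wpM2l ?(ltW rho0) //; have := ler_norm C2; lra.
    by rewrite /rho divfK // gt_eqF // ltr_wpDl.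
  by move: H h1 h2; move: `|_| (rho^-1 * d * C1) (rho * C2) => p q r; lra.
- move=> m f m0 tf.
  have sub : U `&` [set x | m < w x / h x] `<=` U by move=> x [].
  have tfU := test_subset sub tf.
  apply: (Tlim _ _ tfU) => e e0.
  pose I := integral_rV (fun x => `|f x|); have I0 : 0 <= I by apply: integral_rV_ge0.
  pose Lm := `|ln m| + `|L|.
  pose C := `|b| * Lm * I + 1.
  have Lm0 : 0 <= Lm by rewrite addr_ge0.
  have C0 : 0 < C by rewrite ltr_wpDl // mulr_ge0 // mulr_ge0.
  exists (e / C); first by rewrite divr_gt0.
  move=> d /andP[d0 de].
  have Chf : Cc (fun x => h x * f x).
    by apply: (Cc_mul oU _ tfU) => x /UW; exact: smooth_continuous sh.
  have -> : a d f - integral_rV (fun x => h x * f x) =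
      integral_rV (fun x => -1 * (h x * f x) + h x * chi d x * f x).
    by rewrite integral_rVDZ //; [rewrite mulN1r addrC|exact: Ca].
  have CD := CcDZ (-1) Chf (Ca d f d0 tfU).
  apply: le_trans (norm_integral_le CD) _.
  apply: (@le_trans _ _ (d * (`|b| * Lm) * I)).
    rewrite -integral_rVZ; last exact: Cc_norm (test_Cc tfU).
    apply: le_integral_rV; first exact: Cc_norm.
      have := CcDZ (d * (`|b| * Lm)) (Cc_norm (test_Cc tfU)) (Cc0 R N).
      by congr Cc; apply/funext => x; rewrite addr0.
    move=> x; have [[Ux mx]|nx] := pselect ((U `&` [set x | m < w x / h x]) x); last first.
      by rewrite (test_out tf nx) !mulr0 addr0 !normr0 mulr0.
    have Kx := UK _ Ux; have [vb hb] := Kb _ Kx; have hx := h0 _ (UW _ Ux).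
    have -> : -1 * (h x * f x) + h x * chi d x * f x = h x * (chi d x - 1) * f x by ring.
    rewrite normrM (normrM (h x)) ler_wpM2r // (gtr0_norm hx) mulrCA; apply: ler_pM => //.
    - exact: ltW.
    - by apply: le_trans hb _; exact: ler_norm.
    have c1 : 1 + d * ln m <= chi d x by apply: logcut_ge => //; rewrite m0 ltW.
    have c2 : chi d x <= 1 + d * L by apply: (logcut_le d0); rewrite (v0 _ (UW _ Ux)) /=.
    have n1 : - (d * Lm) <= d * ln m.
      rewrite -mulrN ler_wpM2l ?(ltW d0) // /Lm; have := ler_norm (- ln m).
      by rewrite normrN; have := normr_ge0 L; lra.
    have n2 : d * L <= d * Lm.
      by rewrite ler_wpM2l ?(ltW d0) // /Lm; have := ler_norm L; have := normr_ge0 (ln m); lra.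
    by rewrite ler_norml; apply/andP; split; lra.
  have -> : d * (`|b| * Lm) * I = d * (C - 1) by rewrite /C; ring.
  have : d * C <= e by rewrite -ler_pdivlMr // ltW.
  have : 0 <= d * 1 by rewrite mulr1 ltW.
  by rewrite mulrBr; lra.
- move=> f fw tf; apply: (Tlim _ _ tf) => e e0; exists 1 => // d /andP[d0 _].
  rewrite subr0 /a (_ : (fun x => _) = fun=> 0) ?integral_rV0 ?normr0 ?ltW //.
  apply/funext => x; have [->|fx] := eqVneq (f x) 0; first by rewrite mulr0.
  by rewrite /chi /v (fw _ fx) mul0r logcut0 mulr0 mul0r.
Qed.

(** By hypoellipticity the functional of log_limit has a smooth density t near y.
    It equals h >= 1/2 where w > 0, hence is positive at y if y belongs to the
    closure of that set; it then stays positive near y, whereas it vanishes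
    outside the closure. *)
Lemma positivity_dichotomy_local W w y : open W -> Ck 2 W w -> (forall x, W x -> 0 <= w x) ->
  (forall x, W x -> M w x <= 0) -> W y ->
  (forall x, W x -> ~ closure [set z | 0 < w z] x -> w x = 0) /\
  (closure [set z | 0 < w z] y ->
    exists2 r : R, 0 < r & forall x, `|y - x| < r -> closure [set z | W z /\ 0 < w z] x).
Proof.
move=> oW Cw w0 Mw Wy; split.
  move=> x Wx nx; apply/eqP; rewrite eq_le w0 // andbT leNgt; apply/negP => wx.
  by apply: nx; exact: subset_closure.
move=> cly.
have [r1 r10 [h sh hP]] := local_harmonic y.
have [r2 r20 rW] := open_ballP oW Wy.
pose r := Num.min r1 r2; have r0 : 0 < r by rewrite lt_min r10.
pose W' := [set x | `|y - x| < r].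
have oW' : open W' by exact: open_center_ball.
have W'W : W' `<=` W by move=> x; rewrite /W' /= lt_min => /andP[_]; exact: rW.
have W'h : W' `<=` [set x | `|y - x| < r1] by move=> x; rewrite /W' /= lt_min => /andP[].
have W'y : W' y by rewrite /W' /= subrr normr0.
have sh' : smooth W' h by exact: smooth_subset sh.
have hW x : W' x -> 2^-1 <= h x /\ M h x = 0 by move=> /W'h; exact: hP.
have h0 x : W' x -> 0 < h x by move=> /hW[h2 _]; apply: lt_le_trans h2; rewrite invr_gt0.
have [phi [tphi phi0 phiy]] := test_bump oW' W'y.
have [K [cK KW [sphi phiK]]] := tphi.
pose eta x := 2 / phi y * phi x.
have Kc f : (forall x, W' x -> {for x, continuous f}) -> exists b, forall x, K x -> f x <= b.
  by move=> cf; apply: (compact_upper_bound cK) => x /KW; exact: cf.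
have cw x : W' x -> {for x, continuous w} by move=> /W'W Wx; exact: (Ck_continuous Cw).
have chc x : W' x -> {for x, continuous h} by exact: smooth_continuous sh'.
have cwh x : W' x -> {for x, continuous (fun x => w x / h x)}.
  move=> Wx; apply: continuousM; first exact: cw.
  by apply: continuousV; [rewrite gt_eqF // h0|exact: chc].
have [b1 Hb1] := Kc _ cwh; have [b2 Hb2] := Kc _ chc.
pose U := W' `&` [set x | 1 < eta x].
have seta : smooth setT eta.
  by apply: (smoothM (@openT _) _ sphi); exact: smooth_cst.
have oU : open U.
  by apply: open_superlevel => // x _; exact: (smooth_continuous seta).
have UW' : U `<=` W' by move=> x [].
have Uy : U y.
  by split=> //=; rewrite /eta divfK ?gt_eqF // ltr1n.
have [T [Tlin Tb TM Tpos T0]] : exists T : functional R N, [/\ linear_on U T,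
    (forall f, test_function U f -> T f <= Num.max b1 b2 * (1 + ln (1 + Num.max b1 b2)) * integral_rV (fun x => `|f x|)),
    (forall zeta, test_function U zeta -> T (M zeta) = 0),
    (forall (m : R) f, 0 < m -> test_function (U `&` [set x | m < w x / h x]) f ->
       T f = integral_rV (fun x => h x * f x)) &
    (forall f, (forall x, f x != 0 -> w x = 0) -> test_function U f -> T f = 0)].
  apply: (log_limit oU oW' UW' sh').
  - by move=> x W'x; split; [exact: h0|have [] := hW _ W'x].
  - exact: Ck_subset Cw.
  - by move=> x /W'W; exact: w0.
  - by move=> x /W'W; exact: Mw.
  exists K, eta; split=> //.
  - by split=> // x /phiK; rewrite /eta => ->; rewrite mulr0.
  - move=> x; split; first by rewrite mulr_ge0 // divr_ge0 // ltW.
    by move=> [_ /ltW].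
  - by move=> x Kx; rewrite !le_max Hb1 // Hb2 // orbT.
have [t st tT] : exists2 t, smooth U t & forall phi, test_function U phi ->
    T phi = integral_rV (fun x => t x * phi x).
  apply: (weak_solution_smooth oU Tlin
    (order0_of_L1 Tlin Tb) (smooth_cst (N:=N) U 0)).
  move=> zeta tz; rewrite TM // (_ : (fun x => _) = fun=> 0) ?integral_rV0 //.
  by apply/funext => x; rewrite !mul0r.
have ct x : U x -> {for x, continuous t} by exact: smooth_continuous st.
have th x : U x -> 0 < w x -> t x = h x.
  move=> Ux wx; have hx := h0 _ (UW' _ Ux).
  pose m := w x / h x / 2; have m0 : 0 < m by rewrite !divr_gt0.
  pose Um := U `&` [set x | m < w x / h x].
  have oUm : open Um by apply: open_superlevel => // z /UW'; exact: cwh.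
  apply: (eq_of_integral oUm).
  - by move=> z [Uz _]; exact: ct.
  - by move=> z [/UW' Wz _]; exact: chc.
  - move=> f tf; rewrite -(Tpos m) // -tT //; apply: test_subset tf; exact: subIsetl.
  - by split=> //=; rewrite /m ltr_pdivrMr // ltr_pMr ?ltr1n // divr_gt0.
have ty : 4^-1 < t y.
  rewrite ltNge; apply/negP => ty.
  have e0 : (0 : R) < 4^-1 by rewrite invr_gt0.
  have /continuous_epsP/(_ _ e0)[d d0 Hd] := ct y Uy.
  have oO : open (U `&` [set x | `|y - x| < d]) by apply: openI => //; exact: open_center_ball.
  have Oy : (U `&` [set x | `|y - x| < d]) y by split=> //=; rewrite subrr normr0.
  have [z /= wz [Uz yz]] := closure_meets oO Oy cly.
  have := Hd z yz; rewrite (th z Uz wz) ltr_norml => /andP[Hz _].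
  have [hz _] := hW z (UW' _ Uz).
  by move: Hz hz ty; move: (t y) (h z) => p q; lra.
have oO := open_superlevel (m := 0) oU ct.
have Oy : (U `&` [set x | 0 < t x]) y by split=> //=; apply: lt_trans ty; rewrite invr_gt0.
have [d d0 dO] := open_ballP oO Oy.
exists d => // x /dO[Ux tx]; apply: contrapT => ncl.
have [e e0 He] := not_closureP ncl.
pose O := U `&` [set z | `|x - z| < e].
have oOx : open O by apply: openI => //; exact: open_center_ball.
have Ox : O x by split=> //=; rewrite subrr normr0.
have wO z : O z -> w z = 0.
  move=> [Uz xz]; have Wz := W'W _ (UW' _ Uz).
  apply/eqP; rewrite eq_le w0 // andbT leNgt; apply/negP => wz.
  by apply: (He z xz).
move: tx; rewrite /= (_ : t x = 0) ?ltxx //.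
apply: (eq_of_integral oOx) Ox.
- by move=> z [Uz _]; exact: ct.
- by move=> z _; exact: cst_continuous.
- move=> f tf; have tfU : test_function U f by apply: test_subset tf; exact: subIsetl.
  rewrite -tT // T0 // => [|z fz].
    by rewrite (_ : (fun x => _) = fun=> 0) ?integral_rV0 //; apply/funext => z; rewrite mul0r.
  by apply: wO; apply: contrapT => nO; move: fz; rewrite (test_out tf nO) eqxx.
Qed.

(** The trace on W of the closure of the set where w > 0 is open, by the local
    statement. *)
Lemma positivity_dichotomy W w : open W -> connected W -> Ck 2 W w ->
  (forall x, W x -> 0 <= w x) -> (forall x, W x -> M w x <= 0) ->
  (forall x, W x -> w x = 0) \/ W `<=` closure [set z | W z /\ 0 < w z].
Proof.
move=> oW cW Cw w0 Mw; pose P := [set z | 0 < w z].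
have clP x : W x -> closure P x -> closure [set z | W z /\ 0 < w z] x.
  move=> Wx Px; have [_ /(_ Px)[r r0 H]] := positivity_dichotomy_local oW Cw w0 Mw Wx.
  by apply: H; rewrite subrr normr0.
have [[x0 [Wx0 Px0]]|nP] := pselect (exists x, W x /\ closure P x); last first.
  left=> x Wx; have [H _] := positivity_dichotomy_local oW Cw w0 Mw Wx.
  by apply: H => // Px; apply: nP; exists x.
right=> x Wx; apply: clP => //.
suff e : W `&` closure P = W by have [] : (W `&` closure P) x by rewrite e.
apply: cW; first by exists x0.
- exists (interior (closure P)); first exact: open_interior.
  apply/seteqP; split=> z [Wz Pz]; split=> //; last exact: interior_subset Pz.
  have [_ /(_ Pz)[r r0 H]] := positivity_dichotomy_local oW Cw w0 Mw Wz.
  apply/nbhs_ballP; exists r => // t; rewrite -ball_normE => /H.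
  by apply: closureS => q [].
- by exists (closure P) => //; exact: closed_closure.
Qed.

(** * The functional of a pole *)

(** T f plays the role of the value at x0 of the solution of - M phi = f with zero
    boundary values: it is only required to be at most phi x0 for every
    supersolution phi.  The weak minimum principle says that these
    requirements are consistent, and multiples of the barrier make them finite
    and bound T by the supremum norm. *)
Lemma pole_functional Omega (x0 : rV) : open Omega -> Omega x0 -> exists r : R,
  [/\ 0 < r, (forall x, `|x0 - x| <= r -> Omega x) & exists (T : functional R N) (C : R),
    [/\ linear_on [set x | `|x0 - x| < r] T,
      (forall f phi, test_function [set x | `|x0 - x| < r] f -> Ck 2 Omega phi ->
         (forall x, `|x0 - x| = r -> 0 <= phi x) ->
         (forall x, `|x0 - x| < r -> f x <= - M phi x) -> T f <= phi x0),
      0 <= C &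
      (forall f (m : R), test_function [set x | `|x0 - x| < r] f -> (forall x, `|f x| <= m) ->
         `|T f| <= C * m)]].
Proof.
move=> oO Ox0.
have [i [al [r0 [al0 r00 Hb]]]] := barrier x0.
have [r1 r10 Hr1] := open_ballP oO Ox0.
pose r := Num.min r0 (r1 / 2).
have r_gt0 : 0 < r by rewrite lt_min r00 divr_gt0.
have rr0 : r <= r0 by rewrite ge_min lexx.
have rr1 : r < r1 by rewrite gt_min ltr_pdivrMr // ltr_pMr // ltr1n orbT.
have r0r : 0 < r <= r0 by rewrite r_gt0.
have KO x : `|x0 - x| <= r -> Omega x by move=> xr; apply: Hr1; exact: le_lt_trans xr rr1.
exists r; split=> //.
pose B := [set x | `|x0 - x| < r]; pose K := [set x | `|x0 - x| <= r].
have oB : open B by exact: open_center_ball.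
have BK : B `<=` K by move=> x /ltW.
have BO : B `<=` Omega by move=> x /ltW; exact: KO.
have Cpar : Ck 2 Omega (parabola x0 i r) by exact: (smooth_parabola x0 i r oO).
pose S f (s : R) := exists phi, [/\ Ck 2 Omega phi, (forall x, `|x0 - x| = r -> 0 <= phi x),
  (forall x, B x -> f x <= - M phi x) & phi x0 <= s].
have S0 : S (fun=> 0) 0.
  exists (fun=> 0); split; [exact: Ck_cst|by []| |by []].
  by move=> x _; rewrite (Mop0) oppr0.
have Sbound f m : (forall x, `|f x| <= m) -> S f (m / al * parabola x0 i r x0).
  move=> fm; have m0 : 0 <= m by apply: le_trans (fm x0).
  exists (fun x => m / al * parabola x0 i r x + 0); split.
  - by have := CkD oO (CkZ (m / al) oO Cpar) (Ck_cst 2 Omega 0).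
  - move=> x xr; rewrite addr0 mulr_ge0 // ?divr_ge0 ?(ltW al0) //.
    have xr' : `|x0 - x| <= r by rewrite xr.
    by have /andP[] := parabola_bounds i xr'.
  - move=> x Bx; have Ox := BO x Bx.
    rewrite (MopDZ (m / al) oO Cpar (Ck_cst 2 Omega 0) Ox) (Mop0) addr0.
    apply: le_trans (ler_norm _) _; apply: le_trans (fm x) _.
    have := Hb r x r0r (ltW Bx) => Hbx.
    have ma : 0 <= m / al by rewrite divr_ge0 // ltW.
    have := ler_wpM2l ma Hbx; rewrite mulrN divfK ?gt_eqF // => H.
    by rewrite lerNr.
  - by rewrite addr0.
have [] := @dominated_functional R rV (test_function B) S.
- by move=> al' f g; exact: testDZ.
- exact: S0.
- move=> f g s t [p [Cp p0 fp ps]] [q [Cq q0 gq qt]].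
  exists (fun x => 1 * p x + q x); split.
  + exact: (CkD oO (CkZ 1 oO Cp) Cq).
  + by move=> x xr; rewrite mul1r addr_ge0 ?p0 ?q0.
  + move=> x Bx; rewrite (MopDZ 1 oO Cp Cq (BO x Bx)) mul1r opprD.
    by apply: lerD; [exact: fp|exact: gq].
  + by rewrite mul1r lerD.
- move=> a f s a0 [p [Cp p0 fp ps]].
  exists (fun x => a * p x + 0); split.
  + exact: (CkD oO (CkZ a oO Cp) (Ck_cst 2 Omega 0)).
  + by move=> x xr; rewrite addr0 mulr_ge0 ?p0 // ltW.
  + move=> x Bx.
    rewrite (MopDZ a oO Cp (Ck_cst 2 Omega 0) (BO x Bx)) (Mop0) addr0.
    by rewrite -mulrN ler_pM2l // fp.
  + by rewrite addr0 ler_pM2l.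
- move=> s [p [Cp p0 fp ps]]; apply: le_trans ps.
  have Kx0 : K x0 by rewrite /K /= subrr normr0 ltW.
  have bK x : K x -> 0 <= parabola x0 i r x.
    by move=> Kx; have /andP[] := parabola_bounds i Kx.
  have Mb x : B x -> M (parabola x0 i r) x < 0.
    by move=> Bx; apply: le_lt_trans (Hb r x r0r (ltW Bx)) _; rewrite oppr_lt0.
  have pb x : K x -> ~ B x -> 0 <= p x.
    by move=> Kx nB; apply: p0; apply/eqP; rewrite eq_le Kx /= leNgt; exact/negP.
  have Mp x : B x -> M p x <= 0 by move=> Bx; rewrite -oppr_ge0; exact: fp.
  exact: (weak_minimum_principle oO KO
    (@compact_center_ball R N x0 r) oB BK Cp Cpar bK Mb pb Mp Kx0).
- move=> f tf; have [m _ fm] := Cc_bounded (test_Cc tf).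
  by exists (m / al * parabola x0 i r x0); exact: Sbound.
move=> T [Tlin Tdom]; exists T, (al^-1 * parabola x0 i r x0).
have Tlin' : linear_on B T by move=> a f g; exact: Tlin.
have TS f s : test_function B f -> S f s -> T f <= s by move=> tf Sf; exact: Tdom.
have par0 : 0 <= parabola x0 i r x0.
  have xx : `|x0 - x0| <= r by rewrite subrr normr0 ltW.
  by have /andP[] := parabola_bounds i xx.
split=> //.
- by move=> f phi tf Cphi phi0 fphi; apply: (TS _ _ tf); exists phi; split.
- by rewrite mulr_ge0 // invr_ge0 ltW.
- move=> f m tf fm.
  have E : al^-1 * parabola x0 i r x0 * m = m / al * parabola x0 i r x0.
    by rewrite mulrC mulrA.
  rewrite E ler_norml lerNl; apply/andP; split; last by apply: TS => //; exact: Sbound.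
  rewrite -mulN1r -(linear_onZ (-1) Tlin' tf); apply: TS; first exact: testZ.
  by apply: Sbound => x; rewrite mulN1r normrN.
Qed.

Lemma carre_critical f g x : (forall i, partial i f x = 0) -> carre A f g x = 0.
Proof.
move=> f0; rewrite carreE big1 // => i _; rewrite big1 // => j _.
by rewrite f0 mulr0 mul0r.
Qed.

(** The square of an elliptic coordinate, cut off: it vanishes at x0
    together with its gradient, but M sees its second derivative. *)
Lemma test_with_Mop x0 U : open U -> U x0 -> exists psi,
  [/\ test_function U psi, psi x0 = 0 & M psi x0 != 0].
Proof.
move=> oU Ux0; have [i Ai] := A_diag_gt0 x0.
have [eta [teta _ eta0]] := test_bump oU Ux0.
have oT : open (setT : set rV) by exact: openT.
pose p := parabola x0 i (0 : R).
have sp : smooth setT p by exact: smooth_parabola.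
have px0 : p x0 = 0 by rewrite /p /parabola subrr expr0n subr0.
have tpsi : test_function U (fun x => p x * eta x) by exact: test_mulT.
exists (fun x => p x * eta x); split=> //; first by rewrite px0 mul0r.
have dp k : partial k p x0 = 0.
  pose q x := -1 * p x.
  have Cq : Ck 2 setT q by exact: (CkZ (-1) oT (sp 2%N)).
  have qmin x : setT x -> q x0 <= q x.
    by move=> _; rewrite /q px0 mulr0 mulN1r /p /parabola expr0n sub0r opprK sqr_ge0.
  have [/(_ k) + _] := local_min_test oT Cq (Logic.I : setT x0) qmin.
  rewrite partialZ; last by apply: (smooth_derivable (i := k) sp).
  by move/eqP; rewrite mulN1r oppr_eq0 => /eqP.
have Ceta : Ck 2 setT eta by exact: (test_smooth teta).
rewrite /Mop (divform_mul A_smooth A_sym oT (V_smooth 1) (sp 2%N) Ceta (Logic.I : setT x0)).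
rewrite carre_critical // px0 !mul0r !mulr0 add0r addr0 subr0 divform_parabola //.
rewrite subrr mulr0 mul0r add0r; apply: mulf_neq0; first by rewrite gt_eqF.
by rewrite oppr_eq0 !mulf_neq0 ?gt_eqF // pnatr_eq0.
Qed.

(** Away from the pole T is a weak solution, hence has a smooth density g.  If
    g vanished identically, T would be a multiple of the evaluation at x0; the
    function of test_with_Mop shows that the multiple is 0, while T (M eta) is
    - eta x0, which is nonzero for a bump eta. *)
Lemma green_density x0 (r : R) (T : functional R N) (C : R) : 0 < r ->
  linear_on [set x | `|x0 - x| < r] T -> 0 <= C ->
  (forall f (m : R), test_function [set x | `|x0 - x| < r] f -> (forall x, `|f x| <= m) ->
         `|T f| <= C * m) ->
  (forall f, test_function [set x | `|x0 - x| < r] f -> (forall x, 0 <= f x) -> 0 <= T f) ->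
  (forall f, test_function [set x | `|x0 - x| < r] f -> T (M f) = - f x0) ->
  let U := [set x | `|x0 - x| < r] `&` [set x | x != x0] in
  exists g, [/\ smooth U g, (forall f, test_function U f -> T f = integral_rV (fun x => g x * f x)),
    (forall x, U x -> 0 <= g x), (forall x, U x -> M g x = 0) & ~ (forall x, U x -> g x = 0)].
Proof.
move=> r0 Tlin C0 Tb Tge TM U; pose B := [set x | `|x0 - x| < r].
have oB : open B by exact: open_center_ball.
have Bx0 : B x0 by rewrite /B /= subrr normr0.
have oU : open U.
  apply: openI => //; have -> : [set x | x != x0] = ~` [set x0].
    by apply/seteqP; split => x /eqP.
  by apply: closed_openC; apply: compact_closed_rV; exact: compact_set1.
have UB : U `<=` B by exact: subIsetl.
have TlinU : linear_on U T.
  by move=> a f g tf tg; apply: Tlin; exact: test_subset UB _.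
have TMU zeta : test_function U zeta -> T (M zeta) = 0.
  move=> tz; rewrite TM; last exact: test_subset UB tz.
  by rewrite (test_out tz) ?oppr0 // => -[_]; rewrite /= eqxx.
have int0 (k l : rV -> R) : (forall x, k x * l x = 0) -> integral_rV (fun x => k x * l x) = 0.
  by move=> kl; rewrite (_ : (fun x => _) = fun=> 0) ?integral_rV0 //; exact/funext.
have [g sg gT] : exists2 g, smooth U g & forall phi, test_function U phi ->
    T phi = integral_rV (fun x => g x * phi x).
  apply: (weak_solution_smooth oU TlinU _
    (smooth_cst (N:=N) U 0)).
    move=> K cK KU; exists C => // phi b sphi phib; apply: Tb => //.
    by exists K; split=> //; exact: subset_trans KU UB.
  by move=> zeta tz; rewrite TMU // int0 // => x; rewrite !mul0r.
exists g; split=> //.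
- apply: (le_of_integral oU); first by move=> x _; exact: cst_continuous.
    by move=> x; exact: smooth_continuous sg.
  move=> phi tphi phi0; rewrite -gT // int0 => [|x]; last by rewrite mul0r.
  by apply: Tge => //; exact: test_subset UB tphi.
- apply: (classical_of_weak oU sg (smooth_cst (N:=N) U 0)).
  move=> zeta tz; rewrite -gT; last exact: test_Mop.
  by rewrite TMU // int0 // => x; rewrite mul0r.
- move=> g0.
  have T0 f : test_function U f -> T f = 0.
    move=> tf; rewrite gT // int0 // => x; have [/g0->|nU] := pselect (U x).
      by rewrite mul0r.
    by rewrite (test_out tf nU) mulr0.
  have Tpt := functional_at_point Tlin C0 Tb T0.
  have [psi [tpsi psi0 Mpsi]] := test_with_Mop oB Bx0.
  have [eta [teta _ eta0]] := test_bump oB Bx0.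
  have tMpsi := test_Mop tpsi.
  have tMeta := test_Mop teta.
  pose l := M eta x0 / M psi x0.
  have : T (fun x => - l * M psi x + M eta x) = 0.
    apply: Tpt; first exact: testDZ.
    by rewrite /l mulNr divfK // addNr.
  rewrite Tlin // TM // psi0 oppr0 mulr0 add0r TM // => /eqP.
  by rewrite oppr_eq0 gt_eqF.
Qed.

(** * Vanishing near a zero *)

(** This is t / (1 + t).  It vanishes at 0 and is strictly concave, so that M
    (saturate v) is a sum of three nonpositive terms when v is a nonnegative
    supersolution. *)
Definition saturate (t : R) : R := 1 - (1 + t)^-1 ^+ 1.
Definition saturate1 (t : R) : R := (1 + t)^-1 ^+ 2.
Definition saturate2 (t : R) : R := - 2 * (1 + t)^-1 ^+ 3.
Let Isat : set R := [set t | -1 < t].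

Lemma is_derive_saturate (t : R) : Isat t -> is_derive t 1 saturate (saturate1 t).
Proof.
move=> It; apply: is_derive_eq (is_deriveB (is_derive_cst (1 : R) t (1 : R)) (is_derive_shift_inv 1 It)) _.
by rewrite sub0r mulN1r opprK.
Qed.

Lemma is_derive_saturate1 (t : R) : Isat t -> is_derive t 1 saturate1 (saturate2 t).
Proof. by move=> It; exact: (is_derive_shift_inv 2 It). Qed.

Lemma continuous_saturate2 (t : R) : Isat t -> {for t, continuous saturate2}.
Proof.
move=> It; exact: (is_derive_continuous (is_deriveZ (- 2 : R) (is_derive_shift_inv 3 It))).
Qed.

Lemma Ck_saturate U v : open U -> Ck 2 U v -> (forall x, U x -> 0 <= v x) ->
  Ck 2 U (fun x => saturate (v x)).
Proof.
move=> oU Cv v0; apply: (@Ck_chain2 R N U Isat _ _ _ v oU _ _ is_derive_saturate is_derive_saturate1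
  continuous_saturate2 Cv); first exact: open_gt.
by move=> x /v0; apply: lt_le_trans; rewrite oppr_lt0.
Qed.

Lemma Mop_saturate U v x : open U -> Ck 2 U v -> (forall y, U y -> 0 <= v y) -> U x ->
  M (fun y => saturate (v y)) x = (1 + v x)^-1 ^+ 2 * M v x
    - 2 * (1 + v x)^-1 ^+ 3 * (V x * carre A v v x) - c x * V x * (v x * (1 + v x)^-1) ^+ 2.
Proof.
move=> oU Cv v0 Ux; have UI y : U y -> Isat (v y).
  by move=> /v0; apply: lt_le_trans; rewrite oppr_lt0.
have oI : open Isat by exact: open_gt.
rewrite (Mop_chain oU oI UI is_derive_saturate is_derive_saturate1
  continuous_saturate2 Cv Ux).
have vn : 1 + v x != 0 by rewrite gt_eqF // ltr_pwDl // v0.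
rewrite /saturate /saturate1 /saturate2; move: (M v x) (carre A v v x) => m k.
by field.
Qed.

(** A function of v that vanishes near 0 inherits the equation when M v, the
    energy density of v and c v are all zero. *)
Lemma Mop_flat_shift U v (a : R) x : open U -> Ck 2 U v -> U x -> 0 < a ->
  M v x = 0 -> carre A v v x = 0 -> c x * v x = 0 ->
  M (fun y => flat (v y - a)) x = 0.
Proof.
move=> oU Cv Ux a0 Mv gv cv.
have oI : open (setT : set R) by exact: openT.
have UI y : U y -> (setT : set R) (v y) by [].
pose F1 t := flat_term 2 (t - a).
pose F2 t := - 2%:R * flat_term 3 (t - a) + flat_term 4 (t - a).
have d1 (t : R) : setT t -> is_derive t 1 (fun t => flat (t - a)) (F1 t).
  by move=> _; apply: is_derive_eq (is_derive_flat_shift 0 a t) _; rewrite oppr0 mul0r add0r.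
have d2 (t : R) : setT t -> is_derive t 1 F1 (F2 t).
  by move=> _; exact: is_derive_flat_shift.
have c2 (t : R) : setT t -> {for t, continuous F2}.
  move=> _; apply: (is_derive_continuous (is_deriveD (is_deriveZ (- 2%:R : R) (is_derive_flat_shift 3 a t))
    (is_derive_flat_shift 4 a t))).
rewrite (Mop_chain oU oI UI d1 d2 c2 Cv Ux) Mv gv !mulr0 !add0r.
have [v0|vn] := eqVneq (v x) 0.
  rewrite v0 mul0r sub0r add0r.
  by rewrite flat_eq0 ?oppr0 ?mulr0 // oppr_le0 ltW.
move/eqP: cv; rewrite mulf_eq0 (negbTE vn) orbF => /eqP->.
by rewrite !mul0r.
Qed.

Lemma punctured_approach (x0 : rV) (r : R) (i : 'I_N) : 0 < r ->
  exists x : rV, `|x0 - x| < r /\ x != x0.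
Proof.
move=> r0; have r20 : 0 < r / 2 by rewrite divr_gt0.
exists (x0 + (r / 2) *: delta_mx ord0 i); split.
  rewrite opprD addNKr normrN normrZ (gtr0_norm r20).
  apply: (@le_lt_trans _ _ (r / 2 * 1)); last by rewrite mulr1 ltr_pdivrMr // ltr_pMr // ltr1n.
  by rewrite ler_pM2l // norm_delta_le.
apply/eqP => /rowP/(_ i); rewrite !mxE !eqxx mulr1 => /eqP.
by rewrite -subr_eq0 addrAC subrr add0r gt_eqF.
Qed.

(** Let T be the pole functional at x0 and g its density, which is positive on a
    dense set because the punctured ball is connected.  The supersolution
    L = saturate v vanishes at x0, so T f <= L x0 = 0 whenever
    0 <= f <= - M L; as T f is the integral of g f, this forces M L = 0.  The
    three terms of M L then vanish separately, and flat (v - a) is a solution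
    for every a > 0; it vanishes near x0, so it vanishes on the whole punctured
    ball, that is v <= a. *)
Lemma local_vanishing_ge2 (i j : 'I_N) Omega v x0 : i != j -> open Omega -> Ck 2 Omega v ->
  (forall x, Omega x -> 0 <= v x) -> (forall x, Omega x -> M v x <= 0) ->
  Omega x0 -> v x0 = 0 -> exists2 r : R, 0 < r & forall x, `|x0 - x| < r -> v x = 0.
Proof.
move=> ij oO Cv v0 Mv Ox0 vx0.
have [r [r0 KO [T [C [Tlin TS C0 Tb]]]]] :=
  pole_functional oO Ox0.
pose B := [set x | `|x0 - x| < r].
have BO : B `<=` Omega by move=> x /ltW; exact: KO.
have oB : open B by exact: open_center_ball.
have Bx0 : B x0 by rewrite /B /= subrr normr0.
have Tge f : test_function B f -> (forall x, 0 <= f x) -> 0 <= T f.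
  move=> tf f0; rewrite -oppr_le0 -mulN1r -(linear_onZ (-1) Tlin tf).
  have := TS (fun x => -1 * f x) (fun=> 0) (testZ (-1) tf) (Ck_cst 2 Omega 0).
  apply; first by [].
  by move=> x _; rewrite (Mop0) oppr0 mulN1r oppr_le0.
have out0 f x : test_function B f -> `|x0 - x| = r -> f x = 0.
  by move=> tf xr; apply: (test_out tf); rewrite /B /= xr ltxx.
have TM f : test_function B f -> T (M f) = - f x0.
  move=> tf; have tM := test_Mop tf.
  have tN := testZ (-1) tf.
  have Cf : Ck 2 Omega f by exact: Ck_subset (test_C2 tf).
  have CN : Ck 2 Omega (fun x => -1 * f x) by exact: Ck_subset (test_C2 tN).
  apply/eqP; rewrite eq_le; apply/andP; split.
    rewrite -mulN1r; apply: (TS (M f) (fun x => -1 * f x) tM CN).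
      by move=> x xr; rewrite (out0 f) // mulr0.
    by move=> x _; rewrite (Mop_testZ (-1) x tf) mulN1r opprK.
  rewrite lerNl -mulN1r -(linear_onZ (-1) Tlin tM).
  apply: (TS _ f (testZ (-1) tM) Cf); first by move=> x xr; rewrite (out0 f).
  by move=> x _; rewrite mulN1r.
pose U := B `&` [set x | x != x0].
have UB : U `<=` B by exact: subIsetl.
have UO : U `<=` Omega by move=> x /UB /BO.
have cU : connected U by exact: connected_punctured_ball ij r0.
have [g [sg gT g0 Mg gn]] := green_density
  r0 Tlin C0 Tb Tge TM.
have oU : open U.
  apply: openI => //; have -> : [set x | x != x0] = ~` [set x0].
    by apply/seteqP; split => x /eqP.
  by apply: closed_openC; apply: compact_closed_rV; exact: compact_set1.
have dicho := positivity_dichotomy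
  oU cU.
have dense : U `<=` closure [set z | U z /\ 0 < g z].
  have Mg0 x : U x -> M g x <= 0 by move=> Ux; rewrite (Mg x Ux).
  by have [gz|//] := dicho g (sg 2%N) g0 Mg0; case: gn.
pose L x := saturate (v x).
have CL : Ck 2 Omega L by exact: Ck_saturate.
pose q x := -1 * M L x.
have Cq : Ck 0 Omega q by have CM := Ck_Mop oO CL; exact: (CkZ (-1) oO CM).
have cq x : Omega x -> {for x, continuous q} by exact: Ck_continuous Cq.
have parts x : Omega x -> [/\ 0 <= (1 + v x)^-1 ^+ 2 * - M v x,
    0 <= 2 * (1 + v x)^-1 ^+ 3 * (V x * carre A v v x) &
    0 <= c x * V x * (v x * (1 + v x)^-1) ^+ 2].
  move=> Ox; have s0 : 0 <= (1 + v x)^-1 by rewrite invr_ge0 addr_ge0 // v0.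
  split.
  - by apply: mulr_ge0; [exact: exprn_ge0|rewrite oppr_ge0 Mv].
  - apply: mulr_ge0; first by apply: mulr_ge0 => //; exact: exprn_ge0.
    by apply: mulr_ge0; [exact: ltW|exact: carre_ge0].
  - by apply: mulr_ge0; [apply: mulr_ge0; [exact: c_ge0|exact: ltW]|exact: sqr_ge0].
have qE x : Omega x -> q x = (1 + v x)^-1 ^+ 2 * - M v x +
    2 * (1 + v x)^-1 ^+ 3 * (V x * carre A v v x) + c x * V x * (v x * (1 + v x)^-1) ^+ 2.
  by move=> Ox; rewrite /q (Mop_saturate oO Cv v0 Ox); ring.
have q0 x : Omega x -> 0 <= q x.
  by move=> Ox; rewrite qE //; have [h1 h2 h3] := parts x Ox; rewrite !addr_ge0.
have Lx0 : L x0 = 0 by rewrite /L vx0 /saturate addr0 invr1 expr1n subrr.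
(* otherwise a bump below q, placed where g > 0, would have T f > 0 *)
have qU0 y : U y -> q y = 0.
  move=> Uy; apply/eqP; rewrite eq_le q0 ?andbT; last exact: UO.
  rewrite leNgt; apply/negP => qy.
  have oW := open_superlevel (m := 0) oU (fun x Ux => cq x (UO x Ux)).
  have [z [Uz gz] [_ /= qz]] := closure_meets oW (conj Uy qy) (dense y Uy).
  have oW2 := open_superlevel (m := q z / 2) oU (fun x Ux => cq x (UO x Ux)).
  have oW3 := open_superlevel (m := 0) oU (fun x Ux => smooth_continuous sg Ux).
  have q2 : q z / 2 < q z by rewrite ltr_pdivrMr // ltr_pMr // ltr1n.
  have [phi [tphi phi0 phiz]] := test_bump (openI oW2 oW3) (conj (conj Uz q2) (conj Uz gz)).
  have [m m0 phim] := Cc_bounded (test_Cc tphi).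
  pose k := q z / 2 / (m + 1); have k0 : 0 < k by rewrite !divr_gt0 // ltr_wpDl.
  pose f x := k * phi x.
  have tf : test_function ((U `&` [set x | q z / 2 < q x]) `&` (U `&` [set x | 0 < g x])) f.
    exact: testZ.
  have tfU : test_function U f by apply: test_subset tf => x [[]].
  have tfB : test_function B f := test_subset UB tfU.
  have Tf0 : T f <= 0.
    rewrite -Lx0; apply: (TS f L tfB CL).
      move=> x xr; rewrite /L /saturate expr1 subr_ge0.
      have Ox : Omega x by apply: KO; rewrite xr.
      by rewrite invf_le1 ?lerDl ?v0 // ltr_wpDr ?v0.
    move=> x Bx; rewrite -mulN1r -/(q x).
    have [[[_ /= qx] _]|nx] :=
      pselect (((U `&` [set x | q z / 2 < q x]) `&` (U `&` [set x | 0 < g x])) x); last first.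
      by rewrite (test_out tf nx) q0 //; exact: BO.
    apply: le_trans (ltW qx); rewrite /f /k mulrAC ler_pdivrMr; last by rewrite ltr_wpDl.
    rewrite ler_pM2l ?divr_gt0 //; apply: le_trans (ler_norm _) _.
    by apply: le_trans (phim x) _; rewrite lerDl.
  have cgf : Cc (fun x => g x * f x).
    by apply: (Cc_mul oU _ tfU) => x; exact: smooth_continuous sg.
  have := Tf0; rewrite leNgt gT // => /negP; apply.
  apply: (integral_rV_gt0 (x := z) cgf); last by rewrite mulr_gt0 // mulr_gt0.
  move=> x; have [Ux|nx] := pselect (U x); last by rewrite (test_out tfU nx) mulr0.
  by apply: mulr_ge0; [exact: g0|apply: mulr_ge0; [exact: ltW|exact: phi0]].
have vU x : U x -> [/\ M v x = 0, carre A v v x = 0 & c x * v x = 0].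
  move=> Ux; have Ox := UO x Ux; have [h1 h2 h3] := parts x Ox.
  have := qU0 x Ux; rewrite qE // => /eqP.
  rewrite paddr_eq0 ?addr_ge0 // paddr_eq0 // => /andP[/andP[]].
  have v1 : 0 < 1 + v x by rewrite ltr_pwDl // v0.
  have s0 : (1 + v x)^-1 != 0 by rewrite invr_eq0 gt_eqF.
  have s2 : 2 * (1 + v x)^-1 ^+ 3 != 0 by rewrite mulf_neq0 ?pnatr_eq0 // expf_neq0.
  rewrite mulf_eq0 (negbTE (expf_neq0 2 s0)) /= oppr_eq0 => /eqP->.
  rewrite mulf_eq0 (negbTE s2) /= mulf_eq0 (gt_eqF (V_gt0 x)) /= => /eqP->.
  rewrite mulf_eq0 mulf_eq0 (gt_eqF (V_gt0 x)) orbF sqrf_eq0 mulf_eq0 (negbTE s0) orbF => cv.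
  by split=> //; apply/eqP; rewrite mulf_eq0.
have vle (a : R) : 0 < a -> forall x, U x -> v x <= a.
  move=> a0; pose w x := flat (v x - a).
  have Cw : Ck 2 U w.
    have Cv' := CkB oU (Ck_subset UO Cv) (Ck_cst 2 U a).
    by apply: (@Ck_comp _ _ _ U setT (@flat R) _ oU _ _ Cv') => //; exact: C1k_flat.
  have Mw x : U x -> M w x = 0.
    move=> Ux; have [e1 e2 e3] := vU x Ux.
    exact: (Mop_flat_shift oO Cv (UO x Ux) a0 e1 e2 e3).
  have w0 x : U x -> 0 <= w x by move=> _; exact: flat_ge0.
  have Mw0 x : U x -> M w x <= 0 by move=> Ux; rewrite (Mw x Ux).
  have [wz|wd] := dicho w Cw w0 Mw0.
    move=> x Ux; rewrite leNgt; apply/negP => va; have := wz x Ux; apply/eqP.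
    by rewrite gt_eqF // flat_gt0 // subr_gt0.
  have cv0 := Ck_continuous Cv Ox0.
  have /continuous_epsP/(_ a a0)[d d0 Hd] := cv0.
  have dr : 0 < Num.min d r by rewrite lt_min d0.
  have [y [yd yn]] := punctured_approach x0 i dr.
  move: yd; rewrite lt_min => /andP[yd yr].
  have Uy : U y by split.
  have oO2 : open (U `&` [set z | `|x0 - z| < d]) by apply: openI oU _; exact: open_center_ball.
  have [z [Uz /= wz] [_ /= zd]] := closure_meets oO2 (conj Uy yd) (wd y Uy).
  have vz : a < v z.
    by rewrite ltNge; apply/negP => va; move: wz; rewrite /w flat_eq0 ?ltxx // subr_le0.
  by have := Hd z zd; rewrite vx0 sub0r normrN ltr_norml => /andP[_]; rewrite ltNge (ltW vz).
exists r => // x xr; have [->//|xn] := eqVneq x x0.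
have Ux : U x by split.
apply/eqP; rewrite eq_le v0 ?andbT; last exact: UO.
apply/ler_addgt0Pl => a a0; rewrite addr0; exact: vle.
Qed.

Lemma is_derive_along U f (w x : rV) (t : R) : open U -> Ck 1 U f -> U (t *: w + x) ->
  is_derive t 1 (fun h : R => f (h *: w + x)) (\sum_k w ord0 k * partial k f (t *: w + x)).
Proof.
move=> oU Cf Ut; have [dw ew] := is_derive_direction w oU Cf Ut.
by apply: is_derive_eq (is_derive_line dw) _; rewrite ew.
Qed.

(** In one variable V A v' vanishes at x0, where v is minimal, and has derivative
    at most c V v.  Integrating twice bounds the maximum of v over a ball of
    radius r by a constant times r^2 times itself. *)
Lemma local_vanishing_1 (i : 'I_N) Omega v x0 : (forall k : 'I_N, k = i) -> 0 < A x0 i i ->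
  open Omega -> Ck 2 Omega v ->
  (forall x, Omega x -> 0 <= v x) -> (forall x, Omega x -> M v x <= 0) ->
  Omega x0 -> v x0 = 0 -> exists2 r : R, 0 < r & forall x, `|x0 - x| < r -> v x = 0.
Proof.
move=> only Ai oO Cv v0 Mv Ox0 vx0.
have sum1 (F : 'I_N -> R) : \sum_k F k = F i.
  by rewrite (bigD1 i) //= big1 ?addr0 // => k; rewrite (only k) eqxx.
have oT : open (setT : set rV) by exact: openT.
pose a x := V x * A x i i; pose b x := c x * V x.
have sa : smooth setT a by exact: (smoothM oT V_smooth (A_smooth i i)).
have sb : smooth setT b by exact: (smoothM oT c_smooth V_smooth).
have a0 : 0 < a x0 by rewrite mulr_gt0.
have b0 x : 0 <= b x by rewrite mulr_ge0 // ltW.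
pose al := a x0 / 2; have al0 : 0 < al by rewrite divr_gt0.
pose be := b x0 + 1; have be0 : 0 < be by rewrite ltr_wpDl.
have /continuous_epsP/(_ _ al0)[d1 d10 Ha] : {for x0, continuous a}.
  exact: (smooth_continuous sa).
have /continuous_epsP/(_ 1 ltr01)[d2 d20 Hb] : {for x0, continuous b}.
  exact: (smooth_continuous sb).
have [d3 d30 HO] := open_ballP oO Ox0.
pose d := Num.min (Num.min d1 d2) (Num.min d3 (Num.min 1 (al / (2 * be)))).
have d0 : 0 < d by rewrite !lt_min d10 d20 d30 ltr01 divr_gt0 // mulr_gt0.
pose r := d / 2; have r0 : 0 < r by rewrite divr_gt0.
have rd : r < d by rewrite ltr_pdivrMr // ltr_pMr // ltr1n.
move: (rd); rewrite !lt_min => /andP[/andP[rd1 rd2] /and3P[rd3 r1 ral]].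
have Kr x : `|x0 - x| <= r -> [/\ Omega x, al <= a x & b x <= be].
  move=> xr; split; first by apply: HO; exact: le_lt_trans xr rd3.
    by have := Ha x (le_lt_trans xr rd1); rewrite ltr_norml /al => /andP[_]; lra.
  by have := Hb x (le_lt_trans xr rd2); rewrite ltr_norml /be => /andP[+ _]; lra.
pose K := [set x | `|x0 - x| <= r].
have K0 : K !=set0 by exists x0; rewrite /K /= subrr normr0 ltW.
have cvK : {within K, continuous v}.
  by apply: continuous_in_subspaceT => x /set_mem/Kr[Ox _ _]; exact: (Ck_continuous Cv).
have [z zK zmax] := EVT_max_rV K0 (@compact_center_ball R N x0 r) cvK.
move/set_mem: zK => zK; have [Oz _ _] := Kr z zK.
have vz0 := v0 z Oz.
have vle x : K x -> v x <= v z by move=> Kx; apply: zmax; exact: mem_set.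
pose flx y := V y * A y i i * partial i v y.
have Cflx : Ck 1 Omega flx.
  by apply: (CkM oO); [exact: Ck_subset (sa 1%N)|exact: Ck_partial Cv].
have dflx x : divform A V v x = partial i flx x.
  by rewrite /divform sum1 sum1.
have dv0 : partial i v x0 = 0.
  have vmin x : Omega x -> v x0 <= v x by rewrite vx0; exact: v0.
  by have [/(_ i)] := local_min_test oO Cv Ox0 vmin.
have side (sg : R) (t : R) : sg ^+ 2 = 1 -> 0 <= t <= r ->
    v (t *: (sg *: delta_mx ord0 i) + x0) <= be * v z * r / al * r.
  move=> sg2 tr; pose w : rV := sg *: delta_mx ord0 i.
  have nsg : `|sg| = 1.
    by apply/eqP; rewrite -(@eqrXn2 _ 2) // expr1n real_normK ?num_real // sg2.
  have wi : w ord0 i = sg by rewrite !mxE !eqxx mulr1.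
  have Kw s : 0 <= s <= r -> K (s *: w + x0).
    move=> /andP[s0 sr]; rewrite /K /= opprD addrCA subrr addr0 normrN !normrZ nsg mul1r.
    rewrite (ger0_norm s0); apply: le_trans sr.
    by rewrite ler_piMr // norm_delta_le.
  apply: (@second_order_bound R (fun s => v (s *: w + x0)) (fun s => sg * partial i v (s *: w + x0))
    (fun s => sg * flx (s *: w + x0)) (fun s => partial i flx (s *: w + x0))
    (fun s => a (s *: w + x0)) r al _ al0 _ _ _ _ _ _ _ _ tr).
  - by rewrite mulr_ge0 // ltW.
  - move=> s /Kw/Kr[Os _ _]; apply: is_derive_eq (is_derive_along oO (Ck_pred Cv) Os) _.
    by rewrite sum1 wi.
  - move=> s /Kw/Kr[Os _ _].
    apply: is_derive_eq (is_deriveZ sg (is_derive_along oO Cflx Os)) _.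
    by rewrite sum1 wi /GRing.scale /= mulrA -expr2 sg2 mul1r.
  - by move=> s /Kw/Kr[_ als _]; split=> //; rewrite /flx /a; ring.
  - move=> s /Kw Ks; have [Os _ bs] := Kr _ Ks; rewrite -dflx.
    have := Mv _ Os; rewrite /Mop subr_le0 -/(b _) => h; apply: le_trans h _.
    apply: ler_pM => //; [exact: v0|exact: vle].
  - by rewrite scale0r add0r.
  - by rewrite scale0r add0r /flx dv0 !mulr0.
have vz : v z <= be * v z * r / al * r.
  have zE : z = (z ord0 i - x0 ord0 i) *: delta_mx ord0 i + x0.
    apply/rowP => k; rewrite (only k) !mxE !eqxx mulr1 subrK //.
  have zr : `|z ord0 i - x0 ord0 i| <= r.
    apply: le_trans zK; rewrite distrC; have := coord_norm_le (x0 - z) i.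
    by rewrite !mxE.
  have [zi|zi] := leP 0 (z ord0 i - x0 ord0 i).
    rewrite {1}zE -[delta_mx ord0 i]scale1r; apply: side; first exact: expr1n.
    by rewrite zi -(ger0_norm zi).
  rewrite {1}zE; have -> : (z ord0 i - x0 ord0 i) *: delta_mx ord0 i =
      (- (z ord0 i - x0 ord0 i)) *: (-1 *: (delta_mx ord0 i : rV)).
    by rewrite scaleN1r scalerN scaleNr opprK.
  apply: side; first by rewrite sqrrN expr1n.
  by rewrite oppr_ge0 (ltW zi) -(ltr0_norm zi).
have vzz : v z = 0.
  have ber : be * r <= al / 2.
    move: (ltW ral); rewrite ler_pdivlMr ?mulr_gt0 //; lra.
  have : be * v z * r / al * r <= v z / 2.
    have -> : be * v z * r / al * r = v z * (be * r / al * r) by ring.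
    rewrite ler_wpM2l //; apply: (@le_trans _ _ (2^-1 * 1)); last by rewrite mulr1.
    have h1 : be * r / al <= 2^-1 by rewrite ler_pdivrMr // [leRHS]mulrC.
    have h2 : 0 <= be * r / al by rewrite divr_ge0 ?mulr_ge0 // ltW.
    exact: ler_pM h2 (ltW r0) h1 (ltW r1).
  by move=> h; apply/eqP; rewrite eq_le vz0 andbT; lra.
exists r => // x /ltW xr; have [Ox _ _] := Kr x xr.
by apply/eqP; rewrite eq_le v0 // andbT -vzz vle.
Qed.

Lemma local_vanishing Omega v x0 : open Omega -> Ck 2 Omega v ->
  (forall x, Omega x -> 0 <= v x) -> (forall x, Omega x -> M v x <= 0) ->
  Omega x0 -> v x0 = 0 -> exists2 r : R, 0 < r & forall x, `|x0 - x| < r -> v x = 0.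
Proof.
move=> oO Cv v0 Mv Ox0 vx0; have [i Ai] := A_diag_gt0 x0.
have [[k ki]|only] := pselect (exists k, k != i).
  exact: (local_vanishing_ge2
    ki oO Cv v0 Mv Ox0 vx0).
apply: (local_vanishing_1 _ Ai oO Cv v0 Mv Ox0 vx0) => k.
by apply/eqP; apply: contrapT => /negP ki; apply: only; exists k.
Qed.

Lemma MopE u x : M u x = V x * Lc V A c u x.
Proof.
rewrite /Mop /Lc mulrBr mulrA mulfV ?mul1r ?gt_eqF //; congr (_ - _).
by rewrite mulrA [V x * c x]mulrC.
Qed.

End Operators.

(** * The strong maximum principle *)

Theorem mainTheorem8 (R : realType) (N : nat)
    (V : 'rV[R]_N -> R) (A : 'rV[R]_N -> 'M[R]_N) (c : 'rV[R]_N -> R)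
    (V_smooth : smooth setT V) (V_gt0 : forall x, 0 < V x)
    (A_smooth : forall i j, smooth setT (fun x => A x i j))
    (A_sym : forall x, (A x)^T = A x)
    (A_psd : forall (x xi : 'rV[R]_N), 0 <= (xi *m A x *m xi^T) ord0 ord0)
    (A_neq0 : forall x, A x != 0)
    (c_smooth : smooth setT c) (c_ge0 : forall x, 0 <= c x)
    (Lc_hypo : forall Omega : set 'rV[R]_N,
       open Omega -> hypoelliptic (Lc_distr V A c) Omega)
    (Omega : set 'rV[R]_N) (Omega_open : open Omega)
    (Omega_conn : connected Omega)
    (u : 'rV[R]_N -> R) (u_C2 : Ck 2 Omega u)
    (Lc_u_ge0 : forall x, Omega x -> 0 <= Lc V A c u x)
    (u_max : exists2 x0, Omega x0 &
       0 <= u x0 /\ forall x, Omega x -> u x <= u x0) :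
  forall x y, Omega x -> Omega y -> u x = u y.
Proof.
have [x0 Ox0 [ux0 umax]] := u_max.
pose v x := -1 * u x + u x0.
have Cv : Ck 2 Omega v by exact: (CkD Omega_open (CkZ (-1) Omega_open u_C2) (Ck_cst 2 Omega (u x0))).
have v0 x : Omega x -> 0 <= v x by move=> /umax; rewrite /v mulN1r; lra.
have Mv x : Omega x -> Mop V A c v x <= 0.
  move=> Ox; rewrite (MopDZ c V_smooth A_smooth (-1) Omega_open u_C2 (Ck_cst 2 Omega (u x0)) Ox).
  rewrite Mop_cst (MopE A c V_gt0) mulN1r -opprD oppr_le0 addr_ge0 //.
    by rewrite mulr_ge0 ?Lc_u_ge0 // ltW.
  by rewrite !mulr_ge0 // ltW.
pose Z := [set x | v x = 0].
have zeros : Omega `&` Z = Omega.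
  apply: Omega_conn; first by exists x0; split=> //; rewrite /Z /= /v mulN1r addNr.
  - exists (interior Z); first exact: open_interior.
    apply/seteqP; split=> x [Ox Zx]; split=> //; last exact: interior_subset Zx.
    have [r r0 vr] := local_vanishing V_smooth V_gt0 A_smooth A_sym A_psd A_neq0 c_smooth c_ge0 Lc_hypo
      Omega_open Cv v0 Mv Ox Zx.
    by apply/nbhs_ballP; exists r => // y; rewrite -ball_normE => /vr.
  - exists (closure (Omega `&` Z)); first exact: closed_closure.
    apply/seteqP; split=> x [Ox Zx]; split=> //.
      by apply: subset_closure; split.
    apply/eqP; rewrite eq_le v0 // andbT leNgt; apply/negP => vx.
    have oP : open (Omega `&` [set y | 0 < v y]).
      by apply: open_superlevel => // y; exact: Ck_continuous Cv.
    have [y [_ /= vy] [_ /=]] := closure_meets oP (conj Ox vx) Zx.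
    by rewrite vy ltxx.
have uE x : Omega x -> u x = u x0.
  by rewrite -zeros => -[_]; rewrite /Z /= /v mulN1r; lra.
by move=> x y /uE-> /uE->.
Qed.
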